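(* There exists a universal constant $C>0$ such that the following holds. Let $\Omega\subset\mathbb R^2$ be a bounded domain with smooth boundary having $n$ holes. Then for every closed potential $1$-form $A$ on $\Omega$, $$\lambda_1(\Omega,A)\le C\,\frac{n}{|\Omega|}.$$ One can take $C=544\pi$.
   Context: A domain is a connected open set; $|\Omega|$ denotes its area. A bounded domain $\Omega\subset\mathbb R^2$ with smooth boundary has $n$ holes if its boundary consists of one outer closed curve $\Sigma_0$ and $n$ inner closed curves $\Sigma_1,\dots,\Sigma_n$ (equivalently, $\mathbb R^2\setminus\Omega$ has $n$ bounded connected components). A potential is a smooth real $1$-form $A$ (smooth up to the boundary of $\Omega$); it is closed if $dA=0$. For complex-valued $u$, set $\nabla^A u=\nabla u-iuA^{\sharp}$, where $A^\sharp$ is the vector field dual to $A$. The magnetic Laplacian is $\Delta_A=(\nabla^A)^\star\nabla^A$, considered with magnetic Neumann boundary conditions $\nabla^A_N u=0$ on $\partial\Omega$ ($N$ the inner unit normal). Its lowest eigenvalue is $$\lambda_1(\Omega,A)=\min\left\{\frac{\int_\Omega|\nabla^A u|^2}{\int_\Omega|u|^2}:\ u\in H^1(\Omega,\mathbb C)\setminus\{0\}\right\}.$$ *)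

(* Defs.v *)
From HB Require Import structures.
From mathcomp Require Import all_boot all_order all_algebra.
From mathcomp Require Import all_classical all_reals all_analysis.
From mathcomp Require Import complex.

Set Implicit Arguments.
Unset Strict Implicit.
Unset Printing Implicit Defensive.

Import Order.TTheory GRing.Theory Num.Theory.
Import numFieldNormedType.Exports.

Local Open Scope classical_set_scope.
Local Open Scope ring_scope.

Notation plane R := (R * R)%type.

Definition dx (R : realType) : plane R := (1, 0).
Definition dy (R : realType) : plane R := (0, 1).

(* Partial derivatives only see germs, so for open [U] these notions depend
   only on the restriction of [f] to [U]. *)
Fixpoint Ck_on (R : realType) (k : nat) (U : set (plane R))
    (f : plane R -> R) : Prop :=
  (forall p, U p -> {for p, continuous f}) /\
  if k is k'.+1 then
    (forall p, U p -> derivable f p (dx R) /\ derivable f p (dy R)) /\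
    Ck_on k' U ('D_(dx R) f) /\ Ck_on k' U ('D_(dy R) f)
  else True.

Definition smooth_on (R : realType) (U : set (plane R)) (f : plane R -> R) :=
  forall k, Ck_on k U f.

(* Smoothness up to the boundary: [f] on [Omega] is the restriction of a
   smooth function defined in an open neighbourhood of the closure; the values
   of [f] outside [Omega] are irrelevant. *)
Definition smooth_upto_boundary (R : realType) (Omega : set (plane R))
    (f : plane R -> R) :=
  exists (U : set (plane R)) (g : plane R -> R),
    [/\ open U, closure Omega `<=` U, smooth_on U g &
        forall p, Omega p -> f p = g p].

Definition domain (R : realType) (Omega : set (plane R)) :=
  [/\ Omega !=set0, open Omega & connected Omega].

Definition frontier (R : realType) (Omega : set (plane R)) : set (plane R) :=
  closure Omega `\` interior Omega.

(* Near each boundary point, [Omega] is a strict sublevel set of a smooth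
   function without critical points. *)
Definition smooth_boundary (R : realType) (Omega : set (plane R)) :=
  forall p, frontier Omega p ->
  exists (U : set (plane R)) (rho : plane R -> R),
    [/\ open U, U p, smooth_on U rho,
        (forall q, U q -> 'D_(dx R) rho q != 0 \/ 'D_(dy R) rho q != 0) &
        forall q, U q -> (Omega q <-> rho q < 0)].

(* Smooth simple closed curves, with a regular 1-periodic parametrization. *)
Definition smooth_closed_curve (R : realType) (S : set (plane R)) :=
  exists x y : R -> R,
    [/\ (forall k t, derivable (derive1n k x) t 1 /\ derivable (derive1n k y) t 1),
        (forall t, x (t + 1) = x t /\ y (t + 1) = y t),
        (forall t, derive1 x t != 0 \/ derive1 y t != 0),
        (forall s t, 0 <= s < 1 -> 0 <= t < 1 ->
           x s = x t -> y s = y t -> s = t) &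
        S = [set (x t, y t) | t in setT]].

(* [Sigma 0] is the outer curve: [Omega] lies in the bounded component of its
   complement.  The other curves are inner: [Omega] lies in the unbounded
   component of their complements. *)
Definition has_holes (R : realType) (n : nat) (Omega : set (plane R)) :=
  exists Sigma : 'I_n.+1 -> set (plane R),
    [/\ forall i, smooth_closed_curve (Sigma i),
        forall i j, i != j -> Sigma i `&` Sigma j = set0,
        frontier Omega = \bigcup_i Sigma i,
        forall p, Omega p ->
          bounded_set (connected_component (~` Sigma ord0) p) &
        forall (i : 'I_n.+1) p, i != ord0 -> Omega p ->
          ~ bounded_set (connected_component (~` Sigma i) p)].

(* The 1-form (A p).1 dx + (A p).2 dy. *)
Definition potential (R : realType) (Omega : set (plane R))
    (A : plane R -> plane R) :=
  smooth_upto_boundary Omega (fst \o A) /\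
  smooth_upto_boundary Omega (snd \o A).

Definition closed_form (R : realType) (Omega : set (plane R))
    (A : plane R -> plane R) :=
  forall p, Omega p ->
    'D_(dx R) (snd \o A) p = 'D_(dy R) (fst \o A) p.

(* The library's [lebesgue_measure] lives on [measurableTypeR R], the reals
   with their Borel sigma-algebra; measurability below is Borel, which loses
   nothing up to almost everywhere equality. *)
Definition area (R : realType) :
    {measure set (plane (measurableTypeR R)) -> \bar R} :=
  (@lebesgue_measure R \x @lebesgue_measure R)%E.

Definition test_function (R : realType) (Omega : set (plane R))
    (phi : plane R -> R) :=
  smooth_on setT phi /\
  exists K : set (plane R),
    [/\ compact K, K `<=` Omega & forall p, ~ K p -> phi p = 0].

Definition weak_derivative (R : realType) (Omega : set (plane R))
    (v : plane R) (f g : plane R -> R) :=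
  forall phi, test_function Omega phi ->
    \int[area R]_(p in Omega) (f p * 'D_v phi p) =
    - \int[area R]_(p in Omega) (g p * phi p).

Definition sqnormc (R : realType) (z : R[i]) : R :=
  complex.Re z ^+ 2 + complex.Im z ^+ 2.

Definition L2 (R : realType) (Omega : set (plane (measurableTypeR R)))
    (u : plane (measurableTypeR R) -> R[i]) :=
  [/\ measurable_fun Omega
        (fun p : plane (measurableTypeR R) => complex.Re (u p)),
      measurable_fun Omega
        (fun p : plane (measurableTypeR R) => complex.Im (u p)) &
      (\int[area R]_(p in Omega) (sqnormc (u p))%:E < +oo)%E].

(* Real test functions suffice: the complex-valued identity is equivalent to
   those for the real and imaginary parts. *)
Definition weak_derivativec (R : realType) (Omega : set (plane R))
    (v : plane R) (u g : plane R -> R[i]) :=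
  weak_derivative Omega v (fun p => complex.Re (u p))
                          (fun p => complex.Re (g p)) /\
  weak_derivative Omega v (fun p => complex.Im (u p))
                          (fun p => complex.Im (g p)).

(* [u] belongs to H^1(Omega, C), with weak partial derivatives [ux], [uy]. *)
Definition H1 (R : realType) (Omega : set (plane R))
    (u ux uy : plane R -> R[i]) :=
  [/\ L2 Omega u, L2 Omega ux, L2 Omega uy,
      weak_derivativec Omega (dx R) u ux & weak_derivativec Omega (dy R) u uy].

(* The squared length of grad u - i u A^sharp at [p], where [ux], [uy] are the
   partial derivatives of [u]. *)
Definition magnetic_density (R : realType) (A : plane R -> plane R)
    (u ux uy : plane R -> R[i]) (p : plane R) : R :=
  sqnormc (ux p - 'i%C * u p * ((A p).1)%:C%C) +
  sqnormc (uy p - 'i%C * u p * ((A p).2)%:C%C).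

Definition rayleigh (R : realType) (Omega : set (plane R))
    (A : plane R -> plane R) (u ux uy : plane R -> R[i]) : \bar R :=
  (\int[area R]_(p in Omega) (magnetic_density A u ux uy p)%:E /
   \int[area R]_(p in Omega) (sqnormc (u p))%:E)%E.

(* The infimum is taken in the extended reals.  Elements of H^1 are identified
   when equal almost everywhere, hence the non-vanishing condition. *)
Definition lambda1 (R : realType) (Omega : set (plane R))
    (A : plane R -> plane R) : \bar R :=
  ereal_inf [set q | exists u ux uy,
    [/\ H1 Omega u ux uy,
        ~ {ae area R, forall p, Omega p -> u p = 0} &
        q = rayleigh Omega A u ux uy]].

(* Main.v *)
Require Import Defs.
From HB Require Import structures.
From mathcomp Require Import all_boot all_order all_algebra.
From mathcomp Require Import all_classical all_reals all_analysis.
From mathcomp Require Import measurable_realfun complex ring lra.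
Import Order.TTheory GRing.Theory Num.Theory.
Import numFieldNormedType.Exports.
Set Implicit Arguments.
Unset Strict Implicit.
Unset Printing Implicit Defensive.
Local Open Scope classical_set_scope.
Local Open Scope ring_scope.

(** Let [dth p] be the angular form about [p].  When the segment from [p] to
    [q] misses [Omega], [dth p - dth q] is exact on [Omega]; so the class of
    [dth p], for [p] outside [Omega], does not change along boundary curves and
    is trivial for one of them.  The other [n] curves provide [n] poles [p_j].

    A closed form is, up to an exact one, [(0, b)] with [d b / d x = 0] on
    [Omega].  Cut [b] along a fine grid: a piece whose cell misses [Omega] is
    cohomologous to a multiple of some [dth q], and the pieces whose cells meet
    [Omega] are small.  Hence [A] is exact up to [\sum_j nu_j dth p_j] and an
    error as small as one likes.

    Over a vertical strip of width [2 s], the forms [dth p_j] with [p_j]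
    outside the strip are exact and the other [nu_j] matter only modulo
    integers.  A random rounding of these [nu_j], unbiased, kills the cross
    terms of the energy [|\sum_j (m_j - nu_j) dth p_j|^2] and costs at most a
    quarter of the diagonal ones.  The trial function of the strip is
    [window * f * exp (i psi)], where [f = 1 / (1 + \sum_j r^4 / |z - p_j|^4)]
    tames the poles.  Summing the resulting bounds over all strips and choosing
    [r] and [s] of the order of [sqrt (|Omega| / n)] gives the theorem. *)

(** * Gradients and exact forms *)

(** Rounding every [nu_j] at once on the whole domain would cost, at each pole, the integral of
    [f^2 / |z - p_j|^2], which can grow like the logarithm of [|Omega| / r^2], that is of [n]; a
    bound linear in [n] would be lost. In a strip only the poles inside it are rounded, and over a
    band of width [4 s] this integral is at most a multiple of [s / r]. The windows in turn cost
    [|Omega| / s^2]. The cutoff costs a multiple of [n], because [1 - f] has integral of order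
    [n r^2] and [|grad f|^2 <= 2 (1 - f) / r^2].

    The minimum principle is used in each strip in the form [lambda * mass <= energy], so that the
    strips are summed and none has to be selected.

    On the topological side no period is computed along curves: cohomology classes are compared by
    explicit primitives, made of arctangents and of integrals along lines, and the poles are placed
    on the boundary curves. The small error comes from the cells across the boundary, where the
    extended form need not be closed; it only has to be small in the mean square. *)

Section Gradients.
Variable R : realType.
Implicit Types (f g : plane R -> R) (p q : plane R).

(* Weaker than differentiability: continuity and partial derivatives. *)
Definition has_grad f p (a b : R) :=
  [/\ {for p, continuous f},
      is_derive p.1 (1 : R) (fun t => f (t, p.2)) a &
      is_derive p.2 (1 : R) (fun t => f (p.1, t)) b].

Lemma has_grad_eq f p a b a' b' :
  has_grad f p a b -> a = a' -> b = b' -> has_grad f p a' b'.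
Proof. by move=> ? <- <-. Qed.

Lemma continuous_pair (T : topologicalType) (f g : T -> R) x :
  {for x, continuous f} -> {for x, continuous g} ->
  {for x, continuous (fun t => (f t, g t) : plane R)}.
Proof.
by move=> cf cg; exact: (@cvg_pair _ _ _ (nbhs x) (nbhs (f x)) (nbhs (g x))
  _ _ _ f g cf cg).
Qed.

Lemma near_slice1 p (P : plane R -> Prop) :
  (\forall q \near p, P q) -> \forall t \near p.1, P (t, p.2).
Proof.
move=> nP; have := @continuous_pair R id (cst p.2) p.1 _ _.
move=> /(_ (@cvg_id _ _) (@cvg_cst _ _ _ _ _) P); apply.
by rewrite /= -surjective_pairing.
Qed.

Lemma near_slice2 p (P : plane R -> Prop) :
  (\forall q \near p, P q) -> \forall t \near p.2, P (p.1, t).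
Proof.
move=> nP; have := @continuous_pair R (cst p.1) id p.2 _ _.
move=> /(_ (@cvg_cst _ _ _ _ _) (@cvg_id _ _) P); apply.
by rewrite /= -surjective_pairing.
Qed.

Lemma has_grad_near f g p a b :
  (\forall q \near p, f q = g q) -> has_grad f p a b -> has_grad g p a b.
Proof.
move=> fg [cf fx fy]; split.
- have e := nbhs_singleton fg.
  have cf' : f @ p --> g p by rewrite -e; exact: cf.
  by apply: cvg_trans cf'; apply: near_eq_cvg.
- apply: (near_eq_is_derive _ fx); exact: (near_slice1 fg).
- apply: (near_eq_is_derive _ fy); exact: (near_slice2 fg).
Qed.

Lemma has_grad_ext f g p a b :
  (forall q, f q = g q) -> has_grad f p a b -> has_grad g p a b.
Proof. by move=> /funext ->. Qed.

Lemma has_grad_cst (c : R) p : has_grad (fun=> c) p 0 0.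
Proof. by split; [apply: cvg_cst | apply: is_derive_cst | apply: is_derive_cst]. Qed.

Lemma has_grad_fst p : has_grad fst p 1 0.
Proof. by split; [apply: cvg_fst | apply: is_derive_id | apply: is_derive_cst]. Qed.

Lemma has_grad_snd p : has_grad snd p 0 1.
Proof. by split; [apply: cvg_snd | apply: is_derive_cst | apply: is_derive_id]. Qed.

Lemma has_gradD f g p a b c d :
  has_grad f p a b -> has_grad g p c d ->
  has_grad (fun q => f q + g q) p (a + c) (b + d).
Proof.
move=> [cf fx fy] [cg gx gy]; split; first by apply: cvgD.
- by have := is_deriveD fx gx.
- by have := is_deriveD fy gy.
Qed.

Lemma has_gradM f g p a b c d :
  has_grad f p a b -> has_grad g p c d ->
  has_grad (fun q => f q * g q) p (f p * c + g p * a) (f p * d + g p * b).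
Proof.
move=> [cf fx fy] [cg gx gy]; split; first by apply: cvgM.
- by have := is_deriveM fx gx; rewrite -!surjective_pairing.
- by have := is_deriveM fy gy; rewrite -!surjective_pairing.
Qed.

Lemma has_grad_comp (F : R -> R) f p a b c :
  is_derive (f p) (1 : R) F c -> has_grad f p a b ->
  has_grad (fun q => F (f q)) p (c * a) (c * b).
Proof.
move=> Fc [cf fx fy]; split.
- apply: continuous_comp => //.
  by apply/differentiable_continuous/derivable1_diffP; case: Fc.
- by apply: (@is_derive1_comp R F (fun t => f (t, p.2))) => //;
    rewrite -surjective_pairing.
- by apply: (@is_derive1_comp R F (fun t => f (p.1, t))) => //;
    rewrite -surjective_pairing.
Qed.

Lemma has_gradZ (k : R) f p a b :
  has_grad f p a b -> has_grad (fun q => k * f q) p (k * a) (k * b).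
Proof.
move=> gf; apply: (has_grad_eq (has_gradM (has_grad_cst k p) gf));
  by rewrite mulr0 addr0.
Qed.

Lemma has_gradN f p a b :
  has_grad f p a b -> has_grad (fun q => - f q) p (- a) (- b).
Proof.
move=> /(has_gradZ (-1)); rewrite !mulN1r => h.
by apply: has_grad_ext h => q; rewrite mulN1r.
Qed.

Lemma has_gradB f g p a b c d :
  has_grad f p a b -> has_grad g p c d ->
  has_grad (fun q => f q - g q) p (a - c) (b - d).
Proof. by move=> gf /has_gradN; apply: has_gradD. Qed.

Lemma has_gradV f p a b : f p != 0 ->
  has_grad f p a b ->
  has_grad (fun q => (f q)^-1) p (- (f p) ^- 2 * a) (- (f p) ^- 2 * b).
Proof.
move=> fp0; apply: has_grad_comp.
have := @is_deriveV R id (f p) 1 1 fp0 _.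
by rewrite /= [_ *: 1]mulr1 => h; apply: h.
Qed.

Lemma has_gradX f p a b n :
  has_grad f p a b ->
  has_grad (fun q => f q ^+ n) p (n%:R * f p ^+ n.-1 * a) (n%:R * f p ^+ n.-1 * b).
Proof.
move=> gf; apply: (@has_grad_comp (fun t => t ^+ n)) gf.
have /= h := @is_deriveX R R id n (f p) 1 1 (is_derive_id _ _).
have <- : id ^+ n = (fun t : R => t ^+ n) by rewrite exprfctE.
by rewrite [_ *: 1]mulr1 in h.
Qed.

Lemma has_grad_sum (I : Type) (r : seq I) (P : pred I) (F : I -> plane R -> R) a b p :
  (forall i, P i -> has_grad (F i) p (a i) (b i)) ->
  has_grad (fun q => \sum_(i <- r | P i) F i q) p
    (\sum_(i <- r | P i) a i) (\sum_(i <- r | P i) b i).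
Proof.
move=> h; elim: r => [|i r ih].
  rewrite !big_nil; apply: has_grad_ext (has_grad_cst 0 p) => q.
  by rewrite big_nil.
rewrite !big_cons; case: ifPn => Pi; last first.
  by apply: has_grad_ext ih => q; rewrite big_cons (negbTE Pi).
by apply: has_grad_ext (has_gradD (h i Pi) ih) => q; rewrite big_cons Pi.
Qed.

Lemma has_grad_swap f p a b :
  has_grad f p a b -> has_grad (fun q => f (q.2, q.1)) (p.2, p.1) b a.
Proof.
case: p => x y [cf fx fy]; split => //=.
rewrite /continuous_at /=; apply: (@cvg_comp _ _ _ (fun q : plane R => (q.2, q.1)) f) cf.
exact: (@continuous_pair _ snd fst (y, x) cvg_snd cvg_fst).
Qed.

Lemma is_derive_dx f p (a : R) :
  is_derive p (dx R) f a <-> is_derive p.1 (1 : R) (fun t => f (t, p.2)) a.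
Proof.
have E : (fun h : R => h^-1 *: ((f \o shift p) (h *: dx R) - f p)) =
   (fun h : R => h^-1 *: (((fun t => f (t, p.2)) \o shift p.1) (h *: 1) - f (p.1, p.2))).
  apply/funext => h /=; rewrite -surjective_pairing; congr (_ *: (f _ - _)).
  by rewrite /GRing.add /GRing.scale /= /add_pair /scale_pair /= [_ *: 0]mulr0 add0r.
have E1 : derivable f p (dx R) = derivable (fun t => f (t, p.2)) p.1 1.
  by rewrite /derivable E.
have E2 : 'D_(dx R) f p = 'D_1 (fun t => f (t, p.2)) p.1.
  by rewrite /derive E.
by split=> -[h1 h2]; split; rewrite ?E1 ?E2 // -?E1 -?E2.
Qed.

Lemma is_derive_dy f p (a : R) :
  is_derive p (dy R) f a <-> is_derive p.2 (1 : R) (fun t => f (p.1, t)) a.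
Proof.
have E : (fun h : R => h^-1 *: ((f \o shift p) (h *: dy R) - f p)) =
   (fun h : R => h^-1 *: (((fun t => f (p.1, t)) \o shift p.2) (h *: 1) - f (p.1, p.2))).
  apply/funext => h /=; rewrite -surjective_pairing; congr (_ *: (f _ - _)).
  by rewrite /GRing.add /GRing.scale /= /add_pair /scale_pair /= [_ *: 0]mulr0 add0r.
have E1 : derivable f p (dy R) = derivable (fun t => f (p.1, t)) p.2 1.
  by rewrite /derivable E.
have E2 : 'D_(dy R) f p = 'D_1 (fun t => f (p.1, t)) p.2.
  by rewrite /derive E.
by split=> -[h1 h2]; split; rewrite ?E1 ?E2 // -?E1 -?E2.
Qed.

Lemma has_grad_derive f p a b : has_grad f p a b ->
  'D_(dx R) f p = a /\ 'D_(dy R) f p = b.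
Proof. by move=> [_ /is_derive_dx[_ ?] /is_derive_dy[_ ?]]. Qed.

Lemma derivable_has_grad f p : {for p, continuous f} ->
  derivable f p (dx R) -> derivable f p (dy R) ->
  has_grad f p ('D_(dx R) f p) ('D_(dy R) f p).
Proof. move=> cf fx fy; split; first exact: cf.
- by apply/is_derive_dx; apply: DeriveDef.
- by apply/is_derive_dy; apply: DeriveDef.
Qed.

Definition exact_on (V : set (plane R)) (w : plane R -> plane R) :=
  exists phi, forall p, V p -> has_grad phi p (w p).1 (w p).2.

Lemma exact_on_eq V w w' :
  (forall p, V p -> w p = w' p) -> exact_on V w -> exact_on V w'.
Proof. by move=> e [phi h]; exists phi => p Vp; rewrite -e //; apply: h. Qed.

Lemma exact_onW V V' w : V `<=` V' -> exact_on V' w -> exact_on V w.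
Proof. by move=> VV [phi h]; exists phi => p /VV/h. Qed.

Lemma exact_on0 V : exact_on V (fun=> 0).
Proof. by exists (fun=> 0) => p _; apply: has_grad_cst. Qed.

Lemma exact_onD V w w' :
  exact_on V w -> exact_on V w' -> exact_on V (fun p => w p + w' p).
Proof.
by move=> [f hf] [g hg]; exists (fun p => f p + g p) => p Vp;
  apply: has_gradD; [apply: hf | apply: hg].
Qed.

Lemma exact_onZ (k : R) V w : exact_on V w -> exact_on V (fun p => k *: w p).
Proof. by move=> [f hf]; exists (fun p => k * f p) => p Vp; apply/has_gradZ/hf. Qed.

Lemma exact_onN V w : exact_on V w -> exact_on V (fun p => - w p).
Proof.
by move=> /(exact_onZ (-1)); apply: exact_on_eq => p _; rewrite scaleN1r.
Qed.

End Gradients.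

(** * Angular forms and branches of the angle *)

Section AngularForms.
Variable R : realType.
Implicit Types (p q z : plane R) (V : set (plane R)).

Definition rho2 p z : R := (z.1 - p.1) ^+ 2 + (z.2 - p.2) ^+ 2.

(* The angular form about [p]; it is [0] at [p], where it divides by [0]. *)
Definition dth p z : plane R :=
  (- (z.2 - p.2) / rho2 p z, (z.1 - p.1) / rho2 p z).

Lemma rho2_ge0 p z : 0 <= rho2 p z.
Proof. by rewrite addr_ge0 ?sqr_ge0. Qed.

Lemma rho2_eq0 p z : (rho2 p z == 0) = (z == p).
Proof.
rewrite paddr_eq0 ?sqr_ge0 // !sqrf_eq0 !subr_eq0.
by case: z p => [a b] [c d].
Qed.

Lemma rho2_gt0 p z : z != p -> 0 < rho2 p z.
Proof. by move=> zp; rewrite lt_def rho2_ge0 rho2_eq0 zp. Qed.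

Lemma has_grad_fstB p z : has_grad (fun z => z.1 - p.1) z 1 0.
Proof.
by apply: has_grad_eq (has_gradB (has_grad_fst z) (has_grad_cst p.1 z)) _ _;
  rewrite subr0.
Qed.

Lemma has_grad_sndB p z : has_grad (fun z => z.2 - p.2) z 0 1.
Proof.
by apply: has_grad_eq (has_gradB (has_grad_snd z) (has_grad_cst p.2 z)) _ _;
  rewrite subr0.
Qed.

(** On either side of the vertical line through [p], this arctangent is a branch of the angle about
    [p]. *)
Lemma has_grad_atan_yx p z : z.1 != p.1 ->
  has_grad (fun z => atan ((z.2 - p.2) / (z.1 - p.1))) z (dth p z).1 (dth p z).2.
Proof.
rewrite -subr_eq0 => X0.
have h := has_gradM (has_grad_sndB p z) (has_gradV X0 (has_grad_fstB p z)).
apply: has_grad_eq (has_grad_comp (is_derive1_atan _) h) _ _.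
all: rewrite /dth /rho2 /=; set X := z.1 - p.1 in X0 *; set Y := z.2 - p.2.
all: have X2 : 0 < X ^+ 2 by rewrite exprn_even_gt0.
all: have n1 : X ^+ 2 + Y ^+ 2 != 0 by rewrite gt_eqF // ltr_wpDr // sqr_ge0.
all: have n2 : 1 + (Y / X) ^+ 2 != 0 by rewrite gt_eqF // ltr_wpDr // sqr_ge0.
all: by field; rewrite X0 n1.
Qed.

Lemma has_grad_atan_xy p z : z.2 != p.2 ->
  has_grad (fun z => - atan ((z.1 - p.1) / (z.2 - p.2))) z (dth p z).1 (dth p z).2.
Proof.
rewrite -subr_eq0 => Y0.
have h := has_gradM (has_grad_fstB p z) (has_gradV Y0 (has_grad_sndB p z)).
apply: has_grad_eq (has_gradN (has_grad_comp (is_derive1_atan _) h)) _ _.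
all: rewrite /dth /rho2 /=; set X := z.1 - p.1; set Y := z.2 - p.2 in Y0 *.
all: have Y2 : 0 < Y ^+ 2 by rewrite exprn_even_gt0.
all: have n1 : X ^+ 2 + Y ^+ 2 != 0 by rewrite gt_eqF // ltr_wpDl // sqr_ge0.
all: by field; rewrite Y0 n1.
Qed.

Lemma atanV_gt0 (u : R) : 0 < u -> atan u^-1 = pi / 2 - atan u.
Proof.
move=> u0; have a0 : 0 < atan u by rewrite -atan0 lt_atan.
have a1 := atan_ltpi2 u.
rewrite -[RHS]tanK; last by rewrite in_itv /=; apply/andP; split; lra.
congr atan; rewrite /tan.
have -> : sin (pi / 2 - atan u) = cos (atan u).
  by rewrite sinB sin_pihalf cos_pihalf mul1r mul0r subr0.
have -> : cos (pi / 2 - atan u) = sin (atan u).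
  by rewrite cosB sin_pihalf cos_pihalf mul1r mul0r add0r.
by rewrite -[u in LHS]atanK /tan invf_div.
Qed.

Lemma atanV_lt0 (u : R) : u < 0 -> atan u^-1 = - (pi / 2) - atan u.
Proof.
move=> u0; have := @atanV_gt0 (- u); rewrite oppr_gt0 => /(_ u0).
rewrite invrN !atanN; lra.
Qed.

(** For each sign, [atan u + atan u^-1] is a constant, so the constants of [u] and [v] cancel when
    the signs agree. This is what lets a difference of two angles cross a line where the single
    branches jump. *)
Lemma atanB_V (u v : R) : 0 < u * v -> atan u - atan v = atan v^-1 - atan u^-1.
Proof.
case: (ltgtP u 0) => [u0|u0|->]; last by rewrite mul0r ltxx.
- rewrite nmulr_rgt0 // => v0; rewrite !atanV_lt0 //; lra.
- rewrite pmulr_rgt0 // => v0; rewrite !atanV_gt0 //; lra.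
Qed.

Lemma near_gt0 (f : plane R -> R) z : {for z, continuous f} -> 0 < f z ->
  \forall q \near z, 0 < f q.
Proof. by move=> cf fz; apply: (@cvgr_gt _ _ _ _ f (f z) cf). Qed.

Lemma exact_dth_off_line V p : (forall z, V z -> z.1 != p.1) ->
  exact_on V (dth p).
Proof.
by move=> h; exists (fun z => atan ((z.2 - p.2) / (z.1 - p.1))) => z /h;
  apply: has_grad_atan_yx.
Qed.

(** The difference of the angles about the two ends is the angle under which the segment is seen, a
    single-valued function off the segment. *)
Lemma exact_dth_hsegment V (a b y : R) : a <= b ->
  (forall z, V z -> z.2 = y -> a <= z.1 <= b -> False) ->
  exact_on V (fun z => dth (b, y) z - dth (a, y) z).
Proof.
move=> ab h; exists (fun z => - atan ((z.1 - b) / (z.2 - y)) - - atan ((z.1 - a) / (z.2 - y))).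
move=> z Vz; have [zy|zy] := eqVneq z.2 y; last first.
  by apply: has_gradB; [apply: (@has_grad_atan_xy (b, y)) | apply: (@has_grad_atan_xy (a, y))].
have zab : 0 < (z.1 - a) * (z.1 - b).
  have /negP := h z Vz zy; rewrite negb_and -!ltNge => /orP[za|zb].
    by rewrite nmulr_rgt0; lra.
  by rewrite pmulr_rgt0; lra.
have zb : z.1 != b by move: zab; apply: contraTneq => ->; rewrite subrr mulr0 ltxx.
have za : z.1 != a by move: zab; apply: contraTneq => ->; rewrite subrr mul0r ltxx.
(* On the line of the segment but off the segment, both abscissas [z.1 - a] and [z.1 - b] have the
   same sign; nearby, the primitive equals the difference of the branches [atan (Y / X)]. *)
apply: has_grad_near (has_gradB (@has_grad_atan_yx (b, y) z zb) (@has_grad_atan_yx (a, y) z za)).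
have /near_gt0 : {for z, continuous (fun z : plane R => (z.1 - a) * (z.1 - b))}.
  by have [] := has_gradM (has_grad_fstB (a, y) z) (has_grad_fstB (b, y) z).
move=> /(_ zab); apply: filterS => q /= qab.
(* On the line itself both quotients by [0] are [0], which happens to be the right value of the
   primitive. *)
have [->|qy] := eqVneq q.2 y; first by rewrite !subrr invr0 !mul0r !mulr0 !atan0 !oppr0.
rewrite -subr_eq0 in qy.
have := @atanB_V ((q.1 - a) / (q.2 - y)) ((q.1 - b) / (q.2 - y)).
rewrite mulrACA -expr2 pmulr_lgt0 ?exprn_even_gt0 ?invr_eq0 // => /(_ qab).
by rewrite !invf_div => <-; rewrite opprK addrC.
Qed.

(* Exchanging the coordinates changes the sign of angular forms. *)
Lemma exact_dthB_swap V p q :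
  exact_on [set z | V (z.2, z.1)]
    (fun z => dth (p.2, p.1) z - dth (q.2, q.1) z) ->
  exact_on V (fun z => dth p z - dth q z).
Proof.
move=> [phi hphi]; exists (fun z => - phi (z.2, z.1)) => z Vz.
have Vz' : V ((z.2, z.1).2, (z.2, z.1).1) by rewrite /= -surjective_pairing.
have := has_gradN (has_grad_swap (hphi (z.2, z.1) Vz')).
rewrite /= -surjective_pairing => g; apply: (has_grad_eq g).
all: have e c : rho2 (c.2, c.1) (z.2, z.1) = rho2 c z by rewrite /rho2 addrC.
all: by rewrite !e; ring.
Qed.

(* The periods of [(0, b)] and [nu *: dth q] around the box of half-side [h] at
   [q] agree; the primitive is pieced together from branches of the angle on
   the right, left, upper and lower sides of the box. *)
Lemma exact_box V q (h nu : R) (P be : R -> R) (b : plane R -> R) :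
  0 < h ->
  (forall z, V z -> h < `|z.1 - q.1| \/ h < `|z.2 - q.2|) ->
  (forall y, is_derive y (1 : R) P (be y)) ->
  (forall y, y < q.2 - h -> P y = 0) ->
  (forall y, q.2 + h < y -> P y = 2 * pi * nu) ->
  (forall z, q.1 + h < z.1 -> b z = be z.2) ->
  (forall z, z.1 < q.1 - h -> b z = 0) ->
  (forall z, h < `|z.2 - q.2| -> b z = 0) ->
  exact_on V (fun z => (0, b z) - nu *: dth q z).
Proof.
move=> h0 Vbox dP P0 P1 b1 b2 b3.
pose X z := z.1 - q.1; pose Y z := z.2 - q.2.
(* The additive constants make neighbouring branches agree beyond the corners of the box. One turn
   around the box changes the angle term by [2 * pi * nu]; the rise of [P] from [0] to [2 * pi * nu]
   along the right side makes up for it. *)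
pose phi z := if h < X z then P z.2 - nu * atan (Y z / X z) else
  if X z < - h then nu * pi - nu * atan (Y z / X z) else
  if h < Y z then 2 * pi * nu - nu * (pi / 2) + nu * atan (X z / Y z) else
  nu * (pi / 2) + nu * atan (X z / Y z).
have phiT z : h < Y z -> phi z = 2 * pi * nu - nu * (pi / 2) + nu * atan (X z / Y z).
  move=> hY; rewrite /phi hY; case: ifPn => hX.
    rewrite P1 ?ltrBrDl // -1?ltrBrDl //.
    rewrite -[X z / Y z]invf_div atanV_gt0 ?divr_gt0 ?(lt_trans h0) //; lra.
  case: ifPn => // hX'.
  have X0 : X z < 0 by rewrite (lt_trans hX') // oppr_lt0.
  rewrite -[X z / Y z]invf_div atanV_lt0; first lra.
  by rewrite pmulr_rlt0 ?(lt_trans h0) // invr_lt0.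
have phiB z : Y z < - h -> phi z = nu * (pi / 2) + nu * atan (X z / Y z).
  move=> hY; have Y0 : Y z < 0 by rewrite (lt_trans hY) // oppr_lt0.
  rewrite /phi; have -> : (h < Y z) = false by apply/negbTE; rewrite -leNgt; lra.
  case: ifPn => hX.
    rewrite P0; last by move: hY; rewrite /Y; lra.
    rewrite -[X z / Y z]invf_div atanV_lt0; first lra.
    by rewrite nmulr_rlt0 // invr_gt0 (lt_trans h0).
  case: ifPn => // hX'.
  have X0 : X z < 0 by rewrite (lt_trans hX') // oppr_lt0.
  rewrite -[X z / Y z]invf_div atanV_gt0; first lra.
  by rewrite nmulr_rgt0 // invr_lt0.
exists phi => z Vz.
have near_X (c d : R) : 0 < c * X z + d -> \forall z' \near z, 0 < c * X z' + d.
  apply: near_gt0.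
  by have [] := has_gradD (has_gradZ c (has_grad_fstB q z)) (has_grad_cst d z).
have near_Y (c d : R) : 0 < c * Y z + d -> \forall z' \near z, 0 < c * Y z' + d.
  apply: near_gt0.
  by have [] := has_gradD (has_gradZ c (has_grad_sndB q z)) (has_grad_cst d z).
have : [\/ h < X z, X z < - h, h < Y z | Y z < - h].
  case: (Vbox z Vz); rewrite lter_normr => /orP[]; rewrite ?[h < - _]ltrNr => ?.
  - exact: Or41.
  - exact: Or42.
  - exact: Or43.
  - exact: Or44.
case=> hz.
- have nX : z.1 != q.1 by rewrite -subr_eq0 gt_eqF // (lt_trans h0).
  have gP : has_grad (fun z => P z.2) z 0 (be z.2).
    by apply: has_grad_eq (has_grad_comp (dP z.2) (has_grad_snd z)) _ _;
      rewrite ?mulr0 ?mulr1.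
  have g := has_gradB gP (has_gradZ nu (has_grad_atan_yx nX)).
  rewrite b1; last by move: hz; rewrite /X; lra.
  apply: has_grad_near g.
  have := near_X 1 (- h); rewrite mul1r subr_gt0 => /(_ hz).
  by apply: filterS => z' /=; rewrite mul1r subr_gt0 /phi => ->.
- have nX : z.1 != q.1 by rewrite -subr_eq0 lt_eqF // (lt_trans hz) // oppr_lt0.
  have g := has_gradB (has_grad_cst (nu * pi) z) (has_gradZ nu (has_grad_atan_yx nX)).
  rewrite b2; last by move: hz; rewrite /X; lra.
  apply: has_grad_near g.
  have := near_X (-1) (- h); rewrite mulN1r subr_gt0 ltrNr => /(_ hz).
  apply: filterS => z' /=; rewrite mulN1r subr_gt0 ltrNr /phi => hz'.
  by rewrite hz' ifF //; apply/negbTE; rewrite -leNgt; lra.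
- have nY : z.2 != q.2 by rewrite -subr_eq0 gt_eqF // (lt_trans h0).
  have g := has_gradB (has_grad_cst (2 * pi * nu - nu * (pi / 2)) z) (has_gradZ nu (has_grad_atan_xy nY)).
  rewrite b3; last by rewrite lter_normr [h < _]hz.
  apply: has_grad_near g.
  have := near_Y 1 (- h); rewrite mul1r subr_gt0 => /(_ hz).
  by apply: filterS => z' /=; rewrite mul1r subr_gt0 => /phiT ->; rewrite mulrN opprK.
- have nY : z.2 != q.2 by rewrite -subr_eq0 lt_eqF // (lt_trans hz) // oppr_lt0.
  have g := has_gradB (has_grad_cst (nu * (pi / 2)) z) (has_gradZ nu (has_grad_atan_xy nY)).
  rewrite b3; last by rewrite lter_normr [h < - _]ltrNr [_ < - h]hz orbT.
  apply: has_grad_near g.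
  have := near_Y (-1) (- h); rewrite mulN1r subr_gt0 ltrNr => /(_ hz).
  by apply: filterS => z' /=; rewrite mulN1r subr_gt0 ltrNr => /phiB ->; rewrite mulrN opprK.
Qed.

End AngularForms.

(** * Cohomology of angular forms *)

Section Cohomology.
Variables (R : realType) (V : set (plane R)).
Implicit Types (p q z : plane R).

(* The angular forms about [p] and [q] are cohomologous on [V]. *)
Definition cohom p q := exact_on V (fun z => dth p z - dth q z).

Lemma cohom_refl p : cohom p p.
Proof. by apply: exact_on_eq (exact_on0 V) => z _; rewrite subrr. Qed.

Lemma cohom_sym p q : cohom p q -> cohom q p.
Proof. by move=> /exact_onN; apply: exact_on_eq => z _; rewrite opprB. Qed.

Lemma cohom_trans p q z : cohom p q -> cohom q z -> cohom p z.
Proof.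
by move=> h1 h2; apply: exact_on_eq (exact_onD h1 h2) => w _; rewrite addrA subrK.
Qed.

Lemma cohom_exact p q : cohom p q -> exact_on V (dth q) -> exact_on V (dth p).
Proof.
by move=> h1 h2; apply: exact_on_eq (exact_onD h1 h2) => w _; rewrite subrK.
Qed.

(** The sign condition says that [t] lies between [a] and [b] whatever their order, so that a pole
    can be moved in both directions. *)
Lemma cohom_horizontal (a b y : R) :
  (forall t, (t - a) * (t - b) <= 0 -> ~ V (t, y)) -> cohom (a, y) (b, y).
Proof.
wlog ab : a b / b <= a.
  move=> w h; have [ba|/ltW ab] := leP b a; first exact: w.
  by apply: cohom_sym; apply: w => // t tab; apply: h; rewrite mulrC.
move=> h; apply: exact_dth_hsegment => // z Vz zy zab.
apply: (h z.1); first by case/andP: zab => ? ?; rewrite mulr_le0_ge0 ?subr_ge0 ?subr_le0.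
by rewrite -zy -surjective_pairing.
Qed.

End Cohomology.

Lemma cohom_swap (R : realType) (V : set (plane R)) p q :
  cohom [set z | V (z.2, z.1)] (p.2, p.1) (q.2, q.1) -> cohom V p q.
Proof. exact: exact_dthB_swap. Qed.

Lemma cohom_vertical (R : realType) (V : set (plane R)) (a b x : R) :
  (forall t, (t - a) * (t - b) <= 0 -> ~ V (x, t)) -> cohom V (x, a) (x, b).
Proof. by move=> h; apply: cohom_swap; apply: cohom_horizontal. Qed.

Lemma nbhs_box (R : realType) (q : plane R) (P : plane R -> Prop) :
  (\forall z \near q, P z) <->
  exists2 e : R, 0 < e & forall z, `|z.1 - q.1| < e -> `|z.2 - q.2| < e -> P z.
Proof.
split=> [/nbhs_ballP[e /= e0 he]|[e e0 he]].
  exists e => // z z1 z2; apply: he.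
  by split; rewrite /ball /= distrC.
apply/nbhs_ballP; exists e => // z [z1 z2]; apply: he; rewrite distrC //.
Qed.

Lemma bounded_box (R : realType) (A : set (plane R)) : bounded_set A ->
  exists2 M : R, 0 < M & forall z, A z -> `|z.1| < M /\ `|z.2| < M.
Proof.
move=> [M [_ hM]]; exists (Num.max M 0 + 2); first by rewrite ltr_pwDr // le_max lexx orbT.
move=> z Az; have : `|z| <= Num.max M 0 + 1.
  by apply: hM Az; rewrite ltr_pwDr // le_max lexx.
by rewrite prod_normE ge_max => /andP[h1 h2]; split; rewrite (le_lt_trans _ (_ : Num.max M 0 + 1 < _)) // ltrD2l ltr1n.
Qed.

Lemma ler_dist_between (R : realDomainType) (t a b : R) :
  (t - a) * (t - b) <= 0 -> `|t - b| <= `|a - b|.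
Proof.
move=> h; have [->|u0] := eqVneq (t - b) 0; first by rewrite normr0.
rewrite -(ler_pM2l (_ : 0 < `|t - b|)) ?normr_gt0 // -normrM ger0_norm -?expr2 ?sqr_ge0 //.
rewrite -normrM (le_trans _ (ler_norm _)) //.
by rewrite -subr_le0; apply: le_trans h; rewrite le_eqVlt; apply/orP; left; apply/eqP; ring.
Qed.

Section Transverse.
Variables (R : realType) (V : set (plane R)).

(* Near [q], moving by [s * e / 2] in the first coordinate, where [s] is the sign
   of [fx q], leads from the complement of [V] to a box that misses [V]. *)
Lemma cohom_transverse_x (f fx : plane R -> R) q :
  (\forall z \near q, {for z, continuous f} /\
     is_derive z.1 (1 : R) (fun t => f (t, z.2)) (fx z)) ->
  {for q, continuous fx} -> fx q != 0 ->
  (\forall z \near q, V z <-> f z < 0) -> ~ V q ->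
  \forall z \near q, ~ V z -> cohom V z q.
Proof.
move=> nf cfx fx0 nV nVq.
pose s := Num.sg (fx q).
have s2 : s * s = 1 by rewrite -expr2 /s sqr_sg fx0.
have sfx : 0 < fx q * s by rewrite mulrC /s -normrEsg normr_gt0.
have nfx : \forall z \near q, 0 < fx z * s.
  by apply: near_gt0 => //; apply: cvgM => //; apply: cvg_cst.
have /nbhs_box[e e0 he] : \forall z \near q, [/\ {for z, continuous f},
    is_derive z.1 (1 : R) (fun t => f (t, z.2)) (fx z), 0 < fx z * s &
    (V z <-> f z < 0)].
  by near=> z; split; near: z; [apply: filterS nf => z [] | apply: filterS nf => z [] | |].
have e2 : 0 < e / 2 by rewrite divr_gt0.
(* By the mean value theorem, since the derivative in the direction [s] is positive on the whole
   box. Hence a point with [f >= 0] stays outside [V] when it moves in this direction. *)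
have mono (x y t : R) : `|x - q.1| < e / 2 -> `|y - q.2| < e -> 0 < t <= e / 2 ->
    f (x, y) < f (x + s * t, y).
  move=> hx hy ht.
  have hb t' : 0 <= t' <= t -> `|x + s * t' - q.1| < e.
    move=> t't; rewrite addrAC (le_lt_trans (ler_normD _ _)) //.
    rewrite normrM (ger0_norm (_ : 0 <= t')); last by case/andP: t't.
    by rewrite /s normr_sg fx0 mul1r; lra.
  have dfs c : 0 <= c <= t -> is_derive c (1 : R) (fun t' => f (x + s * t', y))
      (fx (x + s * c, y) * s).
    move=> hc; have [|//|_ d _ _] := he (x + s * c, y) _ _; first by apply: hb.
    apply: (@is_derive1_comp R (fun t => f (t, y)) (fun t' => x + s * t')) => //.
    have h1 := is_deriveD (is_derive_cst x c 1) (is_deriveZ s (is_derive_id c 1)).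
    by apply: is_derive_eq h1 _; rewrite add0r [_ *: 1]mulr1.
  have [|||c] := @MVT R (fun t' => f (x + s * t', y)) (fun t' => fx (x + s * t', y) * s) 0 t.
  - by case/andP: ht.
  - by move=> c; rewrite in_itv /= => hc; apply: dfs; lra.
  - apply: derivable_within_continuous => c; rewrite in_itv /= => hc.
    by case: (dfs c hc).
  rewrite in_itv /= => hc; rewrite mulr0 addr0 subr0 => E.
  rewrite -subr_gt0 E; apply: mulr_gt0; last by case/andP: ht.
  by have [|//|_ _ h _] := he (x + s * c, y) _ _; first by apply: hb; lra.
have notV (x y t : R) : `|x - q.1| < e / 2 -> `|y - q.2| < e -> 0 <= t <= e / 2 ->
    ~ V (x, y) -> ~ V (x + s * t, y).
  move=> hx hy ht nVxy; have [->|t0] := eqVneq t 0; first by rewrite mulr0 addr0.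
  have t0' : 0 < t <= e / 2 by rewrite lt_def t0.
  have hb : `|x + s * t - q.1| < e.
    rewrite addrAC (le_lt_trans (ler_normD _ _)) //.
    rewrite normrM (ger0_norm (_ : 0 <= t)); last by case/andP: ht.
    by rewrite /s normr_sg fx0 mul1r; lra.
  have [//|//|_ _ _ i1] := he (x + s * t, y) _ _.
  have [||_ _ _ i2] := he (x, y) _ _ => //; first by rewrite /=; lra.
  move=> /i1; apply/negP; rewrite -leNgt ltW // (le_lt_trans _ (mono _ _ _ hx hy t0')) //.
  by rewrite leNgt; apply/negP => /i2.
pose q' := (q.1 + s * (e / 2), q.2).
have hq' : \forall z \near q', ~ V z.
  have b1 : `|q'.1 - q.1| < e.
    by rewrite /q' /= addrAC subrr add0r normrM /s normr_sg fx0 mul1r gtr0_norm //; lra.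
  have b2 : `|q'.2 - q.2| < e by rewrite subrr normr0.
  have [cf _ _ _] := he q' b1 b2.
  have fq' : 0 < f q'.
    have [||_ _ _ i2] := he q _ _; rewrite ?subrr ?normr0 //.
    rewrite (le_lt_trans _ (mono q.1 q.2 (e / 2) _ _ _)) ?subrr ?normr0 ?e2 //=.
    by rewrite -surjective_pairing leNgt; apply/negP => /i2.
  have nq' : \forall z \near q', (V z <-> f z < 0).
    apply/nbhs_box; exists (e / 2) => // z z1 z2.
    have [||_ _ _ //] := he z.
      have -> : z.1 - q.1 = (z.1 - q'.1) + (q'.1 - q.1) by rewrite addrA subrK.
      rewrite (le_lt_trans (ler_normD _ _)) //.
      have : `|q'.1 - q.1| <= e / 2.
        by rewrite /q' /= addrAC subrr add0r normrM /s normr_sg fx0 mul1r gtr0_norm.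
      lra.
    by rewrite (lt_trans z2) //; lra.
  near=> z; move=> Vz.
  have : f z < 0 by apply/(near nq' z).
  apply/negP; rewrite -leNgt ltW //; near: z.
  exact: near_gt0.
have {hq'}/nbhs_box[eta eta0 heta] := hq'.
apply/nbhs_box; exists (Num.min eta (e / 2)); first by rewrite lt_min eta0.
move=> z; rewrite !lt_min => /andP[z1 z1'] /andP[z2 z2'] nVz.
have bt (x t : R) : (t - x) * (t - (x + s * (e / 2))) <= 0 ->
    exists2 t', 0 <= t' <= e / 2 & t = x + s * t'.
  move=> h; exists (s * (t - x)); last by rewrite mulrA s2 mul1r addrC subrK.
  have : (s * (t - x)) * (s * (t - x) - e / 2) <= 0.
    suff -> : s * (t - x) * (s * (t - x) - e / 2) =
      (s * s - 1) * (t - x) ^+ 2 + (t - x) * (t - (x + s * (e / 2))).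
      by rewrite s2 subrr mul0r add0r.
    by ring.
  set u := s * (t - x) => hu; apply/andP; split; rewrite leNgt; apply/negP => u0.
    by move: hu; apply/negP; rewrite -ltNge nmulr_rgt0 //; lra.
  by move: hu; apply/negP; rewrite -ltNge mulr_gt0 //; lra.
(* The path from [z] to [q]: horizontally into the free box about [q'], vertically and then
   horizontally inside this box, and back from [q'] to [q]. *)
apply: (@cohom_trans _ _ _ (z.1 + s * (e / 2), z.2)).
  rewrite {1}[z]surjective_pairing; apply: cohom_horizontal => t /bt[t' ht' ->].
  by apply: notV => //; [lra | rewrite -surjective_pairing].
apply: (@cohom_trans _ _ _ (z.1 + s * (e / 2), q.2)).
  apply: cohom_vertical => t ht; apply: heta => /=.
    by rewrite opprD addrACA subrr addr0.
  by rewrite (le_lt_trans (ler_dist_between ht)).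
apply: (@cohom_trans _ _ _ q').
  apply: cohom_horizontal => t ht; apply: heta => /=; last by rewrite subrr normr0.
  rewrite (le_lt_trans (ler_dist_between ht)) //.
  by rewrite opprD addrACA subrr addr0.
apply: cohom_sym; rewrite {1}[q]surjective_pairing; apply: cohom_horizontal => t /bt[t' ht' ->].
apply: notV => //; rewrite ?subrr ?normr0 //.
by rewrite -surjective_pairing.
Unshelve. all: by end_near. Qed.

End Transverse.

Lemma near_swap (R : realType) (q : plane R) (P : plane R -> Prop) :
  (\forall z \near (q.2, q.1), P z) -> \forall z \near q, P (z.2, z.1).
Proof.
move=> /(@nbhs_box R)[e e0 he]; apply/nbhs_box; exists e => // z z1 z2.
exact: he.
Qed.

Lemma smooth_on_has_grad (R : realType) (U : set (plane R)) f : smooth_on U f ->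
  [/\ forall p, U p -> has_grad f p ('D_(dx R) f p) ('D_(dy R) f p),
      smooth_on U ('D_(dx R) f) & smooth_on U ('D_(dy R) f)].
Proof.
move=> sf; split.
- move=> p Up; have [cf [df _]] := sf 1%N; have [d1 d2] := df p Up.
  by apply: derivable_has_grad => //; apply: cf.
- by move=> k; have [_ [_ []]] := sf k.+1.
- by move=> k; have [_ [_ []]] := sf k.+1.
Qed.

Lemma smooth_on_continuous (R : realType) (U : set (plane R)) f p : smooth_on U f ->
  U p -> {for p, continuous f}.
Proof. by move=> sf Up; have [cf _] := sf 0%N; apply: cf. Qed.

(** * Choice of the poles on the boundary curves *)

Section Poles.
Variables (R : realType) (Omega : set (plane R)).
Implicit Types (p q z : plane R).
Hypothesis oO : open Omega.

Lemma frontier_notin q : frontier Omega q -> ~ Omega q.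
Proof. by move=> [_]; move/interior_id : oO => ->. Qed.

(** One partial derivative of the defining function is nonzero at [q]; if it is the second one, the
    coordinates are exchanged. *)
Lemma cohom_near_frontier q : smooth_boundary Omega -> frontier Omega q ->
  \forall z \near q, ~ Omega z -> cohom Omega z q.
Proof.
move=> sO fq; have nq := frontier_notin fq.
have [U [rho [oU Uq srho drho Orho]]] := sO q fq.
have [gr sx sy] := smooth_on_has_grad srho.
have nU : \forall z \near q, U z by apply: open_nbhs_nbhs.
case: (drho q Uq) => d0.
  apply: (@cohom_transverse_x R Omega rho ('D_(dx R) rho)) => //.
  - by apply: filterS nU => z /gr[].
  - exact: smooth_on_continuous sx Uq.
  - by apply: filterS nU => z /Orho.
have nU' : \forall z \near (q.2, q.1), U (z.2, z.1).
  by apply: near_swap; rewrite /= -surjective_pairing.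
suff nn : \forall z \near (q.2, q.1), ~ Omega (z.2, z.1) ->
    cohom [set z | Omega (z.2, z.1)] z (q.2, q.1).
  apply: filterS (near_swap nn) => z h nz; apply: cohom_swap; apply: h.
  by rewrite /= -surjective_pairing.
apply: (@cohom_transverse_x R [set z | Omega (z.2, z.1)] (fun z => rho (z.2, z.1))
  (fun z => 'D_(dy R) rho (z.2, z.1)) (q.2, q.1)).
- by apply: filterS nU' => z /gr/has_grad_swap; rewrite /= -surjective_pairing => -[].
- have [gy _ _] := smooth_on_has_grad sy.
  by have [] := has_grad_swap (gy q Uq).
- by rewrite /= -surjective_pairing.
- by apply: filterS nU' => z /Orho.
- by rewrite /= -surjective_pairing.
Qed.

(** The class of [dth] is locally constant along the frontier, so the points of [S] with the class
    of [q] form a subset that is nonempty and both relatively open and relatively closed. *)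
Lemma cohom_connected (S : set (plane R)) p q : smooth_boundary Omega ->
  connected S -> S `<=` frontier Omega -> S p -> S q -> cohom Omega p q.
Proof.
move=> sO cS SF Sp Sq.
suff /seteqP[_ /(_ p Sp)[]] : S `&` [set z | cohom Omega z q] = S by [].
apply: cS.
- by exists q; split => //; exact: cohom_refl.
- exists (interior [set z | S z -> cohom Omega z q]); first exact: open_interior.
  apply/seteqP; split=> z [Sz h]; split=> //; last exact: (interior_subset h).
  apply: filterS (cohom_near_frontier sO (SF _ Sz)) => w hw Sw.
  by apply: cohom_trans h; apply: hw; apply/frontier_notin/SF.
- exists (~` interior [set z | S z -> ~ cohom Omega z q]).
    by rewrite closedC; exact: open_interior.
  apply/seteqP; split=> z [Sz h]; split=> //.
    by move=> /interior_subset/(_ Sz).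
  apply: contrapT => nh; apply: h.
  apply: filterS (cohom_near_frontier sO (SF _ Sz)) => w hw Sw hwq.
  apply: nh; apply: cohom_trans hwq; apply: cohom_sym.
  by apply: hw; apply/frontier_notin/SF.
Qed.

(** The pole slides to the right up to the infimum [t0] of the times at which the ray is in [Omega].
    Openness of [Omega] keeps the point reached outside [Omega], and the infimum property puts it in
    the closure. *)
Lemma exit_right p : ~ Omega p -> (exists2 t, 0 <= t & Omega (p.1 + t, p.2)) ->
  exists2 q, frontier Omega q & cohom Omega p q.
Proof.
move=> np [t1 t10 Ot1].
pose T := [set t : R | 0 <= t /\ Omega (p.1 + t, p.2)].
have hT : has_inf T by split; [exists t1 | exists 0 => t []].
set t0 := inf T.
have t00 : 0 <= t0 by apply: lb_le_inf => [|t []//]; exists t1.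
have seg t : 0 <= t -> t < t0 -> ~ Omega (p.1 + t, p.2).
  move=> t_ge0 tt0 Ot; have : t0 <= t by apply: ge_inf => //; exists 0 => ? [].
  by rewrite leNgt tt0.
pose q := (p.1 + t0, p.2).
have nq : ~ Omega q.
  move=> Oq; have [t0E|t0_neq0] := eqVneq t0 0.
    by apply: np; move: Oq; rewrite /q t0E addr0 -surjective_pairing.
  have t0_gt0 : 0 < t0 by rewrite lt_def t0_neq0.
  have /nbhs_box[e e0 he] : \forall z \near q, Omega z by apply: open_nbhs_nbhs.
  pose d := Num.min (e / 2) t0.
  have d0 : 0 < d by rewrite lt_min t0_gt0 divr_gt0.
  have de : d <= e / 2 by rewrite ge_min lexx.
  have dt : d <= t0 by rewrite ge_min lexx orbT.
  apply: (seg (t0 - d)); [lra | lra |].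
  apply: he => /=; last by rewrite subrr normr0.
  have -> : p.1 + (t0 - d) - (p.1 + t0) = - d by ring.
  by rewrite normrN gtr0_norm //; lra.
exists q.
  split; last by move/interior_subset.
  move=> B /nbhs_box[e e0 he].
  have [t [t_ge0 Ot] tt0] := inf_adherent e0 hT.
  have t0t : t0 <= t by apply: ge_inf => //; exists 0 => ? [].
  exists (p.1 + t, p.2); split=> //; apply: he => /=; last by rewrite subrr normr0.
  rewrite opprD addrACA subrr add0r ger0_norm ?subr_ge0 // ltrBlDl //.
rewrite [p in cohom _ p]surjective_pairing; apply: cohom_horizontal => t ht.
have {ht} tt : p.1 <= t <= p.1 + t0.
  apply/andP; split; rewrite leNgt; apply/negP => ?.
    by move: ht; apply/negP; rewrite -ltNge nmulr_rgt0; lra.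
  by move: ht; apply/negP; rewrite -ltNge pmulr_rgt0; lra.
have [->//|tq] := eqVneq t (p.1 + t0).
have -> : t = p.1 + (t - p.1) by ring.
apply: seg; first lra.
by rewrite ltrBlDl lt_neqAle tq; case/andP: tt.
Qed.

Lemma smooth_closed_curve_connected (S : set (plane R)) :
  smooth_closed_curve S -> connected S /\ S !=set0.
Proof.
move=> [x [y [dxy _ _ _ ->]]]; split; last by exists (x 0, y 0), 0.
apply: connected_continuous_connected.
  by apply/connected_intervalP => ? ? ? ? ? ?.
move=> t; apply: continuous_subspaceT => {}t.
have [dx dy] := dxy 0%N t.
by apply: (@continuous_pair R R x y t); apply/differentiable_continuous/derivable1_diffP.
Qed.

(* The class is trivial on the curve [i0] that a ray from far away hits first. *)
Lemma poles (n : nat) : domain Omega -> bounded_set Omega -> smooth_boundary Omega ->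
  has_holes n Omega ->
  exists pole : 'I_n -> plane R, (forall j, ~ Omega (pole j)) /\
    forall p, ~ Omega p -> exact_on Omega (dth p) \/
      exists j, cohom Omega p (pole j).
Proof.
move=> [[w Ow] _ _] /bounded_box[M M0 hM] sO [Sigma [cS _ fO _ _]].
have SF i : Sigma i `<=` frontier Omega by rewrite fO => p Sp; exists i.
have Sne i : Sigma i !=set0 by have [] := smooth_closed_curve_connected (cS i).
have [s hs] := choice Sne.
have Scoh i p : Sigma i p -> cohom Omega p (s i).
  move=> Sp; apply: (cohom_connected sO _ (@SF i) Sp (hs i)).
  by have [] := smooth_closed_curve_connected (cS i).
(* The vertical line through such a point misses [Omega], so one arctangent serves on all of
   [Omega]. *)
have far p : M <= `|p.1| -> exact_on Omega (dth p).
  move=> Mp; apply: exact_dth_off_line => z /hM[zM _].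
  by apply: contraTneq zM => ->; rewrite -leNgt.
have [i0 hi0] : exists i0, exact_on Omega (dth (s i0)).
  pose p := (- M, w.2).
  have pM : M <= `|p.1| by rewrite normrN ler_norm.
  have np : ~ Omega p by move=> /hM[]; rewrite ltNge pM.
  have [|q] := exit_right np.
    exists (w.1 + M); last by rewrite /= addrC addrK -surjective_pairing.
    by have [+ _] := hM w Ow; rewrite ltr_norml; lra.
  rewrite fO => -[i _ Sq] pq; exists i.
  by apply: cohom_exact (far _ pM); apply: cohom_sym; apply: cohom_trans pq _; apply: Scoh.
(* [lift i0] enumerates the [n] indices other than [i0]. *)
exists (fun j => s (lift i0 j)); split=> [j|p np].
  by apply/frontier_notin/SF/hs.
have [ht|nt] := pselect (exists2 t, 0 <= t & Omega (p.1 + t, p.2)).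
  have [q] := exit_right np ht; rewrite fO => -[i _ Sq] pq.
  have ps : cohom Omega p (s i) by apply: cohom_trans pq _; apply: Scoh.
  case: (unliftP i0 i) => [j ij|ii0]; first by right; exists j; rewrite -ij.
  by left; apply: cohom_exact ps _; rewrite ii0.
(* The ray from [p] to the right misses [Omega], so the pole can be pushed along it until it is far
   away. *)
left; pose q := (Num.max p.1 M, p.2).
apply: (@cohom_exact _ _ _ q); last first.
  by apply: far; rewrite /= (le_trans _ (ler_norm _)) // le_max lexx orbT.
rewrite [p in cohom _ p]surjective_pairing; apply: cohom_horizontal => t ht Ot.
apply: nt; exists (t - p.1); last by rewrite addrC subrK.
rewrite subr_ge0 leNgt; apply/negP => tp; move: ht; apply/negP.
by rewrite -ltNge nmulr_rgt0 ?subr_lt0 // lt_max tp.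
Qed.

End Poles.

(** * Extension and primitives of the potential *)

Section ContinuouslyDifferentiable.
Variable R : realType.
Implicit Types (f g : plane R -> R) (p z : plane R).

Definition isC1 f := exists fx fy,
  [/\ forall p, has_grad f p (fx p) (fy p), continuous fx & continuous fy].

Lemma isC1_continuous f : isC1 f -> continuous f.
Proof. by move=> [fx [fy [h _ _]]] p; case: (h p). Qed.

Lemma isC1_cst (c : R) : isC1 (fun=> c).
Proof.
by exists (fun=> 0), (fun=> 0); split=> p; [exact: has_grad_cst | exact: cvg_cst | exact: cvg_cst].
Qed.

Lemma isC1_fst : isC1 fst.
Proof.
by exists (fun=> 1), (fun=> 0); split=> p; [exact: has_grad_fst | exact: cvg_cst | exact: cvg_cst].
Qed.

Lemma isC1_snd : isC1 snd.
Proof.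
by exists (fun=> 0), (fun=> 1); split=> p; [exact: has_grad_snd | exact: cvg_cst | exact: cvg_cst].
Qed.

Lemma isC1D f g : isC1 f -> isC1 g -> isC1 (fun z => f z + g z).
Proof.
move=> [fx [fy [hf cfx cfy]]] [gx [gy [hg cgx cgy]]].
exists (fun z => fx z + gx z), (fun z => fy z + gy z); split=> p.
- exact: has_gradD.
- by apply: cvgD; [exact: cfx | exact: cgx].
- by apply: cvgD; [exact: cfy | exact: cgy].
Qed.

Lemma isC1M f g : isC1 f -> isC1 g -> isC1 (fun z => f z * g z).
Proof.
move=> C1f C1g; have cf := isC1_continuous C1f; have cg := isC1_continuous C1g.
move: C1f C1g => [fx [fy [hf cfx cfy]]] [gx [gy [hg cgx cgy]]].
exists (fun z => f z * gx z + g z * fx z), (fun z => f z * gy z + g z * fy z); split=> p.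
- exact: has_gradM.
- by apply: cvgD; apply: cvgM; [exact: cf | exact: cgx | exact: cg | exact: cfx].
- by apply: cvgD; apply: cvgM; [exact: cf | exact: cgy | exact: cg | exact: cfy].
Qed.

Lemma isC1X f n : isC1 f -> isC1 (fun z => f z ^+ n).
Proof.
move=> C1f; elim: n => [|n ih].
  by have -> : (fun z => f z ^+ 0) = fun=> 1 by []; exact: isC1_cst.
have -> : (fun z => f z ^+ n.+1) = fun z => f z * f z ^+ n.
  by apply/funext => z; rewrite exprS.
exact: isC1M.
Qed.

Lemma isC1_comp (F F' : R -> R) f : (forall t, is_derive t (1 : R) F (F' t)) ->
  continuous F' -> isC1 f -> isC1 (fun z => F (f z)).
Proof.
move=> dF cF' C1f; have cf := isC1_continuous C1f; move: C1f => [fx [fy [hf cfx cfy]]].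
have cFf : continuous (fun z => F' (f z)).
  by move=> p; apply: continuous_comp; [exact: cf | exact: cF'].
exists (fun z => F' (f z) * fx z), (fun z => F' (f z) * fy z); split=> p.
- exact: has_grad_comp.
- by apply: cvgM; [exact: cFf | exact: cfx].
- by apply: cvgM; [exact: cFf | exact: cfy].
Qed.

Lemma isC1Z (c : R) f : isC1 f -> isC1 (fun z => c * f z).
Proof. by apply: isC1M; exact: isC1_cst. Qed.

Lemma isC1B f g : isC1 f -> isC1 g -> isC1 (fun z => f z - g z).
Proof.
move=> hf hg.
have -> : (fun z => f z - g z) = (fun z => f z + -1 * g z).
  by apply/funext => z; rewrite mulN1r.
by apply: isC1D => //; apply: isC1Z.
Qed.

Lemma isC1_sum (I : Type) (r : seq I) (F : I -> plane R -> R) :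
  (forall i, isC1 (F i)) -> isC1 (fun z => \sum_(i <- r) F i z).
Proof.
move=> h; elim: r => [|i r ih].
  have -> : (fun z => \sum_(i <- [::]) F i z) = fun=> 0.
    by apply/funext => z; rewrite big_nil.
  exact: isC1_cst.
have -> : (fun z => \sum_(j <- i :: r) F j z) = fun z => F i z + \sum_(j <- r) F j z.
  by apply/funext => z; rewrite big_cons.
exact: isC1D.
Qed.

Lemma isC1_local f : (forall z, exists U h hx hy, [/\ open U, U z,
    forall z', U z' -> f z' = h z' /\ has_grad h z' (hx z') (hy z'),
    {for z, continuous hx} & {for z, continuous hy}]) -> isC1 f.
Proof.
move=> loc; exists ('D_(dx R) f), ('D_(dy R) f).
have gU U h hx hy : open U ->
    (forall z', U z' -> f z' = h z' /\ has_grad h z' (hx z') (hy z')) ->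
    forall z, U z -> [/\ has_grad f z (hx z) (hy z), 'D_(dx R) f z = hx z & 'D_(dy R) f z = hy z].
  move=> oU hU z Uz; have g : has_grad f z (hx z) (hy z).
    apply: has_grad_near (proj2 (hU z Uz)).
    have : \forall z' \near z, U z' by apply: open_nbhs_nbhs.
    by apply: filterS => z' /hU[].
  by have [-> ->] := has_grad_derive g.
split=> z; have [U [h [hx [hy [oU Uz hU chx chy]]]]] := loc z;
  have [g ex ey] := gU _ _ _ _ oU hU z Uz.
- by rewrite ex ey.
- rewrite /continuous_at ex; apply: cvg_trans chx; apply: near_eq_cvg.
  have : \forall z' \near z, U z' by apply: open_nbhs_nbhs.
  by apply: filterS => z' Uz'; have [] := gU _ _ _ _ oU hU z' Uz'.
- rewrite /continuous_at ey; apply: cvg_trans chy; apply: near_eq_cvg.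
  have : \forall z' \near z, U z' by apply: open_nbhs_nbhs.
  by apply: filterS => z' Uz'; have [] := gU _ _ _ _ oU hU z' Uz'.
Qed.

Lemma continuous_maxr (T : topologicalType) (f g : T -> R) : continuous f -> continuous g ->
  continuous (fun x => Num.max (f x) (g x)).
Proof.
move=> cf cg.
have -> : (fun x => Num.max (f x) (g x)) = (fun x => (f x + g x + `|f x - g x|) / 2).
  by apply/funext => x; rewrite maxr_absE.
move=> x; apply: cvgM; last exact: cvg_cst.
by apply: cvgD; [apply: cvgD; [exact: cf | exact: cg] | apply: cvg_norm; apply: cvgB; [exact: cf | exact: cg]].
Qed.

Lemma continuous_minr (T : topologicalType) (f g : T -> R) : continuous f -> continuous g ->
  continuous (fun x => Num.min (f x) (g x)).
Proof.
move=> cf cg.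
have -> : (fun x => Num.min (f x) (g x)) = (fun x => (f x + g x - `|f x - g x|) / 2).
  by apply/funext => x; rewrite minr_absE.
move=> x; apply: cvgM; last exact: cvg_cst.
by apply: cvgB; [apply: cvgD; [exact: cf | exact: cg] | apply: cvg_norm; apply: cvgB; [exact: cf | exact: cg]].
Qed.

(** Squaring the positive part makes it continuously differentiable, which is all the regularity
    that the cutoffs and windows built from it need. *)
Definition sqrp (t : R) : R := Num.max 0 t ^+ 2.

Lemma sqrp_ge0 t : 0 <= sqrp t. Proof. exact: sqr_ge0. Qed.

Lemma sqrp_le0 t : t <= 0 -> sqrp t = 0.
Proof. by move=> t0; rewrite /sqrp max_l // expr0n. Qed.

Lemma sqrp_id t : 0 <= t -> sqrp t = t ^+ 2.
Proof. by move=> t0; rewrite /sqrp max_r. Qed.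

Lemma continuous_max0 : continuous (fun t : R => Num.max 0 t).
Proof. by apply: continuous_maxr => x; [exact: cvg_cst | exact: cvg_id]. Qed.

Lemma is_derive_sqrp t : is_derive t (1 : R) sqrp (2 * Num.max 0 t).
Proof.
have [t0|t0|->] : [\/ t < 0, 0 < t | t = 0].
  by case: (ltgtP t 0) => ?; [apply: Or31 | apply: Or32 | apply: Or33].
- rewrite max_l ?(ltW t0) // mulr0.
  apply: near_eq_is_derive (is_derive_cst (0 : R) t 1).
  have : \forall s \near t, s < 0.
    by apply: open_nbhs_nbhs; split=> //; exact: open_lt.
  by apply: filterS => s /ltW s0; rewrite sqrp_le0.
- rewrite max_r ?(ltW t0) //.
  have h := is_deriveX 2 (is_derive_id t (1 : R)).
  have h' : is_derive t (1 : R) (fun s => s ^+ 2) (2 * t).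
    by rewrite expr1 [_ *: 1]mulr1 exprfctE in h.
  apply: near_eq_is_derive h'.
  have : \forall s \near t, 0 < s.
    by apply: open_nbhs_nbhs; split=> //; exact: open_gt.
  by apply: filterS => s /ltW s0; rewrite sqrp_id.
(* At [0] the slope function is the positive part itself, continuous with value [0]. *)
- apply/is_derive1_caratheodory; exists (fun s : R => Num.max 0 s); split.
  + move=> s; rewrite (sqrp_le0 (lexx 0)) !subr0.
    have [s0|s0] := leP s 0; first by rewrite sqrp_le0 // mul0r.
    by rewrite sqrp_id ?(ltW s0) // expr2.
  + exact: continuous_max0.
  + by rewrite maxxx mulr0.
Qed.

Lemma isC1_sqrp f : isC1 f -> isC1 (fun z => sqrp (f z)).
Proof.
apply: (isC1_comp is_derive_sqrp) => t; apply: cvgM; first exact: cvg_cst.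
exact: continuous_max0.
Qed.

End ContinuouslyDifferentiable.

Section Extension.
Variable R : realType.
Implicit Types (p z : plane R).

Definition bump (e : R) p z :=
  sqrp (1 - ((z.1 - p.1) / e) ^+ 2) * sqrp (1 - ((z.2 - p.2) / e) ^+ 2).

Lemma isC1_bump e p : isC1 (bump e p).
Proof.
have h1 : isC1 (fun z : plane R => (z.1 - p.1) / e).
  by apply: isC1M (isC1_cst _); apply: isC1B (isC1_fst R) (isC1_cst _).
have h2 : isC1 (fun z : plane R => (z.2 - p.2) / e).
  by apply: isC1M (isC1_cst _); apply: isC1B (isC1_snd R) (isC1_cst _).
apply: isC1M; apply: isC1_sqrp; apply: isC1B (isC1_cst _) _.
- exact: isC1X.
- exact: isC1X.
Qed.

Lemma bump_ge0 e p z : 0 <= bump e p z.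
Proof. by rewrite mulr_ge0 ?sqrp_ge0. Qed.

(** On the half-size box each factor is at least [(3/4)^2 = 9/16], and [(9/16)^2 > 1/4]. *)
Lemma bump_ge e p z : 0 < e -> `|z.1 - p.1| < e / 2 -> `|z.2 - p.2| < e / 2 ->
  1 <= 4 * bump e p z.
Proof.
move=> e0 h1 h2.
have k (t : R) : `|t| < e / 2 -> 9 / 16 <= sqrp (1 - (t / e) ^+ 2).
  move=> ht; have : `|t / e| < 1 / 2.
    by rewrite normrM normfV (gtr0_norm e0) ltr_pdivrMr //; lra.
  rewrite ltr_norml => /andP[a b].
  have u2 : (t / e) ^+ 2 <= 1 / 4 by nra.
  by rewrite sqrp_id; nra.
by have := k _ h1; have := k _ h2; rewrite /bump; nra.
Qed.

Lemma bump_eq0 e p z : 0 < e -> e <= `|z.1 - p.1| \/ e <= `|z.2 - p.2| ->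
  bump e p z = 0.
Proof.
move=> e0.
have k (t : R) : e <= `|t| -> sqrp (1 - (t / e) ^+ 2) = 0.
  move=> ht; rewrite sqrp_le0 // subr_le0 -[_ ^+ 2]ger0_norm ?sqr_ge0 //.
  by rewrite normrX expr_ge1 // normrM normfV (gtr0_norm e0) ler_pdivlMr // mul1r.
by rewrite /bump => -[/k ->|/k ->]; rewrite ?mul0r ?mulr0.
Qed.

Lemma compact_closure (A : set (plane R)) : bounded_set A -> compact (closure A).
Proof.
move=> /bounded_box[M M0 hM].
have cB : compact (`[- M, M]%classic `*` `[- M, M]%classic : set (plane R)).
  by apply: compact_setX; exact: segment_compact.
apply: (subclosed_compact _ cB); first exact: closed_closure.
have clB : closed (`[- M, M]%classic `*` `[- M, M]%classic : set (plane R)).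
  by apply: (compact_closed _ cB); exact: norm_hausdorff.
rewrite (iffLR (closure_id _) clB); apply: closureS => z /hM[h1 h2].
by split; rewrite /= in_itv /= -ler_norml ltW.
Qed.

Lemma plane_finite_cover (K : set (plane R)) (W : plane R -> set (plane R)) :
  compact K -> (forall p, open (W p)) -> (forall p, K p -> W p p) ->
  exists2 s : seq (plane R), (forall p, p \in s -> K p) &
    forall z, K z -> exists2 p, p \in s & W p z.
Proof.
move=> cK oW Wp.
pose T : ptopologicalType :=
  HB.pack (plane R) (isPointed.Build (plane R) (0, 0)).
have : @compact T K by [].
rewrite (@compact_cover T) => /(_ _ K W) [p _|p Kp|D DK KD]; first exact: oW.
  by exists p => //; exact: Wp.
exists (finmap.enum_fset D) => [p pD|z /KD[p pD Wz]]; first exact/set_mem/DK.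
by exists p.
Qed.

(** A finite sum [sig] of bumps satisfies [4 * sig >= 1] on [K] and vanishes near the complement of
    [U]; the function [1 - sqrp (1 - 4 * sig)] turns these two cases into the values [1] and [0]. *)
Lemma cutoff (K U : set (plane R)) : compact K -> open U -> K `<=` U ->
  exists chi, [/\ isC1 chi, forall z, K z -> chi z = 1 &
    forall z, ~ U z -> \forall z' \near z, chi z' = 0].
Proof.
move=> cK oU KU.
(* The bump is supported in the box of half-side [e], whereas the box of half-side [2 * e] is in
   [U]: the margin makes the bump vanish in a neighbourhood of each point outside [U]. *)
have ex p : exists e : R, 0 < e /\ (K p -> forall z, `|z.1 - p.1| < 2 * e -> `|z.2 - p.2| < 2 * e -> U z).
  have [Kp|nKp] := pselect (K p); last by exists 1.
  have /nbhs_box[e e0 he] : \forall z \near p, U z.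
    by apply: open_nbhs_nbhs; split=> //; exact: KU.
  exists (e / 2); split=> [|_ z]; first by rewrite divr_gt0.
  by rewrite mulrC divfK ?pnatr_eq0 //; exact: he.
have [e he] := choice ex.
have e0 p : 0 < e p by have [] := he p.
pose W p := interior [set z : plane R | `|z.1 - p.1| < e p / 2 /\ `|z.2 - p.2| < e p / 2].
have [||D DK KD] := plane_finite_cover (W := W) cK.
- by move=> p; exact: open_interior.
- by move=> p Kp; apply/nbhs_box; exists (e p / 2); rewrite ?divr_gt0 ?subrr ?normr0.
pose sig z := \sum_(p <- D) bump (e p) p z.
have C1sig : isC1 sig by apply: isC1_sum => p; exact: isC1_bump.
exists (fun z => 1 - sqrp (1 - 4 * sig z)); split.
- apply: isC1B (isC1_cst _) _; apply: isC1_sqrp; apply: isC1B (isC1_cst _) _.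
  exact: isC1Z.
- move=> z /KD[p pD /interior_subset[h1 h2]].
  have := bump_ge (e0 p) h1 h2.
  have : bump (e p) p z <= sig z.
    rewrite /sig (big_rem p) //= lerDl sumr_ge0 // => q _; exact: bump_ge0.
  by move=> a b; rewrite sqrp_le0 ?subr0 //; lra.
- move=> z nUz.
  suff : \forall z' \near z, sig z' = 0.
    by apply: filterS => z' ->; rewrite mulr0 subr0 sqrp_id // expr1n subrr.
  have nb p : p \in D -> \forall z' \near z, bump (e p) p z' = 0.
    move=> /DK Kp.
    have : 2 * e p <= `|z.1 - p.1| \/ 2 * e p <= `|z.2 - p.2|.
      have [?|h1] := leP (2 * e p) `|z.1 - p.1|; first by left.
      have [?|h2] := leP (2 * e p) `|z.2 - p.2|; first by right.
      by case: nUz; apply: (proj2 (he p)).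
    move=> hz; apply/nbhs_box; exists (e p) => // z' h1 h2; apply: bump_eq0 => //.
    case: hz => hz; [left|right].
      have := ler_distD z'.1 z.1 p.1; rewrite (distrC z.1 z'.1); lra.
    have := ler_distD z'.2 z.2 p.2; rewrite (distrC z.2 z'.2); lra.
  rewrite /sig; elim: D {DK KD sig C1sig} nb => [|p s ih] nb.
    by apply: filterE => z'; rewrite big_nil.
  have n1 := nb p (mem_head _ _).
  have n2 : \forall z' \near z, \sum_(p <- s) bump (e p) p z' = 0.
    by apply: ih => q qs; apply: nb; rewrite in_cons qs orbT.
  by apply: filterS2 n1 n2 => z' h1 h2; rewrite big_cons h1 h2 addr0.
Qed.

Lemma smooth_extension (Omega : set (plane R)) f : bounded_set Omega ->
  smooth_upto_boundary Omega f ->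
  exists F, [/\ isC1 F, forall z, Omega z -> F z = f z &
    exists2 M, 0 < M & forall z, M <= `|z.1| \/ M <= `|z.2| -> F z = 0].
Proof.
move=> bO [U [g [oU KU sg gE]]].
have [M M0 hM] := bounded_box bO.
(* Cutting off inside [B] as well gives the extension a bounded support. *)
pose B := [set z : plane R | `|z.1| < M + 1 /\ `|z.2| < M + 1].
have oB : open B.
  have -> : B = (fun z : plane R => M + 1 - Num.max `|z.1| `|z.2|) @^-1` [set t | 0 < t].
    apply/seteqP; split=> z; rewrite /B /= subr_gt0 gt_max; first by move=> [-> ->].
    by move=> /andP.
  apply: open_comp; last exact: open_gt.
  move=> z _; apply: cvgB; first exact: cvg_cst.
  apply: (@continuous_maxr R _ (fun z : plane R => `|z.1|) (fun z : plane R => `|z.2|)) => {}z.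
    by apply: cvg_norm; exact: cvg_fst.
  by apply: cvg_norm; exact: cvg_snd.
have cK := compact_closure bO.
have KB : closure Omega `<=` B.
  have cB : closed (`[- M, M]%classic `*` `[- M, M]%classic : set (plane R)).
    apply: compact_closed; first exact: norm_hausdorff.
    by apply: compact_setX; exact: segment_compact.
  have : closure Omega `<=` `[- M, M]%classic `*` `[- M, M]%classic.
    rewrite [X in _ `<=` X](iffLR (closure_id _) cB); apply: closureS => z /hM[h1 h2].
    by split; rewrite /= in_itv /= -ler_norml ltW.
  move=> h z /h[]; rewrite /= !in_itv /= -!ler_norml => h1 h2; split; lra.
have [chi [C1chi chi1 chi0]] := cutoff cK (openI oU oB) (fun z Kz => conj (KU z Kz) (KB z Kz)).
have [gg sgx sgy] := smooth_on_has_grad sg.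
have [cx [cy [gchi ccx ccy]]] := C1chi.
exists (fun z => chi z * g z); split.
- apply: isC1_local => z; have [Uz|nUz] := pselect (U z); last first.
    exists (interior [set z | chi z = 0]), (fun=> 0), (fun=> 0), (fun=> 0); split.
    + exact: open_interior.
    + by apply: chi0 => -[].
    + move=> z' /interior_subset /= ->; rewrite mul0r; split=> //.
      exact: has_grad_cst.
    + exact: cvg_cst.
    + exact: cvg_cst.
  have c0 := isC1_continuous C1chi.
  exists U, (fun z => chi z * g z), (fun z => chi z * 'D_(dx R) g z + g z * cx z),
    (fun z => chi z * 'D_(dy R) g z + g z * cy z); split=> //.
  + by move=> z' Uz'; split=> //; apply: has_gradM (gchi _) (gg _ Uz').
  + apply: cvgD; apply: cvgM; [exact: c0 | exact: (smooth_on_continuous sgx) |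
      exact: (smooth_on_continuous sg) | exact: ccx].
  + apply: cvgD; apply: cvgM; [exact: c0 | exact: (smooth_on_continuous sgy) |
      exact: (smooth_on_continuous sg) | exact: ccy].
- by move=> z Oz; rewrite chi1 ?mul1r ?gE //; exact: subset_closure.
- exists (M + 1); first by rewrite addr_gt0.
  move=> z hz; have : \forall z' \near z, chi z' = 0.
    by apply: chi0 => -[_ [h1 h2]]; case: hz; rewrite leNgt ?h1 ?h2.
  by move=> /nbhs_singleton ->; rewrite mul0r.
Qed.

End Extension.

(** * Primitives along horizontal lines *)

Section Primitives.
Variable R : realType.
Local Notation mu := (@lebesgue_measure R).

Lemma ler_dist_derive (F f : R -> R) (C a x : R) :
  (forall t, is_derive t (1 : R) F (f t)) -> (forall t, `|f t| <= C) ->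
  `|F x - F a| <= C * `|x - a|.
Proof.
move=> dF fC; wlog ax : a x / a <= x.
  move=> w; have [/w//|/ltW/w] := leP a x.
  by rewrite distrC (distrC a).
move: ax; rewrite le_eqVlt => /predU1P[->|ax]; first by rewrite !subrr normr0 mulr0.
have [|c _ ->] := MVT ax (fun t _ => dF t).
  apply: derivable_within_continuous => t _; by case: (dF t).
by rewrite normrM ler_wpM2r.
Qed.

Lemma is_derive_eps (f : R -> R) (x d : R) :
  (forall e, 0 < e -> exists2 del, 0 < del &
     forall h, `|h| < del -> `|f (x + h) - f x - h * d| <= e * `|h|) ->
  is_derive x (1 : R) f d.
Proof.
move=> H.
have cv : h^-1 *: ((f \o shift x) (h *: (1 : R)) - f x) @[h --> (0 : R)^'] --> d.
  apply/cvgrPdist_le => e e0; have [del del0 hdel] := H e e0.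
  near=> h.
  have h0 : h != 0 by near: h; exact: nbhs_dnbhs_neq.
  have hd : `|h| < del.
    by near: h; apply: dnbhs0_lt.
  have := hdel h hd; rewrite -ler_pdivrMr ?normr_gt0 // => hle.
  apply: le_trans hle; rewrite -normfV -normrM distrC /= [h *: _]mulr1.
  rewrite le_eqVlt; apply/orP; left; apply/eqP; congr `|_|.
  by rewrite (addrC h) /GRing.scale /=; field.
split; first by apply/cvg_ex; exists d.
exact: cvg_lim cv.
Unshelve. all: by end_near. Qed.

Variable M : R.

(** The integrands vanish up to [- M]; starting one unit earlier makes every [x >= - M] an interior
    point, where the fundamental theorem of calculus applies. *)
Definition prim (g : R -> R) (x : R) := \int[mu]_(t in `[- M - 1, x]) g t.

Lemma continuous_integrable (g : R -> R) (a b : R) : continuous g ->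
  mu.-integrable `[a, b] (EFin \o g).
Proof.
move=> cg; apply: continuous_compact_integrable; first exact: segment_compact.
exact: continuous_subspaceT.
Qed.

Lemma prim_eq0 (g : R -> R) x : (forall t, t <= x -> g t = 0) -> prim g x = 0.
Proof.
move=> g0; rewrite /prim (@eq_Rintegral _ _ _ _ _ (cst 0)).
  by rewrite Rintegral_cst //= mul0r.
by move=> t; rewrite inE /= in_itv /= => /andP[_ /g0].
Qed.

Lemma is_derive_prim (g : R -> R) x : continuous g ->
  (forall t, t <= - M -> g t = 0) -> is_derive x (1 : R) (prim g) (g x).
Proof.
move=> cg g0; have [xM|xM] := ltP x (- M).
  rewrite g0 ?(ltW xM) //.
  apply: near_eq_is_derive (is_derive_cst (0 : R) x 1).
  have : \forall s \near x, s < - M by apply: open_nbhs_nbhs; split=> //; exact: open_lt.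
  apply: filterS => s sM; rewrite prim_eq0 // => t ts; apply: g0.
  by rewrite (le_trans ts) // ltW.
have x1 : x < x + 1 by rewrite ltrDl.
have [|d <-] := continuous_FTC1_closed x1 (@continuous_integrable g (- M - 1) (x + 1) cg) _ (cg x).
  by rewrite (lt_le_trans _ xM) // ltrBlDr ltrDl.
split; first exact: d.
by rewrite derive1E.
Qed.

End Primitives.

Section PartialPrimitives.
Variables (R : realType) (M : R).
Implicit Types (G : plane R -> R) (z : plane R).
Hypothesis M0 : 0 < M.

Definition box_supp G := forall z, M <= `|z.1| \/ M <= `|z.2| -> G z = 0.

(** Compactness gives a common [del] for pairs with at least one point in the closed box; outside
    this box [G] vanishes. *)
Lemma unif_cont G : continuous G -> box_supp G -> forall e, 0 < e ->
  exists2 del, 0 < del & forall z z', `|z.1 - z'.1| < del ->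
    `|z.2 - z'.2| < del -> `|G z - G z'| < e.
Proof.
move=> cG sG e e0.
pose K : set (plane R) := `[- M, M]%classic `*` `[- M, M]%classic.
have cK : compact K by apply: compact_setX; exact: segment_compact.
have ex p : exists d : R, 0 < d /\
    forall z, `|z.1 - p.1| < 2 * d -> `|z.2 - p.2| < 2 * d -> `|G z - G p| < e / 2.
  have e2 : 0 < e / 2 by rewrite divr_gt0.
  have /nbhs_box[d d0 hd] : \forall z \near p, `|G z - G p| < e / 2.
    by have /cvgrPdist_lt/(_ _ e2) := cG p; apply: filterS => z; rewrite distrC.
  exists (d / 2); split=> [|z]; first by rewrite divr_gt0.
  by rewrite mulrC divfK ?pnatr_eq0 //; exact: hd.
have [d hd] := choice ex.
have d0 p : 0 < d p by have [] := hd p.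
pose W p := interior [set z : plane R | `|z.1 - p.1| < d p /\ `|z.2 - p.2| < d p].
have [||D DK KD] := plane_finite_cover (W := W) cK.
- by move=> p; exact: open_interior.
- by move=> p Kp; apply/nbhs_box; exists (d p); rewrite ?subrr ?normr0.
have [del del0 hdel] : exists2 del, 0 < del & forall p, p \in D -> del <= d p.
  elim: D {DK KD} => [|p D [del del0 ih]]; first by exists 1.
  exists (Num.min del (d p)); first by rewrite lt_min del0 d0.
  move=> q; rewrite in_cons ge_min => /predU1P[->|/ih ->//]; by rewrite lexx orbT.
have inK z z' : K z -> `|z.1 - z'.1| < del -> `|z.2 - z'.2| < del -> `|G z - G z'| < e.
  move=> /KD[p /hdel pD /interior_subset[h1 h2]] h1' h2'.
  have a1 : `|G z - G p| < e / 2 by apply: (proj2 (hd p)); have := d0 p; lra.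
  have a2 : `|G z' - G p| < e / 2.
    apply: (proj2 (hd p)).
      by have := ler_distD z.1 z'.1 p.1; rewrite (distrC z'.1 z.1); lra.
    by have := ler_distD z.2 z'.2 p.2; rewrite (distrC z'.2 z.2); lra.
  by have := ler_distD (G p) (G z) (G z'); rewrite (distrC (G p)); lra.
have outK z : ~ K z -> G z = 0.
  move=> nK; apply: sG; apply: contrapT => /not_orP[/negP + /negP].
  rewrite -!ltNge => /ltW h1 /ltW h2; apply: nK.
  by split; rewrite /= in_itv /= -ler_norml.
exists del => // z z' h1 h2.
have [Kz|nKz] := pselect (K z); first exact: inK.
have [Kz'|nKz'] := pselect (K z').
  by rewrite distrC; apply: inK => //; rewrite distrC.
by rewrite !outK // subrr normr0.
Qed.

Lemma continuous_row G y : continuous G -> continuous (fun t => G (t, y)).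
Proof.
move=> cG t; apply: (@continuous_comp _ _ _ (fun t : R => (t, y) : plane R) G); last exact: cG.
by apply: (@continuous_pair R R id (cst y)); [exact: cvg_id | exact: cvg_cst].
Qed.

Definition rprim G z := prim M (fun t => G (t, z.2)) z.1.

Lemma rprim_dx G z : continuous G -> box_supp G ->
  is_derive z.1 (1 : R) (fun t => rprim G (t, z.2)) (G z).
Proof.
move=> cG sG; rewrite [z in G z]surjective_pairing.
apply: (@is_derive_prim R M (fun t => G (t, z.2))); first exact: continuous_row.
move=> t tM; apply: sG; left => /=; rewrite -normrN (le_trans _ (ler_norm _)) //.
by rewrite lerNr.
Qed.

Lemma rprim_eq0 G z : box_supp G -> z.1 <= - M \/ M <= `|z.2| -> rprim G z = 0.
Proof.
move=> sG hz; apply: prim_eq0 => t tz; apply: sG.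
case: hz => hz; [left|by right].
by rewrite -normrN (le_trans _ (ler_norm _)) //= lerNr (le_trans tz).
Qed.

(** Both primitives vanish at abscissa [- M], and their difference has slope at most [C]. *)
Lemma ler_rprim G G' y y' (C x : R) : continuous G -> box_supp G ->
  continuous G' -> box_supp G' ->
  (forall t, `|G (t, y) - G' (t, y')| <= C) ->
  `|rprim G (x, y) - rprim G' (x, y')| <= C * `|x + M|.
Proof.
move=> cG sG cG' sG' h.
have := @ler_dist_derive R (fun t => rprim G (t, y) - rprim G' (t, y'))
  (fun t => G (t, y) - G' (t, y')) C (- M) x.
have e1 : rprim G (- M, y) = 0 by apply: rprim_eq0 => //; left.
have e2 : rprim G' (- M, y') = 0 by apply: rprim_eq0 => //; left.
rewrite e1 e2 subr0 subr0 opprK; apply=> // t.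
by apply: is_deriveB; [exact: (@rprim_dx G (t, y)) | exact: (@rprim_dx G' (t, y'))].
Qed.

Lemma continuous_rprim G : continuous G -> box_supp G -> continuous (rprim G).
Proof.
move=> cG sG z; apply/cvgrPdist_lt => e e0.
have e2 : 0 < e / 2 by rewrite divr_gt0.
pose C := `|z.1| + 1 + M.
have C0 : 0 < C by rewrite /C ltr_wpDl // addr_ge0.
have [d d0 hd] := unif_cont cG sG (divr_gt0 e2 C0).
have c1 : {for z.1, continuous (fun t => rprim G (t, z.2))}.
  by apply/differentiable_continuous/derivable1_diffP; case: (rprim_dx z cG sG).
have n2 : \forall q \near z, `|rprim G (z.1, z.2) - rprim G (q.1, z.2)| < e / 2.
  have /cvgrPdist_lt/(_ _ e2) h := c1.
  exact: (@cvg_fst _ _ (nbhs z.1) (nbhs z.2) _ _ h).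
have n3 : \forall q \near z, `|q.1 - z.1| < 1 /\ `|q.2 - z.2| < d.
  apply/nbhs_box; exists (Num.min 1 d); first by rewrite lt_min ltr01.
  by move=> q; rewrite !lt_min => /andP[? ?] /andP[].
apply: filterS2 n2 n3 => q n2 [q1 q2].
rewrite [z in rprim G z]surjective_pairing [q in rprim G q]surjective_pairing.
rewrite (le_lt_trans (ler_distD (rprim G (q.1, z.2)) _ _)) //.
suff : `|rprim G (q.1, z.2) - rprim G (q.1, q.2)| <= e / 2 by lra.
apply: (le_trans (@ler_rprim G G z.2 q.2 (e / 2 / C) q.1 cG sG cG sG _)).
  move=> t; apply/ltW/hd => /=; first by rewrite subrr normr0.
  by rewrite distrC.
rewrite mulrAC ler_pdivrMr // ler_pM2l // /C (le_trans (ler_normD _ _)) //.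
rewrite (gtr0_norm M0) lerD2r //.
by have := ler_distD z.1 q.1 0; rewrite !subr0; lra.
Qed.

(** Differentiation under the integral sign. As a function of the abscissa, the remainder of first
    order vanishes at [- M], and its slope is the remainder of [G], which uniform continuity of [Gy]
    makes small relative to [h] on all rows at once. *)
Lemma rprim_dy G Gy z : continuous G -> box_supp G -> continuous Gy -> box_supp Gy ->
  (forall z, is_derive z.2 (1 : R) (fun t => G (z.1, t)) (Gy z)) ->
  is_derive z.2 (1 : R) (fun t => rprim G (z.1, t)) (rprim Gy z).
Proof.
move=> cG sG cGy sGy dG; apply: is_derive_eps => e e0.
pose C := `|z.1 + M| + 1.
have C0 : 0 < C by rewrite ltr_wpDl.
have [d d0 hd] := unif_cont cGy sGy (divr_gt0 e0 C0).
exists d => // h hhd; rewrite -surjective_pairing.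
have := @ler_dist_derive R
  (fun t => rprim G (t, z.2 + h) - rprim G (t, z.2) - h * rprim Gy (t, z.2))
  (fun t => G (t, z.2 + h) - G (t, z.2) - h * Gy (t, z.2)) (e / C * `|h|) (- M) z.1.
have e0' G' y : box_supp G' -> rprim G' (- M, y) = 0.
  by move=> sG'; apply: rprim_eq0 => //; left.
rewrite !e0' // mulr0 !subr0 opprK -!surjective_pairing => H.
apply: (le_trans (H _ _)).
- move=> t; apply: is_deriveB; first by apply: is_deriveB;
    [exact: (@rprim_dx G (t, _)) | exact: (@rprim_dx G (t, _))].
  exact: (is_deriveZ h (@rprim_dx Gy (t, z.2) cGy sGy)).
- move=> t.
  (* The remainder of [G] is the increment of this function of [s] between [0] and [1], so the mean
     value theorem reduces it to a variation of [Gy]. *)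
  have dGs s : is_derive s (1 : R) (fun s => G (t, z.2 + s * h) - s * h * Gy (t, z.2))
      (h * (Gy (t, z.2 + s * h) - Gy (t, z.2))).
    have a1 := is_deriveD (is_derive_cst z.2 s 1) (is_deriveM (is_derive_id s (1 : R)) (is_derive_cst h s 1)).
    have a2 : is_derive s (1 : R) (fun s : R => z.2 + s * h) h.
      by apply: is_derive_eq a1 _; rewrite /= scaler0 add0r [_ *: 1]mulr1 add0r.
    have a3 : is_derive s (1 : R) (fun s => G (t, z.2 + s * h)) (Gy (t, z.2 + s * h) * h).
      exact: (@is_derive1_comp R (fun u => G (t, u)) (fun s : R => z.2 + s * h) s _ _ (dG (t, z.2 + s * h)) a2).
    have a4 := is_deriveM (is_deriveM (is_derive_id s (1 : R)) (is_derive_cst h s 1)) (is_derive_cst (Gy (t, z.2)) s 1).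
    have a5 : is_derive s (1 : R) (fun s : R => s * h * Gy (t, z.2)) (h * Gy (t, z.2)).
      apply: is_derive_eq a4 _; rewrite /= !scaler0 !add0r.
      by rewrite /GRing.scale /= mulr1 mulrC.
    by apply: is_derive_eq (is_deriveB a3 a5) _; ring.
  have [|s] := MVT ltr01 (fun s _ => dGs s).
    by apply: derivable_within_continuous => s _; case: (dGs s).
  rewrite in_itv /= => /andP[s0 s1].
  rewrite !mul1r !mul0r addr0 subr0 subr0 mulr1 => E.
  have -> : G (t, z.2 + h) - G (t, z.2) - h * Gy (t, z.2) =
    G (t, z.2 + h) - h * Gy (t, z.2) - G (t, z.2) by ring.
  rewrite E normrM mulrC ler_wpM2r // ltW // hd //= ?subrr ?normr0 //.
  rewrite addrAC subrr add0r normrM (le_lt_trans _ hhd) // ler_piMl //.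
  by rewrite gtr0_norm // ltW.
rewrite mulrAC ler_wpM2r // mulrAC ler_pdivrMr // ler_pM2l //.
by rewrite lerDl.
Qed.

End PartialPrimitives.

Section Gauge.
Variable R : realType.
Implicit Types (z : plane R).

(** Outside the larger box, [F] vanishes on a neighbourhood, hence so do its partial derivatives. *)
Lemma box_supp_isC1 (M : R) (F : plane R -> R) fx fy :
  (forall z, has_grad F z (fx z) (fy z)) -> box_supp M F ->
  [/\ box_supp (M + 1) F, box_supp (M + 1) fx & box_supp (M + 1) fy].
Proof.
move=> gF sF.
have nF z : M + 1 <= `|z.1| \/ M + 1 <= `|z.2| -> \forall q \near z, 0 = F q.
  move=> hz; apply/nbhs_box; exists 1 => // q q1 q2; rewrite sF //.
  case: hz => hz; [left|right].
    by have := ler_distD q.1 z.1 0; rewrite !subr0 (distrC z.1); lra.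
  by have := ler_distD q.2 z.2 0; rewrite !subr0 (distrC z.2); lra.
have g0 z hz := has_grad_near (nF z hz) (has_grad_cst 0 z).
split=> z hz.
- by apply: sF; case: hz => hz; [left|right]; lra.
- by have [] := has_grad_derive (g0 z hz); have [-> _] := has_grad_derive (gF z).
- by have [] := has_grad_derive (g0 z hz); have [_ ->] := has_grad_derive (gF z).
Qed.

(* Integrating the first coefficient along horizontal lines. *)
Lemma gauge (M0 : R) (F1 F2 : plane R -> R) : 0 < M0 ->
  isC1 F1 -> isC1 F2 -> box_supp M0 F1 -> box_supp M0 F2 ->
  exists M phi b B, [/\ M0 < M, continuous b /\
    (forall z, z.1 <= - M \/ M <= `|z.2| -> b z = 0),
    [/\ continuous B, box_supp M B &
      forall z, is_derive z.1 (1 : R) (fun t => b (t, z.2)) (B z)],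
    (forall z, has_grad phi z (F1 z) (F2 z - b z)) &
    forall z, B z = 'D_(dx R) F2 z - 'D_(dy R) F1 z].
Proof.
move=> M00 C1 C2 s1 s2; have c1 := isC1_continuous C1; have c2 := isC1_continuous C2.
move: C1 C2 => [f1x [f1y [g1 c1x c1y]]] [f2x [f2y [g2 c2x c2y]]].
have [s1' _ s1y] := box_supp_isC1 g1 s1.
have [s2' s2x _] := box_supp_isC1 g2 s2.
have M1 : 0 < M0 + 1 by lra.
(* With [phi] the row primitive of [F1], the remaining coefficient is [F2] minus the second partial
   derivative of [phi]; its derivative [B] along rows is the curl of the extended form, which
   vanishes wherever that form is closed. *)
exists (M0 + 1), (rprim (M0 + 1) F1), (fun z => F2 z - rprim (M0 + 1) f1y z),
  (fun z => f2x z - f1y z); split.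
- by rewrite ltrDl.
- split; first by move=> z; apply: cvgB; [exact: c2 | exact: continuous_rprim].
  move=> z hz; rewrite rprim_eq0 // subr0 s2' //.
  by case: hz => hz; [left; have := ler_norm (- z.1); rewrite normrN; lra | right].
- split.
  + by move=> z; apply: cvgB; [exact: c2x | exact: c1y].
  + by move=> z hz; rewrite s2x // s1y // subrr.
  + move=> z; apply: is_deriveB; last exact: rprim_dx.
    by have [_ h _] := g2 z.
- move=> z; split; first exact: continuous_rprim.
    exact: rprim_dx.
  rewrite opprB addrCA subrr addr0; apply: rprim_dy => //.
  by move=> {}z; have [_ _ h] := g1 z.
- by move=> z; have [-> _] := has_grad_derive (g2 z); have [_ ->] := has_grad_derive (g1 z).
Qed.

End Gauge.

Lemma continuous_bigsum (R : realType) (T : topologicalType) (I : Type) (r : seq I)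
    (F : I -> T -> R) :
  (forall i, continuous (F i)) -> continuous (fun z => \sum_(i <- r) F i z).
Proof.
move=> cF; elim: r => [|i r ih].
  have -> : (fun z => \sum_(i <- [::]) F i z) = cst 0.
    by apply/funext => z; rewrite big_nil.
  by move=> z; exact: cvg_cst.
have -> : (fun z => \sum_(j <- i :: r) F j z) = fun z => F i z + \sum_(j <- r) F j z.
  by apply/funext => z; rewrite big_cons.
by move=> z; apply: cvgD; [exact: cF | exact: ih].
Qed.

(** * Closed forms modulo exact ones *)

Section Spanned.
Variables (R : realType) (V : set (plane R)) (n : nat) (pole : 'I_n -> plane R).

Definition spanned (w : plane R -> plane R) :=
  exists nu : 'I_n -> R, exact_on V (fun z => w z - \sum_j nu j *: dth (pole j) z).

Lemma spanned_exact w : exact_on V w -> spanned w.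
Proof.
move=> ew; exists (fun=> 0); apply: exact_on_eq ew => z _.
by rewrite big1 ?subr0 // => j _; rewrite scale0r.
Qed.

Lemma spanned_eq w w' : (forall z, V z -> w z = w' z) -> spanned w -> spanned w'.
Proof. by move=> e [nu h]; exists nu; apply: exact_on_eq h => z Vz; rewrite e. Qed.

Lemma spannedD w w' : spanned w -> spanned w' -> spanned (fun z => w z + w' z).
Proof.
move=> [nu h] [nu' h']; exists (fun j => nu j + nu' j).
apply: exact_on_eq (exact_onD h h') => z _; rewrite addrACA -opprD; congr (_ - _).
by rewrite -big_split; apply: eq_bigr => j _; rewrite scalerDl.
Qed.

Lemma spannedZ (k : R) w : spanned w -> spanned (fun z => k *: w z).
Proof.
move=> [nu h]; exists (fun j => k * nu j).
apply: exact_on_eq (exact_onZ k h) => z _; rewrite scalerBr; congr (_ - _).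
by rewrite scaler_sumr; apply: eq_bigr => j _; rewrite scalerA.
Qed.

Lemma spanned_sum (I : Type) (r : seq I) (w : I -> plane R -> plane R) :
  (forall i, spanned (w i)) -> spanned (fun z => \sum_(i <- r) w i z).
Proof.
move=> h; elim: r => [|i r ih].
  by apply: spanned_exact; apply: exact_on_eq (exact_on0 V) => z _; rewrite big_nil.
by apply: spanned_eq (spannedD (h i) ih) => z _; rewrite big_cons.
Qed.

Lemma spanned_dth p :
  exact_on V (dth p) \/ (exists j, cohom V p (pole j)) -> spanned (dth p).
Proof.
case=> [/spanned_exact//|[j0 hj]]; exists (fun j => (j == j0)%:R).
apply: exact_on_eq hj => z _; congr (_ - _).
rewrite (bigD1 j0) //= eqxx scale1r big1 ?addr0 // => j /negbTE ->.
by rewrite scale0r.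
Qed.

(** Outside the box, [(0, b)] lives only on the half-strip to its right, so its period around the
    box is the integral of [be]. Dividing by [2 * pi] gives the coefficient of [dth q] with the same
    period. *)
Lemma spanned_box q (h M : R) (be : R -> R) (b : plane R -> R) :
  0 < h -> spanned (dth q) ->
  (forall z, V z -> h < `|z.1 - q.1| \/ h < `|z.2 - q.2|) ->
  continuous be -> - M <= q.2 - h ->
  (forall y, h <= `|y - q.2| -> be y = 0) ->
  (forall z, q.1 + h < z.1 -> b z = be z.2) ->
  (forall z, z.1 < q.1 - h -> b z = 0) ->
  (forall z, h < `|z.2 - q.2| -> b z = 0) ->
  spanned (fun z => (0, b z)).
Proof.
move=> h0 sq Vbox cbe Mq be0 b1 b2 b3.
pose P := prim M be; pose nu := P (q.2 + h) / (2 * pi).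
have be_l y : y <= q.2 - h -> be y = 0.
  by move=> yq; apply: be0; rewrite ler_normr; apply/orP; right; lra.
have dP y : is_derive y (1 : R) P (be y).
  by apply: is_derive_prim => // t tM; apply: be_l; rewrite (le_trans tM).
have pi0 : (2 * pi : R) != 0 by rewrite mulf_neq0 ?pnatr_eq0 // gt_eqF // pi_gt0.
have := @exact_box R V q h nu P be b h0 Vbox dP.
have PE y : q.2 + h < y -> P y = 2 * pi * nu.
  move=> yq; rewrite /nu mulrC divfK //.
  have [|c] := MVT yq (fun t _ => dP t).
    by apply: derivable_within_continuous => t _; case: (dP t).
  rewrite in_itv /= => /andP[qc _].
  rewrite be0 ?mul0r => [/eqP|]; first by rewrite subr_eq0 => /eqP.
  by rewrite ler_normr; apply/orP; left; lra.
have P0 y : y < q.2 - h -> P y = 0.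
  by move=> yq; apply: prim_eq0 => t ty; apply: be_l; lra.
move=> /(_ P0 PE b1 b2 b3)/spanned_exact sx.
by apply: spanned_eq (spannedD sx (spannedZ nu sq)) => z _; rewrite subrK.
Qed.

End Spanned.

(** * Decomposition of a closed form on a grid *)

Section Decomposition.
Variables (R : realType) (V : set (plane R)) (n : nat) (pole : 'I_n -> plane R).
Hypothesis V_dth : forall p, ~ V p -> spanned V pole (dth p).
Variables (M : R) (b B : plane R -> R).
Hypothesis M0 : 0 < M.
Hypothesis VM : forall z, V z -> `|z.1| < M /\ `|z.2| < M.
Hypothesis cb : continuous b.
Hypothesis b0 : forall z, z.1 <= - M \/ M <= `|z.2| -> b z = 0.
Hypothesis cB : continuous B.
Hypothesis sB : box_supp M B.
Hypothesis dB : forall z, is_derive z.1 (1 : R) (fun t => b (t, z.2)) (B z).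
Hypothesis B0 : forall z, V z -> B z = 0.

Let ramp (t : R) := Num.min (Num.max t 0) 1.

Let ramp0 t : t <= 0 -> ramp t = 0.
Proof. by move=> t0; rewrite /ramp max_r // min_l // ler01. Qed.

Let ramp1 t : 1 <= t -> ramp t = 1.
Proof. by move=> t1; rewrite /ramp max_l ?min_r // (le_trans ler01). Qed.

Let ramp_le s t : s <= t -> ramp s <= ramp t.
Proof.
move=> st; rewrite /ramp; case: (leP s 0) => s0; case: (leP t 0) => t0.
all: by rewrite ?(min_l ler01) ?lexx //; case: (leP s 1) => s1; case: (leP t 1) => t1; lra.
Qed.

Let continuous_ramp : continuous ramp.
Proof.
apply: continuous_minr; last by move=> x; exact: cvg_cst.
by apply: continuous_maxr => x; [exact: cvg_id | exact: cvg_cst].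
Qed.

(** A cell that meets [V] contains a zero of [B], so [B] is small on the whole cell and the
    increment of [b] across it is small. The error collects exactly these cells; the others can
    carry a pole at their centre. *)
Lemma decomposition (e : R) : 0 < e ->
  exists err : plane R -> R, [/\ continuous err, forall z, V z -> `|err z| <= e &
    spanned V pole (fun z => (0, b z - err z))].
Proof.
(* Each column contributes at most [e' * (2 * h)] to the error, since the tents sum to [1], and the
   [m] columns have total width [2 * M]. *)
move=> e0; pose e' := e / (2 * M).
have e'0 : 0 < e' by rewrite divr_gt0 // mulr_gt0.
have [del del0 hdel] := unif_cont cB sB e'0.
have [m' hm'] : exists m' : nat, 2 * M / del < m'.+1%:R.
  exists (Num.truncn (2 * M / del)); exact: truncnS_gt.
pose m := m'.+1; pose h := M / m%:R.
have m0 : 0 < m%:R :> R by rewrite ltr0n.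
have h0 : 0 < h by rewrite divr_gt0.
have hM : h <= M by rewrite ler_pdivrMr // ler_peMr ?(ltW M0) // ler1n.
have hd : 2 * h < del by rewrite mulrA ltr_pdivrMr // (mulrC del) -ltr_pdivrMr.
have mh : m%:R * h = M by rewrite mulrC divfK // gt_eqF.
pose x (i : nat) := - M + i%:R * (2 * h).
(* Tent [j] is centred at [y j + h] with half-width [h]. The sum of the tents telescopes to the ramp
   at [y 0 = - 2 * M] minus the ramp at [y (3 * m) = M], which is [1] on []-M, M[] because
   [h <= M]. *)
pose y (j : nat) := - (2 * M) + j%:R * h.
have xS i : x i.+1 = x i + 2 * h by rewrite /x -[i.+1]addn1 natrD; ring.
pose c (j : nat) (t : R) := ramp ((t - y j) / h).
pose tent j t := c j t - c j.+1 t.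
have cS j t : c j.+1 t = ramp ((t - y j) / h - 1).
  rewrite /c; congr ramp; rewrite /y -[j.+1]addn1 natrD; field; exact: lt0r_neq0.
have tent_ge0 j t : 0 <= tent j t by rewrite subr_ge0 cS ramp_le // gerBl.
have tent_eq0 j t : h <= `|t - (y j + h)| -> tent j t = 0.
  rewrite ler_normr => /orP[] ht; rewrite /tent cS /c.
    rewrite !ramp1 ?subrr // ?lerBrDr -?(natrD _ 1 1) ler_pdivlMr //; lra.
  rewrite !ramp0 ?subrr // ?lerBlDr ?add0r ler_pdivrMr //; lra.
have ctent j : continuous (tent j).
  have cc k : continuous (c k).
    move=> t; apply: (@continuous_comp _ _ _ (fun t => (t - y k) / h) ramp); last exact: continuous_ramp.
    by apply: cvgM; [apply: cvgB; [exact: cvg_id | exact: cvg_cst] | exact: cvg_cst].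
  by move=> t; apply: cvgB; exact: cc.
(* On [V], [b] is the sum of the [bij i j]: the increment of [b] over the column
   from [x i] to [x i.+1], times a tent in the second coordinate. *)
pose bm (i : nat) (z : plane R) := b (Num.min z.1 (x i), z.2).
have cbm i : continuous (bm i).
  move=> z; apply: (@continuous_comp _ _ _ (fun z : plane R => (Num.min z.1 (x i), z.2) : plane R) b); last exact: cb.
  apply: (@continuous_pair R _ (fun z : plane R => Num.min z.1 (x i)) snd); last exact: cvg_snd.
  apply: (@continuous_minr R _ fst (cst (x i))) => {}z; [exact: cvg_fst | exact: cvg_cst].
pose bij i j z := tent j z.2 * (bm i.+1 z - bm i z).
have cbij i j : continuous (bij i j).
  move=> z; apply: cvgM; last by apply: cvgB; exact: cbm.
  by apply: (@continuous_comp _ _ _ snd (tent j)); [exact: cvg_snd | exact: ctent].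
pose cell (i j : nat) := [set z : plane R | x i <= z.1 <= x i.+1 /\ y j <= z.2 <= y j + 2 * h].
pose meets i j := `[< exists w, V w /\ cell i j w >].
have tent_sum t : `|t| < M -> \sum_(j < 3 * m) tent j t = 1.
  move=> tM; rewrite -(big_mkord xpredT (fun j => tent j t)) /tent.
  under eq_bigr do rewrite -opprB.
  rewrite sumrN telescope_sumr // opprB /c ramp1 ?ramp0 ?subr0 //.
    rewrite ler_pdivrMr // mul0r /y natrM -mulrA mh.
    by have := ler_norm t; lra.
  rewrite ler_pdivlMr // /y mul0r addr0.
  by have := ler_norm (- t); rewrite normrN; lra.
have bE z : V z -> b z = \sum_(i < m) \sum_(j < 3 * m) bij i j z.
  move=> Vz; have [z1 z2] := VM Vz.
  have -> : \sum_(i < m) \sum_(j < 3 * m) bij i j z =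
    \sum_(i < m) (bm i.+1 z - bm i z) * \sum_(j < 3 * m) tent j z.2.
    by apply: eq_bigr => i _; rewrite mulr_sumr; apply: eq_bigr => j _; rewrite mulrC.
  rewrite -mulr_suml.
  rewrite tent_sum //.
  rewrite mulr1 -(big_mkord xpredT (fun i => bm i.+1 z - bm i z)) telescope_sumr //.
  rewrite /bm /x mul0r addr0 mulrCA mh min_l; last by have := ler_norm z.1; lra.
  rewrite [X in _ - X]b0 ?subr0 -?surjective_pairing //.
  by left; rewrite /= ge_min lexx orbT.
pose err z := \sum_(i < m) \sum_(j < 3 * m) (if meets i j then bij i j z else 0).
have bij_small i j z : meets i j -> `|bij i j z| <= tent j z.2 * (e' * (2 * h)).
  move=> /asboolP[w [Vw [w1 w2]]].
  have [tz|tz] := leP h `|z.2 - (y j + h)|.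
    by rewrite /bij tent_eq0 // !mul0r normr0.
  rewrite /bij normrM (ger0_norm (tent_ge0 _ _)) ler_wpM2l //.
  set u := Num.min z.1 (x i.+1); set v := Num.min z.1 (x i).
  have uv : v <= u by rewrite /u /v le_min !ge_min lexx /= xS lerDl mulr_ge0 ?orbT // ltW.
  have uv2 : u - v <= 2 * h.
    rewrite /u /v xS; case: (leP z.1 (x i)) => a1; case: (leP z.1 (x i + 2 * h)) => a2; lra.
  rewrite /bm -/u -/v; move: uv; rewrite le_eqVlt => /predU1P[->|uv].
    by rewrite subrr normr0 mulr_ge0 ?ltW // mulr_gt0.
  have [|t] := @MVT R (fun t => b (t, z.2)) (fun t => B (t, z.2)) v u uv (fun t _ => dB (t, z.2)).
    by apply: derivable_within_continuous => t _; case: (dB (t, z.2)).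
  rewrite in_itv /= => /andP[vt tu] ->.
  rewrite normrM ler_pM // ?(ger0_norm (_ : 0 <= u - v)) ?subr_ge0 ?(ltW uv) //.
  (* If [z] were left of the column, both truncated abscissas would be [z.1] and the increment would
     vanish; so the mean value point lies in the column, within [2 * h < del] of [w] in each
     coordinate. *)
  have vx : v = x i.
    by move: vt tu; rewrite /u /v; case: (leP z.1 (x i)) => // a1 a2; rewrite lt_min => /andP[? ?]; lra.
  have ux : u <= x i.+1 by rewrite /u ge_min lexx orbT.
  rewrite -[B _]subr0 -(B0 Vw); apply/ltW/hdel => /=.
    move: w1; rewrite xS in ux * => w1; rewrite ltr_norml; apply/andP; split; lra.
  by move: tz; rewrite ltr_norml => /andP[? ?]; rewrite ltr_norml; apply/andP; split; lra.
exists err; split.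
- apply: continuous_bigsum => i; apply: continuous_bigsum => j.
  by case: (meets i j); [exact: cbij | move=> z; exact: cvg_cst].
- move=> z Vz; have [z1 z2] := VM Vz.
  have : `|err z| <= \sum_(i < m) \sum_(j < 3 * m) tent j z.2 * (e' * (2 * h)).
    apply: (le_trans (ler_norm_sum _ _ _)); apply: ler_sum => i _.
    apply: (le_trans (ler_norm_sum _ _ _)); apply: ler_sum => j _.
    case: ifPn => mij; first exact: bij_small.
    by rewrite normr0 mulr_ge0 // mulr_ge0 ?ltW // mulr_gt0.
  move=> /le_trans; apply.
  under eq_bigr do rewrite -mulr_suml tent_sum // mul1r.
  rewrite sumr_const card_ord -[_ *+ m]mulr_natl.
  have -> : m%:R * (e' * (2 * h)) = e' * (2 * (m%:R * h)) by ring.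
  by rewrite mh /e' divfK // gt_eqF // mulr_gt0.
- apply: (@spanned_eq _ _ _ _ (fun z => \sum_(i < m) \sum_(j < 3 * m)
    ((0, if meets i j then 0 else bij i j z) : plane R))).
    move=> z Vz; rewrite bE // /err -sumrB.
    have pair_sum (I : finType) (F : I -> R) : \sum_i ((0, F i) : plane R) = (0, \sum_i F i).
      by elim/big_rec2: _ => // i u v _ ->; apply/eqP; rewrite xpair_eqE /= addr0 !eqxx.
    rewrite -pair_sum; apply: eq_bigr => i _.
    rewrite -sumrB -pair_sum; apply: eq_bigr => j _.
    by case: ifP => _; rewrite ?subrr ?subr0.
  apply: spanned_sum => i; apply: spanned_sum => j.
  case: (boolP (meets i j)) => mij; first by apply: spanned_exact; exact: exact_on0.
  have nV z : cell i j z -> ~ V z by move=> cz Vz; move/asboolP: mij; apply; exists z.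
  pose q : plane R := (x i + h, y j + h).
  (* The bound is [2 * M] because the lowest cells start at [y 0 = - 2 * M]. The cell is the closed
     box of half-side [h] about [q], so it misses [V] together with its centre. *)
  apply: (@spanned_box _ _ _ _ q h (2 * M) (fun t => tent j t * (b (x i.+1, t) - b (x i, t)))) => //.
  + apply: V_dth; apply: nV; split; rewrite /= ?xS; apply/andP; split; lra.
  + move=> z Vz; apply: contrapT => /not_orP[/negP + /negP].
    rewrite -!leNgt !ler_norml /q /= => /andP[? ?] /andP[? ?]; apply: (nV z) Vz.
    split; rewrite ?xS; apply/andP; split; lra.
  + move=> t; apply: cvgM; first exact: ctent.
    have cbx s : continuous (fun t => b (s, t)).
      move=> t'; apply: (@continuous_comp _ _ _ (fun t : R => (s, t) : plane R) b); last exact: cb.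
      by apply: (@continuous_pair R R (cst s) id); [exact: cvg_cst | exact: cvg_id].
    by apply: cvgB; exact: cbx.
  + by rewrite /q /= addrK /y lerDl mulr_ge0 // ltW.
  + by move=> t ht; rewrite tent_eq0 // mul0r.
  + move=> z; rewrite /q /= => hz; rewrite /bij /bm !min_r //= ?xS; lra.
  + move=> z; rewrite /q /= => hz; rewrite /bij /bm !min_l /= ?xS; [|lra|lra].
    by rewrite subrr mulr0.
  + by move=> z hz; rewrite /bij tent_eq0 ?mul0r // ltW.
Qed.

End Decomposition.

(** The poles are fixed once and for all; the coefficients and the error depend on [e]. Closedness
    enters as the vanishing of [B] on [Omega]. *)
Lemma closed_form_decomposition (R : realType) (Omega : set (plane R)) (n : nat)
    (A : plane R -> plane R) :
  domain Omega -> bounded_set Omega -> smooth_boundary Omega -> has_holes n Omega ->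
  potential Omega A -> closed_form Omega A ->
  exists F1 F2 (pole : 'I_n -> plane R),
    [/\ continuous F1, continuous F2, forall z, Omega z -> A z = (F1 z, F2 z),
      forall j, ~ Omega (pole j) &
      forall e, 0 < e -> exists nu err, [/\ continuous err,
        forall z, Omega z -> `|err z| <= e &
        exact_on Omega (fun z => A z - \sum_j nu j *: dth (pole j) z - (0, err z))]].
Proof.
move=> dO bO sO hO [/(smooth_extension bO)[F1 [C1 E1 [M1 M10 s1]]]
  /(smooth_extension bO)[F2 [C2 E2 [M2 M20 s2]]]] clA.
have oO : open Omega by have [] := dO.
have [M3 M30 hM] := bounded_box bO.
pose M0 := Num.max M1 (Num.max M2 M3).
have le1 : M1 <= M0 by rewrite le_max lexx.
have le2 : M2 <= M0 by rewrite !le_max lexx orbT.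
have le3 : M3 <= M0 by rewrite !le_max lexx !orbT.
have M00 : 0 < M0 by rewrite (lt_le_trans M10).
have s1' : box_supp M0 F1.
  by move=> z hz; apply: s1; case: hz => hz; [left|right]; rewrite (le_trans _ hz).
have s2' : box_supp M0 F2.
  by move=> z hz; apply: s2; case: hz => hz; [left|right]; rewrite (le_trans _ hz).
have [M [phi [b [B [MM0 [cb b0] [cB sB dB] gphi BE]]]]] := gauge M00 C1 C2 s1' s2'.
have [pole [npole hpole]] := poles oO dO bO sO hO.
exists F1, F2, pole; split => //; [exact: isC1_continuous | exact: isC1_continuous | |].
  by move=> z Oz; rewrite E1 // E2 // /= -surjective_pairing.
move=> e e0.
have B0 z : Omega z -> B z = 0.
  move=> Oz; have nO : \forall z' \near z, Omega z' by apply: open_nbhs_nbhs.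
  rewrite BE (@near_eq_derive _ _ _ F2 (snd \o A) z (dx R)); last first.
    by apply: filterS nO => z' /E2.
  rewrite (@near_eq_derive _ _ _ F1 (fst \o A) z (dy R)); last first.
    by apply: filterS nO => z' /E1.
  by rewrite clA // subrr.
have [||err [cerr err_e [nu [psi hpsi]]]] := @decomposition R Omega n pole _ M b B
    (lt_trans M00 MM0) _ cb b0 cB sB dB B0 e e0.
- by move=> p /hpole; exact: spanned_dth.
- by move=> z /hM[h1 h2]; split; lra.
exists nu, err; split=> //.
exists (fun z => phi z + psi z) => z Oz.
apply: has_grad_eq (has_gradD (gphi z) (hpsi z Oz)) _ _.
  by rewrite /= (E1 _ Oz) /= sub0r subr0.
by rewrite /= (E2 _ Oz) /=; ring.
Qed.

Notation mplane R := (plane (measurableTypeR R)).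

(** * Trial functions *)

Section PlaneMeasure.
Variable R : realType.
Local Notation mu := (@lebesgue_measure R).
Implicit Types (f g : plane R -> R) (z : plane R).

(** An open set is the union of the boxes with rational ends that it contains. *)
Lemma measurable_open_plane (A : set (plane R)) : open A ->
  measurable (A : set (mplane R)).
Proof.
move=> oA.
pose box (q : rat * rat * (rat * rat)) : set (mplane R) :=
  (`]ratr q.1.1, ratr q.1.2[%classic : set R) `*` (`]ratr q.2.1, ratr q.2.2[%classic : set R).
pose F q := if `[< box q `<=` A >] then box q else set0.
have -> : A = \bigcup_q F q.
  apply/seteqP; split=> [z Az|z [q _]]; last by rewrite /F; case: asboolP => [h /h|_ []].
  have /nbhs_box[e e0 he] : \forall q \near z, A q by apply: open_nbhs_nbhs.
  have rl (x : R) : exists q : rat * rat, x - e < ratr q.1 < x /\ x < ratr q.2 < x + e.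
    have /rat_in_itvoo[a] : x - e < x by rewrite gtrBl.
    have /rat_in_itvoo[b] : x < x + e by rewrite ltrDl.
    by rewrite !in_itv /= => hb ha; exists (a, b).
  have [q1 [a1 b1]] := rl z.1; have [q2 [a2 b2]] := rl z.2.
  exists (q1, q2) => //; rewrite /F.
  have -> : `[< box (q1, q2) `<=` A >].
    apply/asboolP => w [w1 w2]; rewrite /= !in_itv /= in w1 w2; apply: he.
      by rewrite ltr_norml; apply/andP; split; lra.
    by rewrite ltr_norml; apply/andP; split; lra.
  by split; rewrite /= in_itv /=; apply/andP; split; lra.
apply: countable_bigcupT_measurable; first exact: countableP.
move=> q; rewrite /F; case: ifP => _ //.
by apply: measurableX; exact: measurable_itv.
Qed.

Lemma measurable_continuous_on (A : set (plane R)) f : open A ->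
  (forall z, A z -> {for z, continuous f}) ->
  measurable_fun (A : set (mplane R)) (f : mplane R -> R).
Proof.
move=> oA cf; apply: (measurability _ (RGenOpens.measurableE R)).
move=> _ [_ [a [b ->] <-]]; apply: measurable_open_plane.
rewrite openE => z [Az faz]; apply: filterI; first by apply: open_nbhs_nbhs.
by apply: (cf z Az); apply: open_nbhs_nbhs; split=> //; exact: interval_open.
Qed.

Lemma measurable_continuous f : continuous f -> measurable_fun setT (f : mplane R -> R).
Proof. by move=> cf; apply: measurable_continuous_on => // [|z _]; [exact: openT | exact: cf]. Qed.

Definition cbox (M : R) : set (mplane R) :=
  (`[- M, M]%classic : set R) `*` (`[- M, M]%classic : set R).

Lemma measurable_cbox M : measurable (cbox M).
Proof. by apply: measurableX; exact: measurable_itv. Qed.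

Lemma area_setX (A B : set (measurableTypeR R)) : measurable A -> measurable B ->
  area R (A `*` B) = (lebesgue_measure A * lebesgue_measure B)%E.
Proof. by move=> mA mB; exact: product_measure1E. Qed.

Lemma area_cbox M : 0 < M -> area R (cbox M) = ((2 * M) ^+ 2)%:E.
Proof.
move=> M0; rewrite /cbox area_setX; [|exact: measurable_itv|exact: measurable_itv].
have e : lebesgue_measure (`[- M, M]%classic : set R) = (2 * M)%:E.
  rewrite lebesgue_measure_itv /= lte_fin ifT; last by lra.
  by rewrite -EFinB; congr EFin; ring.
by rewrite e -EFinM -expr2.
Qed.

Lemma area_bounded (A : set (plane R)) : open A -> bounded_set A ->
  (area R A < +oo)%E.
Proof.
move=> oA /bounded_box[M M0 hM].
apply: (@le_lt_trans _ _ (area R (cbox M))); last by rewrite area_cbox // ltry.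
apply: le_measure; rewrite ?inE.
- exact: measurable_open_plane.
- exact: measurable_cbox.
- by move=> z /hM[h1 h2]; split; rewrite /= in_itv /= -ler_norml ltW.
Qed.

Lemma area_open_gt0 (A : set (plane R)) : open A -> A !=set0 -> (0 < area R A)%E.
Proof.
move=> oA [z Az].
have /nbhs_box[e e0 he] : \forall q \near z, A q by apply: open_nbhs_nbhs.
pose B : set (mplane R) := (`]z.1 - e, z.1 + e[%classic : set R) `*` (`]z.2 - e, z.2 + e[%classic : set R).
have mB : measurable B by apply: measurableX; exact: measurable_itv.
apply: (@lt_le_trans _ _ (area R B)); last first.
  apply: le_measure; rewrite ?inE //; first exact: measurable_open_plane.
  move=> w [w1 w2]; rewrite /= !in_itv /= in w1 w2; apply: he.
    by rewrite ltr_norml; apply/andP; split; lra.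
  by rewrite ltr_norml; apply/andP; split; lra.
rewrite /B area_setX; [|exact: measurable_itv|exact: measurable_itv].
have m1 (x : R) : lebesgue_measure (`]x - e, x + e[%classic : set R) = (2 * e)%:E.
  rewrite lebesgue_measure_itv /= lte_fin ifT; last by lra.
  by rewrite -EFinB; congr EFin; ring.
by rewrite !m1 -EFinM lte_fin !mulr_gt0.
Qed.

Lemma continuous_box_bounded (M : R) f : continuous f -> box_supp M f ->
  exists C, forall z, `|f z| <= C.
Proof.
move=> cf sf.
have cB : compact (`[- M, M]%classic `*` `[- M, M]%classic : set (plane R)).
  by apply: compact_setX; exact: segment_compact.
have := compact_bounded (continuous_compact (continuous_subspaceT cf) cB).
move=> [C0 [_ hC]]; exists (`|C0| + 1) => z.
have [Kz|nKz] := pselect ((`[- M, M]%classic `*` `[- M, M]%classic : set (plane R)) z).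
  apply: hC; first by rewrite (le_lt_trans (ler_norm _)) // ltrDl.
  by exists z.
rewrite sf ?normr0 ?addr_ge0 //.
apply: contrapT => /not_orP[/negP + /negP]; rewrite -!ltNge => /ltW h1 /ltW h2; apply: nKz.
by split; rewrite /= in_itv /= -ler_norml.
Qed.

Lemma integrable_box_supp (M : R) f : 0 < M -> continuous f -> box_supp M f ->
  (area R).-integrable setT (EFin \o (f : mplane R -> R)).
Proof.
move=> M0 cf sf; have [C hC] := continuous_box_bounded cf sf.
apply: (@le_integrable _ _ _ _ _ measurableT _ (EFin \o (fun z : mplane R => C * \1_(cbox M) z))).
- by apply/measurable_EFinP; exact: measurable_continuous.
- move=> z _; rewrite /= lee_fin indicE.
  have [zK|zK] := boolP (z \in cbox M).
    by rewrite mulr1 (le_trans (hC z)) // ler_norm.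
  rewrite mulr0 normr0 sf ?normr0 //.
  apply: contrapT => /not_orP[/negP + /negP]; rewrite -!ltNge => /ltW h1 /ltW h2.
  move/negP: zK; apply; rewrite inE.
  by split; rewrite /= in_itv /= -ler_norml.
- have := @integrableZl _ _ _ (area R) _ measurableT C (EFin \o \1_(cbox M)).
  apply; apply/integrableP; split.
    by apply/measurable_EFinP; apply: measurable_indic; exact: measurable_cbox.
  under eq_integral => z _ do rewrite gee0_abs ?lee_fin //.
  rewrite integral_indic //; last exact: measurable_cbox.
  by rewrite setIT; rewrite area_cbox // ltry.
Qed.

Lemma integral_derive_eq0 (M : R) (F f : R -> R) : 0 < M -> continuous f ->
  (forall t, is_derive t (1 : R) F (f t)) -> (forall t, M <= `|t| -> F t = 0) ->
  (forall t, M <= `|t| -> f t = 0) ->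
  (\int[mu]_t (f t)%:E = 0)%E.
Proof.
move=> M0 cf dF F0 f0.
have dFc t : {for t, continuous F}.
  by apply/differentiable_continuous/derivable1_diffP; case: (dF t).
have -> : (\int[mu]_t (f t)%:E = \int[mu]_(t in `[(- M)%R, M]) (f t)%:E)%E.
  rewrite [RHS]integral_mkcond; apply: eq_integral => t _.
  rewrite patchE; case: ifPn => // /negP tM; rewrite f0 //.
  rewrite leNgt; apply/negP => /ltW h; apply: tM; rewrite inE /= in_itv /=.
  by rewrite -ler_norml.
rewrite (@continuous_FTC2 _ f F).
- by rewrite !F0 ?normrN ?ler_norm // subee.
- by lra.
- exact: continuous_subspaceT.
- split=> [t _||]; first by case: (dF t).
    exact: cvg_at_right_filter (dFc _).
  exact: cvg_at_left_filter (dFc _).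
- by move=> t _; rewrite derive1E; case: (dF t).
Qed.

Lemma integral_dx_eq0 (M : R) F fx : 0 < M -> box_supp M F -> box_supp M fx ->
  continuous fx ->
  (forall z, is_derive z.1 (1 : R) (fun t => F (t, z.2)) (fx z)) ->
  (\int[area R]_z (fx z)%:E = 0)%E.
Proof.
move=> M0 sF sfx cfx dF.
have := integrable_box_supp M0 cfx sfx; rewrite /area => /fubini2 <-.
apply: integral0_eq => y _; rewrite /fubini_G /=.
apply: (@integral_derive_eq0 M (fun t => F (t, y))) => //.
- exact: continuous_row.
- by move=> t; exact: (dF (t, y)).
- by move=> t tM; apply: sF; left.
- by move=> t tM; apply: sfx; left.
Qed.

Lemma integral_dy_eq0 (M : R) F fy : 0 < M -> box_supp M F -> box_supp M fy ->
  continuous fy ->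
  (forall z, is_derive z.2 (1 : R) (fun t => F (z.1, t)) (fy z)) ->
  (\int[area R]_z (fy z)%:E = 0)%E.
Proof.
move=> M0 sF sfy cfy dF.
have := integrable_box_supp M0 cfy sfy; rewrite /area => /fubini1 <-.
apply: integral0_eq => x _; rewrite /fubini_F /=.
apply: (@integral_derive_eq0 M (fun t => F (x, t))) => //.
- move=> t; apply: (@continuous_comp _ _ _ (fun t : R => (x, t) : plane R) fy); last exact: cfy.
  by apply: (@continuous_pair R R (cst x) id); [exact: cvg_cst | exact: cvg_id].
- by move=> t; exact: (dF (x, t)).
- by move=> t tM; apply: sF; right.
- by move=> t tM; apply: sfy; right.
Qed.

End PlaneMeasure.

(** * Integration by parts and integrals over rectangles *)

Section WeakDerivative.
Variable R : realType.
Implicit Types (f : plane R -> R) (z : plane R).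

(** The product of [f] with a test function, extended by [0], has continuous partial derivatives and
    bounded support, so these have integral [0]. The behaviour of [f] at the frontier does not
    matter, as the test function vanishes off a compact part of [Omega]. *)
Lemma weak_derivative_C1 (Omega : set (plane R)) f fx fy :
  open Omega -> bounded_set Omega ->
  (forall z, Omega z -> has_grad f z (fx z) (fy z)) ->
  (forall z, Omega z -> {for z, continuous fx}) ->
  (forall z, Omega z -> {for z, continuous fy}) ->
  weak_derivative Omega (dx R) f fx /\ weak_derivative Omega (dy R) f fy.
Proof.
move=> oO bO gf cfx cfy; have [M M0 hM] := bounded_box bO.
pose ext (g : plane R -> R) := g \_ Omega.
have extE g z : Omega z -> ext g z = g z by move=> Oz; rewrite /ext patchE mem_set.
have H (phi : plane R -> R) : test_function Omega phi ->
   [/\ (forall z, has_grad (fun z => ext f z * phi z) z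
          (ext f z * 'D_(dx R) phi z + phi z * ext fx z)
          (ext f z * 'D_(dy R) phi z + phi z * ext fy z)),
     continuous (fun z => ext f z * 'D_(dx R) phi z) /\
     continuous (fun z => ext f z * 'D_(dy R) phi z),
     continuous (fun z => ext fx z * phi z) /\ continuous (fun z => ext fy z * phi z) &
     [/\ box_supp M phi, box_supp M ('D_(dx R) phi) & box_supp M ('D_(dy R) phi)]].
  move=> [sphi [K [cK KO phi0]]].
  have [gphi sx sy] := smooth_on_has_grad sphi.
  have clK : closed K by apply: (compact_closed _ cK); exact: norm_hausdorff.
  have nz z : ~ K z -> \forall z' \near z, [/\ phi z' = 0, 'D_(dx R) phi z' = 0 & 'D_(dy R) phi z' = 0].
    move=> nK; have oK : open (~` K) by exact: closed_openC.
    have : \forall z' \near z, ~ K z' by apply: open_nbhs_nbhs.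
    apply: filterS => z' nK'; split; first exact: phi0.
      have n' : \forall w \near z', (fun=> 0) w = phi w.
        have : \forall w \near z', ~ K w by apply: open_nbhs_nbhs.
        by apply: filterS => w /phi0 ->.
      by have [-> _] := has_grad_derive (has_grad_near n' (has_grad_cst 0 z')).
    have n' : \forall w \near z', (fun=> 0) w = phi w.
      have : \forall w \near z', ~ K w by apply: open_nbhs_nbhs.
      by apply: filterS => w /phi0 ->.
    by have [_ ->] := has_grad_derive (has_grad_near n' (has_grad_cst 0 z')).
  have nO z : Omega z -> \forall z' \near z, Omega z' by move=> Oz; apply: open_nbhs_nbhs.
  have cext (g h : plane R -> R) : (forall z, Omega z -> {for z, continuous g}) ->
      continuous h -> (forall z, ~ K z -> \forall z' \near z, h z' = 0) ->
      continuous (fun z => ext g z * h z).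
    move=> cg ch h0 z; have [Kz|nK] := pselect (K z).
      have Oz := KO z Kz.
      have ne : \forall z' \near z, g z' * h z' = ext g z' * h z'.
        by apply: filterS (nO z Oz) => z' /extE ->.
      have cv : (fun z => g z * h z) @ z --> ext g z * h z.
        by rewrite extE //; apply: cvgM; [exact: cg | exact: ch].
      by apply: cvg_trans cv; apply: near_eq_cvg.
    have ne : \forall z' \near z, (fun=> 0) z' = ext g z' * h z'.
      by apply: filterS (h0 z nK) => z' ->; rewrite mulr0.
    rewrite /continuous_at (nbhs_singleton (h0 z nK)) mulr0.
    by apply: cvg_trans (@cvg_cst _ 0 _ (nbhs z) _); apply: near_eq_cvg.
  have nz0 z : ~ K z -> \forall z' \near z, phi z' = 0.
    by move=> /nz; apply: filterS => z' [].
  have nzx z : ~ K z -> \forall z' \near z, 'D_(dx R) phi z' = 0.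
    by move=> /nz; apply: filterS => z' [].
  have nzy z : ~ K z -> \forall z' \near z, 'D_(dy R) phi z' = 0.
    by move=> /nz; apply: filterS => z' [].
  have cf z : Omega z -> {for z, continuous f} by move=> /gf[].
  have cphi : continuous phi by move=> z; apply: (smooth_on_continuous sphi).
  have cphix : continuous ('D_(dx R) phi) by move=> z; apply: (smooth_on_continuous sx).
  have cphiy : continuous ('D_(dy R) phi) by move=> z; apply: (smooth_on_continuous sy).
  split.
  - move=> z; have [Kz|nK] := pselect (K z).
      have Oz := KO z Kz; rewrite !extE //.
      apply: has_grad_near (has_gradM (gf z Oz) (gphi z I)).
      by apply: filterS (nO z Oz) => z' /extE ->.
    have [p0 px py] := nbhs_singleton (nz z nK).
    rewrite p0 px py !mulr0 !mul0r addr0.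
    apply: has_grad_near (has_grad_cst 0 z).
    by apply: filterS (nz0 z nK) => z' ->; rewrite mulr0.
  - split; [exact: (cext f _ cf cphix nzx) | exact: (cext f _ cf cphiy nzy)].
  - split; [exact: (cext fx _ cfx cphi nz0) | exact: (cext fy _ cfy cphi nz0)].
  - have notK z : M <= `|z.1| \/ M <= `|z.2| -> ~ K z.
      by move=> hz /KO/hM[h1 h2]; case: hz; rewrite leNgt ?h1 ?h2.
    by split=> z /notK nK; have [] := nbhs_singleton (nz z nK).
have split_int (g h : plane R -> R) : continuous g -> continuous h -> box_supp M g -> box_supp M h ->
    (\int[area R]_z (g z + h z)%:E = 0)%E ->
    \int[area R]_z g z = - \int[area R]_z h z.
  move=> cg ch sg sh E; apply/eqP; rewrite -subr_eq0 opprK; apply/eqP.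
  rewrite -RintegralD //; first by rewrite /Rintegral E.
    exact: (@integrable_box_supp R M).
  exact: (@integrable_box_supp R M).
have supM (g h : plane R -> R) : box_supp M h -> box_supp M (fun z => ext g z * h z).
  by move=> sh z /sh ->; rewrite mulr0.
have supD (g h : plane R -> R) : box_supp M g -> box_supp M h -> box_supp M (fun z => g z + h z).
  by move=> sg sh z hz; rewrite sg // sh // addr0.
have restr (g h : plane R -> R) : (fun z => g z * h z) \_ Omega = fun z => ext g z * h z.
  by apply/funext => z; rewrite /ext !patchE; case: ifP => // _; rewrite mul0r.
split=> phi /H [gr [c1 c2] [c3 c4] [s0 sx sy]].
- rewrite [LHS]Rintegral_mkcond [X in - X]Rintegral_mkcond (restr f) (restr fx).
  apply: split_int; [exact: c1 | exact: c3 | exact: supM | exact: supM |].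
  apply: (@integral_dx_eq0 R M (fun z => ext f z * phi z)) => //.
  + exact: supM.
  + by apply: supD; exact: supM.
  + by move=> z; apply: cvgD; [exact: c1 | exact: c3].
  + by move=> z; have [_ + _] := gr z; rewrite (mulrC (phi z)).
- rewrite [LHS]Rintegral_mkcond [X in - X]Rintegral_mkcond (restr f) (restr fy).
  apply: split_int; [exact: c2 | exact: c4 | exact: supM | exact: supM |].
  apply: (@integral_dy_eq0 R M (fun z => ext f z * phi z)) => //.
  + exact: supM.
  + by apply: supD; exact: supM.
  + by move=> z; apply: cvgD; [exact: c2 | exact: c4].
  + by move=> z; have [_ _ +] := gr z; rewrite (mulrC (phi z)).
Qed.

Definition rect (a b c d : R) : set (mplane R) :=
  (`[a, b]%classic : set R) `*` (`[c, d]%classic : set R).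

Lemma measurable_rect a b c d : measurable (rect a b c d).
Proof. by apply: measurableX; exact: measurable_itv. Qed.

Lemma integral_itv_derive (a b : R) (U u : R -> R) : a < b -> continuous u ->
  (forall t, is_derive t (1 : R) U (u t)) ->
  (\int[lebesgue_measure]_(t in `[a, b]) (u t)%:E = (U b - U a)%:E)%E.
Proof.
move=> ab cu dU.
have dUc t : {for t, continuous U}.
  by apply/differentiable_continuous/derivable1_diffP; case: (dU t).
rewrite (@continuous_FTC2 _ u U) //.
- exact: continuous_subspaceT.
- split=> [t _||]; first by case: (dU t).
    exact: cvg_at_right_filter (dUc _).
  exact: cvg_at_left_filter (dUc _).
- by move=> t _; rewrite derive1E; case: (dU t).
Qed.

Lemma integral_rect (a b c d : R) (U u V v : R -> R) : a < b -> c < d ->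
  continuous u -> continuous v -> (forall t, 0 <= u t) -> (forall t, 0 <= v t) ->
  (forall t, is_derive t (1 : R) U (u t)) -> (forall t, is_derive t (1 : R) V (v t)) ->
  (\int[area R]_(z in rect a b c d) (u z.1 * v z.2)%:E =
   ((U b - U a) * (V d - V c))%:E)%E.
Proof.
move=> ab cd cu cv u0 v0 dU dV.
pose ui : measurableTypeR R -> R := u \_ `[a, b].
pose vi : measurableTypeR R -> R := v \_ `[c, d].
have ui0 t : 0 <= ui t by rewrite /ui patchE; case: ifP.
have vi0 t : 0 <= vi t by rewrite /vi patchE; case: ifP.
have mui : measurable_fun setT ui.
  apply/(measurable_restrictT _ _).1; first exact: measurable_itv.
  by apply: measurable_funTS; exact: continuous_measurable_fun.
have mvi : measurable_fun setT vi.
  apply/(measurable_restrictT _ _).1; first exact: measurable_itv.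
  by apply: measurable_funTS; exact: continuous_measurable_fun.
rewrite integral_mkcond.
have -> : ((fun z : mplane R => (u z.1 * v z.2)%:E) \_ (rect a b c d)) =
    (fun z => (ui z.1)%:E * (vi z.2)%:E)%E.
  apply/funext => z; rewrite /ui /vi !patchE /rect in_setX.
  by case: (_ \in _); case: (_ \in _); rewrite /= -?EFinM ?mul0r ?mulr0.
rewrite /area fubini_tonelli1; last 2 first.
- apply: emeasurable_funM; apply/measurable_EFinP.
    by apply: measurableT_comp mui _; exact: measurable_fst.
  by apply: measurableT_comp mvi _; exact: measurable_snd.
- by move=> z; rewrite mule_ge0 // lee_fin.
have iu : (\int[lebesgue_measure]_t (ui t)%:E = (U b - U a)%:E)%E.
  by rewrite -(integral_itv_derive ab cu dU) [RHS]integral_mkcond restrict_EFin.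
have iv : (\int[lebesgue_measure]_t (vi t)%:E = (V d - V c)%:E)%E.
  by rewrite -(integral_itv_derive cd cv dV) [RHS]integral_mkcond restrict_EFin.
transitivity (\int[lebesgue_measure]_x ((V d - V c)%:E * (ui x)%:E))%E.
  apply: eq_integral => x _; rewrite /fubini_F /= ge0_integralZl //.
  - by rewrite iv muleC.
  - by apply/measurable_EFinP.
  - by move=> y _; rewrite lee_fin.
  - by rewrite lee_fin.
rewrite ge0_integralZl //.
- by rewrite iu -EFinM mulrC.
- by apply/measurable_EFinP.
- by move=> x _; rewrite lee_fin.
- by rewrite -iv; apply: integral_ge0 => y _; rewrite lee_fin.
Qed.

End WeakDerivative.

(** * Rayleigh quotients of explicit trial functions *)

Section Trial.
Variable R : realType.
Implicit Types (z : plane R).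

Lemma continuous_sqr_at (T : topologicalType) (h : T -> R) x :
  {for x, continuous h} -> {for x, continuous (fun y => h y ^+ 2)}.
Proof.
move=> ch; apply: (@continuous_comp _ _ _ h (fun t : R => t ^+ 2)) => //.
exact: exprn_continuous.
Qed.

Lemma integral_bounded_lty (Omega : set (plane R)) (h : plane R -> R) (C : R) :
  open Omega -> bounded_set Omega -> (forall z, Omega z -> {for z, continuous h}) ->
  (forall z, Omega z -> 0 <= h z <= C) ->
  (\int[area R]_(z in Omega) (h z)%:E < +oo)%E.
Proof.
move=> oO bO ch hC; have mO := measurable_open_plane oO.
apply: (@le_lt_trans _ _ (\int[area R]_(z in Omega) (cst C%:E) z)%E).
  apply: ge0_le_integral => //.
  - by move=> z /hC /andP[h0 _]; rewrite lee_fin.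
  - by apply/measurable_EFinP; exact: measurable_continuous_on.
  - by move=> z /hC /andP[_ h1]; rewrite lee_fin.
rewrite integral_cst //; have := area_bounded oO bO.
have [->|/set0P[z /hC /andP[h0 h1]]] := eqVneq Omega set0.
  by rewrite measure0 mule0.
move=> aO; apply: lte_mul_pinfty => //; rewrite lee_fin; exact: le_trans h1.
Qed.

(** The trial function is [a + i b]; [G] and [e] are its squared modulus and its magnetic energy
    density. Without a quotient the conclusion also holds when [G] has integral [0], a case that a
    strip away from the domain produces. *)
Lemma rayleigh_bound (Omega : set (plane R)) (A : plane R -> plane R)
    (a b ax ay bx by' G e : plane R -> R) (C l : R) :
  open Omega -> bounded_set Omega -> Omega !=set0 ->
  (forall z, Omega z -> has_grad a z (ax z) (ay z)) ->
  (forall z, Omega z -> has_grad b z (bx z) (by' z)) ->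
  (forall z, Omega z -> [/\ {for z, continuous ax}, {for z, continuous ay},
     {for z, continuous bx} & {for z, continuous by'}]) ->
  (forall z, Omega z -> a z ^+ 2 + b z ^+ 2 = G z) ->
  (forall z, Omega z -> (ax z + b z * (A z).1) ^+ 2 + (bx z - a z * (A z).1) ^+ 2 +
     ((ay z + b z * (A z).2) ^+ 2 + (by' z - a z * (A z).2) ^+ 2) = e z) ->
  (forall z, Omega z -> [/\ G z <= C, e z <= C, `|(A z).1| <= C & `|(A z).2| <= C]) ->
  (l%:E <= lambda1 Omega A)%E ->
  (l%:E * \int[area R]_(z in Omega) (G z)%:E <= \int[area R]_(z in Omega) (e z)%:E)%E.
Proof.
move=> oO bO [z0 Oz0] ga gb cab GE eE bC lla.
have mO := measurable_open_plane oO.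
have G0 z : Omega z -> 0 <= G z by move=> /GE <-; rewrite addr_ge0 ?sqr_ge0.
have e0 z : Omega z -> 0 <= e z by move=> /eE <-; rewrite !addr_ge0 ?sqr_ge0.
have ca z : Omega z -> {for z, continuous a} by move=> /ga[].
have cb z : Omega z -> {for z, continuous b} by move=> /gb[].
have csq (h k : plane R -> R) : (forall z, Omega z -> {for z, continuous h}) ->
    (forall z, Omega z -> {for z, continuous k}) ->
    forall z, Omega z -> {for z, continuous (fun z => h z ^+ 2 + k z ^+ 2)}.
  by move=> ch ck z Oz; apply: cvgD; apply: continuous_sqr_at; [exact: ch | exact: ck].
have iG : (\int[area R]_(z in Omega) (a z ^+ 2 + b z ^+ 2)%:E =
           \int[area R]_(z in Omega) (G z)%:E)%E.
  by apply: eq_integral => z /set_mem Oz; rewrite GE.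
have IG0 : (0 <= \int[area R]_(z in Omega) (G z)%:E)%E.
  by apply: integral_ge0 => z Oz; rewrite lee_fin G0.
have Ie0 : (0 <= \int[area R]_(z in Omega) (e z)%:E)%E.
  by apply: integral_ge0 => z Oz; rewrite lee_fin e0.
have IGoo : (\int[area R]_(z in Omega) (G z)%:E < +oo)%E.
  rewrite -iG; apply: (@integral_bounded_lty _ _ C) => //; first exact: csq.
  by move=> z Oz; rewrite GE // G0 //=; case: (bC z Oz).
move: IG0; rewrite le_eqVlt => /predU1P[<-|IG0]; first by rewrite mule0.
pose u z := (a z +i* b z)%C; pose ux z := (ax z +i* bx z)%C; pose uy z := (ay z +i* by' z)%C.
have C0 : 0 <= C by have [_ _ + _] := bC z0 Oz0; apply: le_trans.
(* The ordinary gradient is the magnetic one plus [i u A], whence [|grad u|^2 <= 2 |grad^A u|^2 + 2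
   |u|^2 |A|^2], here for one coordinate. *)
have key (x y p q t : R) : p ^+ 2 + q ^+ 2 <= C -> `|t| <= C ->
    (x + q * t) ^+ 2 + (y - p * t) ^+ 2 <= C ->
    x ^+ 2 + y ^+ 2 <= 2 * C + 2 * (C * C ^+ 2).
  move=> h1 h2 h3.
  have t2 : t ^+ 2 <= C ^+ 2 by rewrite -(real_normK (num_real t)) lerXn2r // ?nnegrE.
  have : (p ^+ 2 + q ^+ 2) * t ^+ 2 <= C * C ^+ 2.
    by rewrite ler_pM // ?addr_ge0 ?sqr_ge0.
  have : 0 <= (x + q * t + q * t) ^+ 2 + (y - p * t - p * t) ^+ 2.
    by rewrite addr_ge0 ?sqr_ge0.
  by lra.
have sq0 (x y : R) : 0 <= x ^+ 2 + y ^+ 2 by rewrite addr_ge0 ?sqr_ge0.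
have L2u : L2 Omega u.
  split; [exact: measurable_continuous_on | exact: measurable_continuous_on |].
  by rewrite /sqnormc /= iG.
have L2x : L2 Omega ux.
  split; try by apply: measurable_continuous_on => // z /cab[].
  rewrite /sqnormc /=; apply: (@integral_bounded_lty _ _ (2 * C + 2 * (C * C ^+ 2))) => //.
    by apply: csq => z /cab[].
  move=> z Oz; rewrite sq0 /=; have [h1 h2 h3 h4] := bC z Oz.
  apply: (key _ _ (a z) (b z) (A z).1) => //; first by rewrite GE.
  apply: le_trans h2; rewrite -eE // lerDl; exact: sq0.
have L2y : L2 Omega uy.
  split; try by apply: measurable_continuous_on => // z /cab[].
  rewrite /sqnormc /=; apply: (@integral_bounded_lty _ _ (2 * C + 2 * (C * C ^+ 2))) => //.
    by apply: csq => z /cab[].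
  move=> z Oz; rewrite sq0 /=; have [h1 h2 h3 h4] := bC z Oz.
  apply: (key _ _ (a z) (b z) (A z).2) => //; first by rewrite GE.
  apply: le_trans h2; rewrite -eE // lerDr; exact: sq0.
have [wax way] := weak_derivative_C1 oO bO ga (fun z Oz => (let: And4 h _ _ _ := cab z Oz in h))
   (fun z Oz => (let: And4 _ h _ _ := cab z Oz in h)).
have [wbx wby] := weak_derivative_C1 oO bO gb (fun z Oz => (let: And4 _ _ h _ := cab z Oz in h))
   (fun z Oz => (let: And4 _ _ _ h := cab z Oz in h)).
have hH : H1 Omega u ux uy by split.
have nu0 : ~ {ae area R, forall p, Omega p -> u p = 0}.
  move=> u0; move: IG0; rewrite -iG lt_neqAle eq_sym => /andP[/eqP + _]; apply.
  rewrite (@ae_eq_integral _ _ _ (area R) Omega (cst 0%E)) ?integral0 //.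
  - by apply/measurable_EFinP; apply: measurable_continuous_on => //; exact: csq.
  - move: u0; apply: filterS; first exact: (ae_filter_ringOfSetsType (area R)).
    move=> z h Oz; have := h Oz; rewrite /u => -[-> ->].
    by rewrite expr0n /= addr0.
have : (lambda1 Omega A <= rayleigh Omega A u ux uy)%E.
  by apply: ereal_inf_lbound; exists u, ux, uy.
move=> /(le_trans lla).
have -> : rayleigh Omega A u ux uy =
   (\int[area R]_(z in Omega) (e z)%:E / \int[area R]_(z in Omega) (G z)%:E)%E.
  rewrite /rayleigh; congr (_ / _)%E; last by rewrite -iG.
  apply: eq_integral => z /set_mem Oz; rewrite -eE //; congr EFin.
  rewrite /magnetic_density /sqnormc /u /ux /uy /=; ring.
have : (\int[area R]_(z in Omega) (G z)%:E)%E \is a fin_num by rewrite ge0_fin_numE // ltW.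
move: IG0; case: (\int[area R]_(z in Omega) (G z)%:E)%E => // r; rewrite lte_fin => r0 _.
by rewrite inver gt_eqF // lee_pdivlMr.
Qed.

End Trial.

(** * Unimodular phases *)

Section Phases.
Variables (R : realType) (U V : set (plane R)).
Implicit Types (w : plane R -> plane R) (c s : plane R -> R) (z : plane R).

(* On [V], [w] is the differential of an argument of the unimodular function
   [c + i s].  Nothing is asked of [c] and [s] on [U] outside [V], where the
   amplitude of the trial function vanishes. *)
Definition phase_on w c s :=
  (forall z, U z -> c z ^+ 2 + s z ^+ 2 = 1) /\
  forall z, V z -> has_grad c z (- s z * (w z).1) (- s z * (w z).2) /\
                   has_grad s z (c z * (w z).1) (c z * (w z).2).

Definition has_phase w := exists c s, phase_on w c s.

Lemma has_phase_eq w w' : (forall z, V z -> w z = w' z) -> has_phase w -> has_phase w'.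
Proof.
by move=> e [c [s [h1 h2]]]; exists c, s; split=> // z Vz; rewrite -e //; exact: h2.
Qed.

Lemma has_phase_exact w : exact_on V w -> has_phase w.
Proof.
move=> [phi h]; exists (fun z => cos (phi z)), (fun z => sin (phi z)); split.
  by move=> z _; rewrite cos2Dsin2.
move=> z /h g; split.
  exact: (has_grad_comp (is_derive_cos (phi z)) g).
exact: (has_grad_comp (is_derive_sin (phi z)) g).
Qed.

Lemma has_phaseD w w' : has_phase w -> has_phase w' -> has_phase (fun z => w z + w' z).
Proof.
move=> [c [s [h1 h2]]] [c' [s' [h1' h2']]].
exists (fun z => c z * c' z - s z * s' z), (fun z => c z * s' z + s z * c' z); split.
  move=> z Uz; transitivity ((c z ^+ 2 + s z ^+ 2) * (c' z ^+ 2 + s' z ^+ 2)); first by ring.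
  by rewrite h1 // h1' // mulr1.
move=> z Vz; have [gc gs] := h2 z Vz; have [gc' gs'] := h2' z Vz; split.
  by apply: has_grad_eq (has_gradB (has_gradM gc gc') (has_gradM gs gs')) _ _ => /=; ring.
by apply: has_grad_eq (has_gradD (has_gradM gc gs') (has_gradM gs gc')) _ _ => /=; ring.
Qed.

Lemma has_phaseN w : has_phase w -> has_phase (fun z => - w z).
Proof.
move=> [c [s [h1 h2]]]; exists c, (fun z => - s z); split.
  by move=> z /h1; rewrite sqrrN.
move=> z /h2[gc gs]; split; first by apply: has_grad_eq gc _ _ => /=; ring.
by apply: has_grad_eq (has_gradN gs) _ _ => /=; ring.
Qed.

Lemma has_phase0 : has_phase (fun=> 0).
Proof. by apply: has_phase_exact; exact: exact_on0. Qed.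

(** The phase is raised to the power [k]; this is why coefficients of angular forms matter only
    modulo integers. *)
Lemma has_phase_int w (k : int) : has_phase w -> has_phase (fun z => k%:~R *: w z).
Proof.
move=> h.
have hn (n : nat) : has_phase (fun z => n%:R *: w z).
  elim: n => [|n ih]; first by apply: has_phase_eq has_phase0 => z _; rewrite scale0r.
  apply: has_phase_eq (has_phaseD h ih) => z _.
  by rewrite -[n.+1]addn1 natrD scalerDl scale1r addrC.
case: k => n; first by apply: has_phase_eq (hn n) => z _.
apply: has_phase_eq (has_phaseN (hn n.+1)) => z _.
by rewrite NegzE mulrNz scaleNr.
Qed.

Lemma has_phase_sum (I : Type) (r : seq I) (w : I -> plane R -> plane R) :
  (forall i, has_phase (w i)) -> has_phase (fun z => \sum_(i <- r) w i z).
Proof.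
move=> h; elim: r => [|i r ih].
  by apply: has_phase_eq has_phase0 => z _; rewrite big_nil.
by apply: has_phase_eq (has_phaseD (h i) ih) => z _; rewrite big_cons.
Qed.

(** The unit vector [(z - p) / |z - p|] is single-valued off [p], although the angle is not. *)
Lemma has_phase_dth p : V `<=` U -> ~ U p -> has_phase (dth p).
Proof.
move=> VU nUp.
have rp z : U z -> 0 < rho2 p z.
  by move=> Uz; apply: rho2_gt0; apply/eqP => zp; apply: nUp; rewrite -zp.
pose N z := Num.sqrt (rho2 p z).
have N2 z : U z -> N z ^+ 2 = rho2 p z by move=> /rp/ltW; exact: sqr_sqrtr.
have N0 z : U z -> N z != 0 by move=> /rp r0; rewrite gt_eqF // sqrtr_gt0.
have gN z : U z -> has_grad N z ((z.1 - p.1) / N z) ((z.2 - p.2) / N z).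
  move=> Uz; have gX := has_gradX 2 (has_grad_fstB p z); have gY := has_gradX 2 (has_grad_sndB p z).
  have h := has_grad_comp (is_derive1_sqrt (rp z Uz)) (has_gradD gX gY).
  apply: has_grad_eq h _ _; rewrite /= -/(N z); have := N0 z Uz; set n := N z => n0; by field.
exists (fun z => (z.1 - p.1) / N z), (fun z => (z.2 - p.2) / N z); split.
  by move=> z Uz; rewrite !expr_div_n -mulrDl N2 // divff // gt_eqF // rp.
move=> z /VU Uz; have n0 := N0 z Uz; have n2 := N2 z Uz.
have gi := has_gradV n0 (gN z Uz).
rewrite /dth -n2; split.
  apply: has_grad_eq (has_gradM (has_grad_fstB p z) gi) _ _ => /=.
    have -> : (z.1 - p.1) * (- N z ^- 2 * ((z.1 - p.1) / N z)) + (N z)^-1 * 1 =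
       (N z ^+ 2 - (z.1 - p.1) ^+ 2) / N z ^+ 3 by field.
    have -> : N z ^+ 2 - (z.1 - p.1) ^+ 2 = (z.2 - p.2) ^+ 2 by rewrite n2 /rho2; ring.
    by field.
  by field.
apply: has_grad_eq (has_gradM (has_grad_sndB p z) gi) _ _ => /=; first by field.
have -> : (z.2 - p.2) * (- N z ^- 2 * ((z.2 - p.2) / N z)) + (N z)^-1 * 1 =
   (N z ^+ 2 - (z.2 - p.2) ^+ 2) / N z ^+ 3 by field.
have -> : N z ^+ 2 - (z.2 - p.2) ^+ 2 = (z.1 - p.1) ^+ 2 by rewrite n2 /rho2; ring.
by field.
Qed.

End Phases.

(** * Gluing phases by a vanishing amplitude *)

Section Glue.
Variable R : realType.
Implicit Types (z : plane R).

Lemma continuous_dominated (T : topologicalType) (f k : T -> R) (x : T) :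
  {for x, continuous f} -> f x = 0 -> (\forall t \near x, `|k t| <= `|f t|) ->
  {for x, continuous k}.
Proof.
move=> cf fx kf.
have kx : k x = 0.
  by apply/eqP; have := nbhs_singleton kf; rewrite fx normr0 normr_le0.
suff : k @ x --> k x by [].
rewrite kx; apply/norm_cvg0P.
have cv : (fun t => `|f t|) @ x --> (0 : R).
  have -> : 0 = `|f x| by rewrite fx normr0.
  by apply: cvg_norm; exact: cf.
apply: (@squeeze_cvgr _ _ _ _ (fun=> 0) (fun t => `|f t|)); [|exact: cvg_cst|exact: cv].
by apply: filterS kf => t h; rewrite normr_ge0.
Qed.

(** The slopes of [k] at [x] are dominated by those of [f], which tend to [0]. It is applied to the
    amplitude times a possibly discontinuous phase, at points where the amplitude vanishes together
    with its gradient. *)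
Lemma is_derive_dominated (f k : R -> R) (x : R) : is_derive x (1 : R) f 0 -> f x = 0 ->
  (\forall t \near x, `|k t| <= `|f t|) -> is_derive x (1 : R) k 0.
Proof.
move=> /is_derive1_caratheodory[F [fE cF Fx]] fx0 kf.
have kx : k x = 0.
  by apply/eqP; have := nbhs_singleton kf; rewrite fx0 normr0 normr_le0.
apply/is_derive1_caratheodory; exists (fun t => k t / (t - x)); split.
- move=> t; rewrite kx subr0; have [->|tx] := eqVneq t x; first by rewrite kx !mul0r.
  by rewrite divfK // subr_eq0.
- apply: continuous_dominated cF Fx _; apply: filterS kf => t h.
  have [->|tx] := eqVneq t x; first by rewrite subrr invr0 mulr0 normr0.
  rewrite normrM normfV ler_pdivrMr ?normr_gt0 ?subr_eq0 // (le_trans h) //.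
  by have := fE t; rewrite fx0 subr0 => ->; rewrite normrM.
- by rewrite subrr invr0 mulr0.
Qed.

Lemma has_grad_dominated (f k : plane R -> R) z : has_grad f z 0 0 -> f z = 0 ->
  (\forall z' \near z, `|k z'| <= `|f z'|) -> has_grad k z 0 0.
Proof.
move=> [cf fx fy] fz kf; split; first exact: continuous_dominated cf fz kf.
- by apply: is_derive_dominated fx _ (near_slice1 kf); rewrite -surjective_pairing.
- by apply: is_derive_dominated fy _ (near_slice2 kf); rewrite -surjective_pairing.
Qed.

(** For the trial function [g * (c + i s)] with phase differential [w], the magnetic density splits
    into [|grad g|^2 + g^2 |w - A|^2], since [c^2 + s^2 = 1] removes the cross terms. *)
Lemma trial_glued (U V : set (plane R)) (A w : plane R -> plane R) (F1 F2 g gx gy : plane R -> R) (C l : R) :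
  open U -> open V -> V `<=` U -> bounded_set U -> U !=set0 ->
  continuous F1 -> continuous F2 -> (forall z, U z -> A z = (F1 z, F2 z)) ->
  has_phase U V w ->
  (forall z, U z -> {for z, continuous (fun z => (w z).1)} /\ {for z, continuous (fun z => (w z).2)}) ->
  (forall z, U z -> [/\ has_grad g z (gx z) (gy z), {for z, continuous gx} & {for z, continuous gy}]) ->
  (forall z, U z -> ~ V z -> [/\ g z = 0, gx z = 0 & gy z = 0]) ->
  let e z := gx z ^+ 2 + gy z ^+ 2 + g z ^+ 2 * (((w z).1 - (A z).1) ^+ 2 + ((w z).2 - (A z).2) ^+ 2) in
  (forall z, U z -> g z ^+ 2 <= C /\ e z <= C) ->
  (l%:E <= lambda1 U A)%E ->
  (l%:E * \int[area R]_(z in U) (g z ^+ 2)%:E <= \int[area R]_(z in U) (e z)%:E)%E.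
Proof.
move=> oU oV VU bU U0 cF1 cF2 AE [c [s [cs1 hcs]]] cw gg g0 e eC lla.
have cs_le z : U z -> `|c z| <= 1 /\ `|s z| <= 1.
  move=> /cs1 h; split; rewrite -(@ler_pXn2r _ 2) ?nnegrE // real_normK ?num_real // expr1n.
    by have := sqr_ge0 (s z); lra.
  by have := sqr_ge0 (c z); lra.
have nU z : U z -> \forall z' \near z, U z' by move=> Uz; apply: open_nbhs_nbhs.
have nV z : V z -> \forall z' \near z, V z' by move=> Vz; apply: open_nbhs_nbhs.
have cg z : U z -> {for z, continuous g} by move=> /gg[[]].
have gmul (k kx ky : plane R -> R) : (forall z, U z -> `|k z| <= 1) ->
    (forall z, V z -> has_grad k z (kx z) (ky z)) ->
    forall z, U z -> has_grad (fun z => g z * k z) z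
      (if `[< V z >] then g z * kx z + k z * gx z else 0)
      (if `[< V z >] then g z * ky z + k z * gy z else 0).
  move=> k1 gk z Uz; have [gz _ _] := gg z Uz.
  case: asboolP => [Vz|nVz]; first exact: has_gradM gz (gk z Vz).
  have [g0' gx0 gy0] := g0 z Uz nVz; rewrite gx0 gy0 in gz.
  apply: has_grad_dominated gz g0' _; apply: filterS (nU z Uz) => z' /k1 kz'.
  by rewrite normrM ler_piMr.
have cmul (h k : plane R -> R) z : U z -> (forall z, U z -> {for z, continuous h}) ->
    (forall z, U z -> `|k z| <= 1) -> (forall z, V z -> {for z, continuous k}) ->
    (forall z, U z -> ~ V z -> h z = 0) -> {for z, continuous (fun z => h z * k z)}.
  move=> Uz ch k1 ck h0; have [Vz|nVz] := pselect (V z).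
    by apply: cvgM; [exact: ch | exact: ck].
  apply: continuous_dominated (ch z Uz) (h0 z Uz nVz) _.
  by apply: filterS (nU z Uz) => t /k1 kt; rewrite normrM ler_piMr.
have cc z : V z -> {for z, continuous c} by move=> /hcs[[]].
have cs z : V z -> {for z, continuous s} by move=> /hcs[_ []].
have c1 z : U z -> `|c z| <= 1 by move=> /cs_le[].
have s1 z : U z -> `|s z| <= 1 by move=> /cs_le[].
have ga z : U z -> has_grad (fun z => g z * c z) z
    (gx z * c z - g z * (w z).1 * s z) (gy z * c z - g z * (w z).2 * s z).
  move=> Uz; have := gmul c _ _ c1 (fun z Vz => (hcs z Vz).1) z Uz.
  case: asboolP => [Vz|nVz] h; first by apply: has_grad_eq h _ _; ring.
  by have [-> -> ->] := g0 z Uz nVz; rewrite !mul0r subrr.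
have gb z : U z -> has_grad (fun z => g z * s z) z
    (gx z * s z + g z * (w z).1 * c z) (gy z * s z + g z * (w z).2 * c z).
  move=> Uz; have := gmul s _ _ s1 (fun z Vz => (hcs z Vz).2) z Uz.
  case: asboolP => [Vz|nVz] h; first by apply: has_grad_eq h _ _; ring.
  by have [-> -> ->] := g0 z Uz nVz; rewrite !mul0r addr0.
have cgx z : U z -> {for z, continuous gx} by move=> /gg[].
have cgy z : U z -> {for z, continuous gy} by move=> /gg[].
have gx0 z : U z -> ~ V z -> gx z = 0 by move=> Uz /(g0 z Uz)[].
have gy0 z : U z -> ~ V z -> gy z = 0 by move=> Uz /(g0 z Uz)[].
have cgw1 z : U z -> {for z, continuous (fun z => g z * (w z).1)}.
  by move=> Uz; apply: cvgM; [exact: cg | exact: (cw z Uz).1].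
have cgw2 z : U z -> {for z, continuous (fun z => g z * (w z).2)}.
  by move=> Uz; apply: cvgM; [exact: cg | exact: (cw z Uz).2].
have gw10 z : U z -> ~ V z -> g z * (w z).1 = 0 by move=> Uz /(g0 z Uz)[-> _ _]; rewrite mul0r.
have gw20 z : U z -> ~ V z -> g z * (w z).2 = 0 by move=> Uz /(g0 z Uz)[-> _ _]; rewrite mul0r.
have [M [M0 hM]] : exists M, 0 < M /\ forall z, U z -> `|F1 z| <= M /\ `|F2 z| <= M.
  have cK := compact_closure bU.
  have [M1 [_ h1]] := compact_bounded (continuous_compact (continuous_subspaceT cF1) cK).
  have [M2 [_ h2]] := compact_bounded (continuous_compact (continuous_subspaceT cF2) cK).
  have m1 := ler_norm M1; have m2 := ler_norm M2; have m1' := normr_ge0 M1; have m2' := normr_ge0 M2.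
  exists (`|M1| + `|M2| + 1); split; first lra.
  move=> z Uz; split; [apply: h1; first lra | apply: h2; first lra].
    by exists z => //; exact: subset_closure.
  by exists z => //; exact: subset_closure.
apply: (@rayleigh_bound R U A (fun z => g z * c z) (fun z => g z * s z) _ _ _ _
  (fun z => g z ^+ 2) e (Num.max C M) l oU bU U0 ga gb) => //.
- move=> z Uz; split.
  + by apply: cvgB; [apply: (cmul gx c) | apply: (cmul (fun z => g z * (w z).1) s)].
  + by apply: cvgB; [apply: (cmul gy c) | apply: (cmul (fun z => g z * (w z).2) s)].
  + by apply: cvgD; [apply: (cmul gx s) | apply: (cmul (fun z => g z * (w z).1) c)].
  + by apply: cvgD; [apply: (cmul gy s) | apply: (cmul (fun z => g z * (w z).2) c)].
- by move=> z Uz; rewrite !exprMn -mulrDr cs1 // mulr1.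
- move=> z Uz; rewrite /e.
  transitivity ((c z ^+ 2 + s z ^+ 2) * (gx z ^+ 2 + gy z ^+ 2 +
     g z ^+ 2 * (((w z).1 - (A z).1) ^+ 2 + ((w z).2 - (A z).2) ^+ 2))); first by ring.
  by rewrite cs1 // mul1r.
- move=> z Uz; have [h1 h2] := eC z Uz; have [h3 h4] := hM z Uz.
  by rewrite !le_max h1 h2 AE //= h3 h4 !orbT.
Qed.

End Glue.

(** * Energy of the strips *)

Section BoundedContinuous.
Variables (R : realType) (U : set (plane R)).
Hypotheses (oU : open U) (bU : bounded_set U).
Implicit Types (h k : plane R -> R).

(** This class is stable under sums and products and is integrable over the bounded open set [U], so
    real-valued integrals can be handled linearly. *)
Definition bc h := (forall z, U z -> {for z, continuous h}) /\
  exists C, forall z, U z -> `|h z| <= C.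

Lemma bc_cst c : bc (fun=> c).
Proof. by split=> [z _|]; [exact: cvg_cst | exists `|c|]. Qed.

Lemma bcD h k : bc h -> bc k -> bc (fun z => h z + k z).
Proof.
move=> [ch [C hC]] [ck [D kD]]; split=> [z Uz|].
  by apply: cvgD; [exact: ch | exact: ck].
by exists (C + D) => z Uz; rewrite (le_trans (ler_normD _ _)) // lerD ?hC ?kD.
Qed.

Lemma bcM h k : bc h -> bc k -> bc (fun z => h z * k z).
Proof.
move=> [ch [C hC]] [ck [D kD]]; split=> [z Uz|].
  by apply: cvgM; [exact: ch | exact: ck].
by exists (C * D) => z Uz; rewrite normrM ler_pM ?hC ?kD.
Qed.

Lemma bcZ c h : bc h -> bc (fun z => c * h z).
Proof. by apply: bcM; exact: bc_cst. Qed.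

Lemma bc_eq h k : (forall z, h z = k z) -> bc h -> bc k.
Proof. by move=> /funext ->. Qed.

Lemma bcX h : bc h -> bc (fun z => h z ^+ 2).
Proof.
move=> bh; have -> : (fun z => h z ^+ 2) = (fun z => h z * h z) by apply/funext => z; rewrite expr2.
exact: bcM.
Qed.

Lemma bc_sum (I : Type) (r : seq I) (P : pred I) (h : I -> plane R -> R) :
  (forall i, P i -> bc (h i)) -> bc (fun z => \sum_(i <- r | P i) h i z).
Proof.
move=> bh; elim: r => [|i r ih].
  have -> : (fun z => \sum_(i <- [::] | P i) h i z) = fun=> 0.
    by apply/funext => z; rewrite big_nil.
  exact: bc_cst.
case: (boolP (P i)) => Pi.
  have -> : (fun z => \sum_(j <- i :: r | P j) h j z) = fun z => h i z + \sum_(j <- r | P j) h j z.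
    by apply/funext => z; rewrite big_cons Pi.
  by apply: bcD => //; exact: bh.
have -> : (fun z => \sum_(j <- i :: r | P j) h j z) = fun z => \sum_(j <- r | P j) h j z.
  by apply/funext => z; rewrite big_cons (negbTE Pi).
exact: ih.
Qed.

Definition Int h : R := \int[area R]_(z in U) h z.

Lemma bc_integrable h : bc h -> (area R).-integrable U (EFin \o (h : mplane R -> R)).
Proof.
move=> [ch [C hC]]; apply/integrableP; split.
  by apply/measurable_EFinP; exact: measurable_continuous_on.
apply: (@integral_bounded_lty R U (fun z => `|h z|) C) => //.
  by move=> z Uz; apply: cvg_norm; exact: ch.
by move=> z Uz; rewrite normr_ge0 hC.
Qed.

Lemma EFin_Int h : bc h -> (\int[area R]_(z in U) (h z)%:E = (Int h)%:E)%E.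
Proof.
move=> bh; rewrite /Int /Rintegral fineK //.
by apply: integrable_fin_num; [exact: measurable_open_plane | exact: bc_integrable].
Qed.

Lemma IntD h k : bc h -> bc k -> Int (fun z => h z + k z) = Int h + Int k.
Proof.
move=> bh bk; apply: RintegralD; [exact: measurable_open_plane | exact: bc_integrable | exact: bc_integrable].
Qed.

Lemma IntZ c h : bc h -> Int (fun z => c * h z) = c * Int h.
Proof. by move=> bh; apply: RintegralZl; [exact: measurable_open_plane | exact: bc_integrable]. Qed.

Lemma IntZD a b h k : bc h -> bc k ->
  Int (fun z => a * h z + b * k z) = a * Int h + b * Int k.
Proof. by move=> bh bk; rewrite IntD ?IntZ //; exact: bcZ. Qed.

Lemma Int_le h k : bc h -> bc k -> (forall z, U z -> h z <= k z) -> Int h <= Int k.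
Proof.
by move=> bh bk hk; apply: le_Rintegral => //;
  [exact: measurable_open_plane | exact: bc_integrable | exact: bc_integrable].
Qed.

Lemma Int_eq h k : (forall z, U z -> h z = k z) -> Int h = Int k.
Proof. by move=> hk; apply: eq_Rintegral => z /set_mem/hk. Qed.

Lemma Int_cst c : Int (fun=> c) = c * fine (area R U).
Proof. by apply: Rintegral_cst; exact: measurable_open_plane. Qed.

Lemma Int_sum (I : Type) (r : seq I) (P : pred I) (h : I -> plane R -> R) :
  (forall i, P i -> bc (h i)) ->
  Int (fun z => \sum_(i <- r | P i) h i z) = \sum_(i <- r | P i) Int (h i).
Proof.
move=> bh; elim: r => [|i r ih].
  rewrite [RHS]big_nil; transitivity (0 * fine (area R U)); last by rewrite mul0r.
  by rewrite -Int_cst; apply: Int_eq => z _; rewrite big_nil.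
rewrite big_cons; case: (boolP (P i)) => Pi; last first.
  by rewrite -ih; apply: Int_eq => z _; rewrite big_cons (negbTE Pi).
rewrite -ih -IntD; [|exact: bh|exact: bc_sum].
by apply: Int_eq => z _; rewrite big_cons Pi.
Qed.

(** A bound with separated variables reduces the integral over [U] to two one-variable integrals,
    evaluated by the primitives [P] and [Q]. *)
Lemma Int_le_rect (a b c d B : R) (P u Q v : R -> R) h : bc h ->
  (forall z, U z -> 0 <= h z) -> a < b -> c < d -> continuous u -> continuous v ->
  (forall t, 0 <= u t) -> (forall t, 0 <= v t) ->
  (forall t, is_derive t (1 : R) P (u t)) -> (forall t, is_derive t (1 : R) Q (v t)) ->
  (forall z, U z -> rect a b c d z -> h z <= u z.1 * v z.2) ->
  (forall z, U z -> ~ rect a b c d z -> h z = 0) ->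
  (P b - P a) * (Q d - Q c) <= B ->
  Int h <= B.
Proof.
move=> bh h0 ab cd cu cv u0 v0 dP dQ h1 h2 PB.
rewrite -lee_fin -EFin_Int //; apply: le_trans (_ : _ <= ((P b - P a) * (Q d - Q c))%:E)%E _; last by rewrite lee_fin.
rewrite -(integral_rect ab cd cu cv u0 v0 dP dQ).
have mU := measurable_open_plane oU.
rewrite [X in (X <= _)%E]integral_mkcond [X in (_ <= X)%E]integral_mkcond.
have uv0 z : 0 <= u z.1 * v z.2 by rewrite mulr_ge0.
apply: ge0_le_integral => //.
- move=> z _; rewrite patchE; case: ifPn => // /set_mem Uz; rewrite lee_fin; exact: h0.
- apply/(measurable_restrictT _ _).1 => //; apply/measurable_EFinP.
  by apply: measurable_continuous_on => //; case: bh.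
- apply/(measurable_restrictT _ _).1; first exact: measurable_rect.
  apply/measurable_EFinP; apply: measurable_funTS; apply: measurable_continuous => z.
  apply: cvgM.
    by apply: (@continuous_comp _ _ _ fst u); [exact: cvg_fst | exact: cu].
  by apply: (@continuous_comp _ _ _ snd v); [exact: cvg_snd | exact: cv].
- move=> z _; rewrite !patchE; case: ifPn => [/set_mem Uz|_]; last first.
    by case: ifP => // _; rewrite lee_fin.
  case: ifPn => [/set_mem rz|/negP rz]; rewrite lee_fin; first exact: h1.
  by rewrite h2 // => rz'; apply: rz; rewrite inE.
Qed.

End BoundedContinuous.

Section Rounding.
Variables (R : realType) (n : nat) (q : ('I_n -> R) -> R).

Let shift (c : 'I_n -> R) (i : 'I_n) (t : R) : 'I_n -> R := fun j => c j + t * (j == i)%:R.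

(* Averaging over the two roundings of one coefficient, weighted by its
   fractional part, costs at most a quarter of the diagonal term. *)
Lemma rounding (nu : 'I_n -> R) (J : pred 'I_n) :
  q (fun=> 0) = 0 -> (forall i, 0 <= q (fun j => (j == i)%:R)) ->
  (forall c i a, (1 - a) * q (shift c i (- a)) + a * q (shift c i (1 - a)) =
      q c + a * (1 - a) * q (fun j => (j == i)%:R)) ->
  exists m : 'I_n -> int,
    q (fun j => if J j then (m j)%:~R - nu j else 0) <=
    4^-1 * \sum_(j | J j) q (fun k => (k == j)%:R).
Proof.
move=> q0 qd qid.
(* The coefficients are rounded one after the other; those not yet treated count as [0], so the
   induction starts from [q 0 = 0]. *)
suff H (s : seq 'I_n) : uniq s -> exists m : 'I_n -> int,
    q (fun j => if J j && (j \in s) then (m j)%:~R - nu j else 0) <=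
    4^-1 * \sum_(j <- s | J j) q (fun k => (k == j)%:R).
  have [m hm] := H (index_enum 'I_n) (index_enum_uniq _); exists m.
  rewrite (_ : (fun j => if J j then _ else _) =
    fun j => if J j && (j \in index_enum 'I_n) then (m j)%:~R - nu j else 0) //.
  by apply/funext => j; rewrite mem_index_enum andbT.
elim: s => [_|i s ih /= /andP[nis us]].
  exists (fun=> 0); rewrite big_nil mulr0.
  rewrite (_ : (fun j => if _ then _ else _) = fun=> 0) ?q0 //.
  by apply/funext => j; rewrite andbF.
have [m hm] := ih us; case: (boolP (J i)) => Ji; last first.
  exists m; rewrite big_cons (negbTE Ji).
  rewrite (_ : (fun j => if J j && (j \in i :: s) then _ else _) =
    fun j => if J j && (j \in s) then (m j)%:~R - nu j else 0) //.
  apply/funext => j; rewrite in_cons; have [->|//] := eqVneq j i.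
  by rewrite (negbTE Ji).
set c := fun j => _ in hm.
pose a := nu i - (Num.floor (nu i))%:~R.
have a0 : 0 <= a by rewrite subr_ge0 floor_le_tmp.
have a1 : a < 1 by rewrite ltrBlDr addrC -intrD1 floorD1_gt.
have rd (t : R) (k : int) : k%:~R - nu i = t -> q (shift c i t) <= q c + a * (1 - a) * q (fun j => (j == i)%:R) ->
    exists m : 'I_n -> int,
    q (fun j => if J j && (j \in i :: s) then (m j)%:~R - nu j else 0) <=
    4^-1 * \sum_(j <- i :: s | J j) q (fun k => (k == j)%:R).
  move=> tE h; exists (fun j => if j == i then k else m j).
  rewrite (_ : (fun j => if _ then _ else _) = shift c i t); last first.
    apply/funext => j; rewrite /shift /c in_cons; have [->|ji] := eqVneq j i.
      by rewrite Ji (negbTE nis) add0r mulr1.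
    by rewrite mulr0 addr0.
  apply: (le_trans h); rewrite big_cons Ji [X in _ <= X]mulrDr [X in _ <= X]addrC lerD //.
  by rewrite ler_wpM2r //; have := sqr_ge0 (a - 1 / 2); lra.
have := qid c i a; set x := q (shift c i (- a)); set y := q (shift c i (1 - a)).
set z := q c + _ => E.
(* The weighted mean of [x] and [y] is [z], so one of the two roundings does not exceed [z]. *)
have [xz|xz] := leP x z.
  by apply: (rd (- a) (Num.floor (nu i))); rewrite // /a opprB.
have yz : y <= z.
  rewrite leNgt; apply/negP => yz.
  have : (1 - a) * z < (1 - a) * x by rewrite ltr_pM2l // subr_gt0.
  have : a * z <= a * y by rewrite ler_wpM2l // ltW.
  lra.
apply: (rd (1 - a) (Num.floor (nu i) + 1)) yz.
by rewrite /a intrD1; ring.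
Qed.

End Rounding.

(** * Windows in one variable *)

Section Windows.
Variable R : realType.
Implicit Types t : R.

Definition window t : R := sqrp (1 - t ^+ 2).
Definition window' t : R := 2 * Num.max 0 (1 - t ^+ 2) * (- 2 * t).

Lemma is_derive_window t : is_derive t (1 : R) window (window' t).
Proof.
have h1 : is_derive t (1 : R) (fun t : R => 1 - t ^+ 2) (- 2 * t).
  have h := is_deriveB (is_derive_cst (1 : R) t 1) (is_deriveX 2 (is_derive_id t (1 : R))).
  have -> : (fun t : R => 1 - t ^+ 2) = (cst 1 - id ^+ 2 : R -> R).
    by apply/funext => x; rewrite /= !fctE.
  by apply: is_derive_eq h _; rewrite /= expr1 sub0r [_ *: 1]mulr1 mulNr.
exact: (is_derive1_comp (is_derive_sqrp _) h1).
Qed.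

Lemma window_eq0 t : 1 <= `|t| -> window t = 0 /\ window' t = 0.
Proof.
move=> t1; have t2 : 1 - t ^+ 2 <= 0 by rewrite subr_le0 -(real_normK (num_real t)) expr_ge1.
by split; rewrite /window /window' ?sqrp_le0 // max_l // mulr0 mul0r.
Qed.

Lemma window_le1 t : window t ^+ 2 <= 1.
Proof.
have t2 := sqr_ge0 t.
have h : 0 <= Num.max 0 (1 - t ^+ 2) <= 1.
  by rewrite le_max lexx ge_max ler01 gerBl.
case/andP: h => h1 h2; rewrite /window /sqrp -exprM expr_le1 //.
Qed.

(** Here [1 - t^2 >= 3/4], and [(3/4)^4 = 81/256]. Every real number is within [1/2] of an integer,
    so this is the share of the mass that the windows keep. *)
Lemma window_half t : `|t| <= 1 / 2 -> 81 / 256 <= window t ^+ 2.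
Proof.
move=> th; have t2 : t ^+ 2 <= 1 / 4.
  rewrite -(real_normK (num_real t)); have := normr_ge0 t; nra.
rewrite /window sqrp_id; last lra.
have h : 3 / 4 <= 1 - t ^+ 2 by lra.
have h2 : 9 / 16 <= (1 - t ^+ 2) ^+ 2 by nra.
by nra.
Qed.

(** With [u = t^2 < 1] the square is [16 (1 - u)^2 u], and [(1 - u) u <= 1/4]. *)
Lemma window'_le t : window' t ^+ 2 <= 4.
Proof.
rewrite /window'; set m := Num.max 0 _.
have [t1|t1] := leP 1 (t ^+ 2).
  by rewrite /m max_l ?subr_le0 // mulr0 mul0r expr0n.
have -> : m = 1 - t ^+ 2 by rewrite /m max_r // subr_ge0 ltW.
have t2 := sqr_ge0 t; set u := t ^+ 2 in t1 t2 *.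
have -> : (2 * (1 - u) * (- 2 * t)) ^+ 2 = 16 * ((1 - u) ^+ 2 * u) by rewrite /u; ring.
have : (1 - u) * u <= 1 / 4 by have := sqr_ge0 (u - 1 / 2); lra.
nra.
Qed.

(* At most two consecutive windows are nonzero at a given point. *)
Lemma sum_two_le (N : nat) (F : nat -> R) (B : R) (i0 : nat) : (forall i, F i <= B) -> 0 <= B ->
  (forall i, i != i0 -> i != i0.+1 -> F i = 0) ->
  \sum_(i < N) F i <= 2 * B.
Proof.
move=> FB B0 F0.
have bnd (k : nat) : \sum_(i < N) B * (i == k :> nat)%:R <= B.
  rewrite -mulr_sumr; have [kN|kN] := ltnP k N.
    rewrite (bigD1 (Ordinal kN)) //= eqxx big1 ?addr0 ?mulr1 // => j.
    by rewrite -val_eqE /= => /negbTE ->.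
  by rewrite big1 ?mulr0 // => j _; rewrite ltn_eqF // (leq_trans (ltn_ord j)).
apply: (@le_trans _ _ (\sum_(i < N) (B * (i == i0 :> nat)%:R + B * (i == i0.+1 :> nat)%:R))).
  apply: ler_sum => i _; have [->|h1] := eqVneq (i : nat) i0.
    by rewrite mulr1 (le_trans (FB _)) // lerDl mulr_ge0.
  have [->|h2] := eqVneq (i : nat) i0.+1; first by rewrite mulr0 add0r mulr1.
  by rewrite F0 // !mulr0 addr0.
by rewrite big_split /= mulr_natl mulr2n lerD.
Qed.

Lemma window_far (x : R) (i : nat) : 0 <= x -> i != Num.truncn x -> i != (Num.truncn x).+1 ->
  1 <= `|x - i%:R|.
Proof.
move=> x0 h1 h2; have /andP[t1 t2] := truncn_itv x0.
rewrite ler_normr; apply/orP; move: h1 h2; rewrite neq_ltn => /orP[h1|h1] h2.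
  left; have : i.+1%:R <= (Num.truncn x)%:R :> R by rewrite ler_nat.
  rewrite -[i.+1]addn1 natrD; lra.
right; have h3 : ((Num.truncn x).+2 <= i)%N by rewrite ltn_neqAle eq_sym h2.
have : (Num.truncn x).+2%:R <= i%:R :> R by rewrite ler_nat.
rewrite -[(Num.truncn x).+2]addn1 natrD; lra.
Qed.

End Windows.

(** * The cutoff at the poles *)

Section Cutoff.
Variables (R : realType) (n : nat) (pole : 'I_n -> plane R) (r : R).
Hypothesis r0 : 0 < r.
Implicit Types z : plane R.

(** The fourth power of the distance serves twice: near the pole it makes [f^2 / |z - p|^2] bounded,
    and far away its decay is integrable over the plane. *)
Definition spike (p : plane R) z : R := r ^+ 4 / rho2 p z ^+ 2.
Definition spikes z : R := \sum_j spike (pole j) z.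
Definition cutoff_fun z : R := (1 + spikes z)^-1.
Definition spikes_dx z : R := \sum_j spike (pole j) z * (- 4 * ((z.1 - (pole j).1) / rho2 (pole j) z)).
Definition spikes_dy z : R := \sum_j spike (pole j) z * (- 4 * ((z.2 - (pole j).2) / rho2 (pole j) z)).
Definition cutoff_dx z : R := - (cutoff_fun z) ^+ 2 * spikes_dx z.
Definition cutoff_dy z : R := - (cutoff_fun z) ^+ 2 * spikes_dy z.

Lemma spike_ge0 p z : 0 <= spike p z.
Proof. by rewrite divr_ge0 ?sqr_ge0 // exprn_ge0 // ltW. Qed.

Lemma spikes_ge0 z : 0 <= spikes z.
Proof. by apply: sumr_ge0 => j _; exact: spike_ge0. Qed.

Lemma spike_le j z : spike (pole j) z <= spikes z.
Proof. by rewrite /spikes (bigD1 j) //= lerDl sumr_ge0 // => i _; exact: spike_ge0. Qed.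

Lemma cutoff_gt0 z : 0 < cutoff_fun z.
Proof. by rewrite invr_gt0 ltr_wpDr // spikes_ge0. Qed.

Lemma cutoff_le1 z : cutoff_fun z <= 1.
Proof. by rewrite invf_le1 ?lerDl ?spikes_ge0 // ltr_wpDr // spikes_ge0. Qed.

Lemma has_grad_rho2 p z : has_grad (rho2 p) z (2 * (z.1 - p.1)) (2 * (z.2 - p.2)).
Proof.
have h := has_gradD (has_gradX 2 (has_grad_fstB p z)) (has_gradX 2 (has_grad_sndB p z)).
by apply: has_grad_eq h _ _; rewrite /= !expr1 ?mulr0 ?addr0 ?add0r mulr1.
Qed.

Lemma has_grad_spike p z : z != p ->
  has_grad (spike p) z (spike p z * (- 4 * ((z.1 - p.1) / rho2 p z)))
    (spike p z * (- 4 * ((z.2 - p.2) / rho2 p z))).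
Proof.
move=> zp; have q0 : rho2 p z != 0 by rewrite rho2_eq0.
have q2 : rho2 p z ^+ 2 != 0 by rewrite expf_neq0.
have h := has_gradZ (r ^+ 4) (has_gradV q2 (has_gradX 2 (has_grad_rho2 p z))).
by apply: has_grad_eq h _ _; rewrite /spike /=; field.
Qed.

Variable D : set (plane R).
Hypothesis Dpole : forall z j, D z -> z != pole j.

Lemma has_grad_spikes z : D z -> has_grad spikes z (spikes_dx z) (spikes_dy z).
Proof. by move=> Dz; apply: has_grad_sum => j _; apply/has_grad_spike/Dpole. Qed.

Lemma has_grad_cutoff z : D z -> has_grad cutoff_fun z (cutoff_dx z) (cutoff_dy z).
Proof.
move=> Dz; have n0 : 1 + spikes z != 0 by rewrite gt_eqF // ltr_wpDr // spikes_ge0.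
have h := has_gradV n0 (has_gradD (has_grad_cst 1 z) (has_grad_spikes Dz)).
by apply: has_grad_eq h _ _; rewrite !add0r /cutoff_dx /cutoff_dy /cutoff_fun exprVn.
Qed.

Lemma continuous_at_sum (I : Type) (s : seq I) (F : I -> plane R -> R) z :
  (forall i, {for z, continuous (F i)}) ->
  {for z, continuous (fun z => \sum_(i <- s) F i z)}.
Proof.
move=> cF; elim: s => [|i s ih].
  have -> : (fun z => \sum_(i <- [::]) F i z) = cst 0.
    by apply/funext => x; rewrite big_nil.
  exact: cvg_cst.
have -> : (fun z => \sum_(j <- i :: s) F j z) = fun z => F i z + \sum_(j <- s) F j z.
  by apply/funext => x; rewrite big_cons.
by apply: cvgD; [exact: cF | exact: ih].
Qed.

Lemma continuous_cutoff_dxy z : D z ->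
  {for z, continuous cutoff_dx} /\ {for z, continuous cutoff_dy}.
Proof.
move=> Dz; have [cc _ _] := has_grad_cutoff Dz.
have c2 : {for z, continuous (fun z => - cutoff_fun z ^+ 2)}.
  by apply: cvgN; exact: continuous_sqr_at.
have cV j : {for z, continuous (fun z => (rho2 (pole j) z)^-1)}.
  have q0 : rho2 (pole j) z != 0 by rewrite rho2_eq0 Dpole.
  by have [] := has_gradV q0 (has_grad_rho2 (pole j) z).
have cs j : {for z, continuous (spike (pole j))}.
  by have [] := has_grad_spike (Dpole j Dz).
have cM (f g : plane R -> R) : {for z, continuous f} -> {for z, continuous g} ->
    {for z, continuous (fun z => f z * g z)} by move=> cf cg; apply: cvgM.
split; apply: (cM _ _ c2); apply: continuous_at_sum => j.
- apply: (cM (spike (pole j))); first exact: cs.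
  apply: (cM (fun=> - 4)); first exact: cvg_cst.
  apply: (cM (fun z => z.1 - (pole j).1) (fun z => (rho2 (pole j) z)^-1)); last exact: cV.
  by have [] := has_grad_fstB (pole j) z.
- apply: (cM (spike (pole j))); first exact: cs.
  apply: (cM (fun=> - 4)); first exact: cvg_cst.
  apply: (cM (fun z => z.2 - (pole j).2) (fun z => (rho2 (pole j) z)^-1)); last exact: cV.
  by have [] := has_grad_sndB (pole j) z.
Qed.

Lemma weighted_cauchy (h x : 'I_n -> R) : (forall j, 0 <= h j) ->
  (\sum_j h j * x j) ^+ 2 <= (\sum_j h j) * \sum_j h j * x j ^+ 2.
Proof.
move=> h0; set S := \sum_j h j; set P := \sum_j h j * x j; set Q := \sum_j h j * x j ^+ 2.
have S0 : 0 <= S by apply: sumr_ge0.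
(* The weighted variance, scaled by [S] to avoid a division; it equals [S * (S * Q - P ^+ 2)]. *)
have : 0 <= \sum_j h j * (S * x j - P) ^+ 2.
  by apply: sumr_ge0 => j _; rewrite mulr_ge0 ?sqr_ge0.
have -> : \sum_j h j * (S * x j - P) ^+ 2 = S * (S * Q - P ^+ 2).
  transitivity (\sum_j (S ^+ 2 * (h j * x j ^+ 2) + (- 2 * S * P) * (h j * x j) + P ^+ 2 * h j)).
    by apply: eq_bigr => j _; ring.
  by rewrite !big_split /= -!mulr_sumr -/S -/P -/Q; ring.
move: S0; rewrite le_eqVlt => /predU1P[S0 _|S0]; last by rewrite pmulr_rge0 // subr_ge0.
have hj j : h j = 0.
  by apply/eqP; rewrite eq_le h0 andbT S0 /S (bigD1 j) //= lerDl sumr_ge0.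
rewrite /P big1 ?expr0n /=; last by move=> j _; rewrite hj mul0r.
by rewrite -S0 mul0r.
Qed.

(** The bound by the deficit [1 - f], with a constant free of [n], is what keeps the cost of the
    cutoff linear in the number of poles. The Cauchy inequality with the spikes as weights prevents
    the gradients of many poles from adding up quadratically. *)
Lemma cutoff_grad_le z : D z ->
  cutoff_dx z ^+ 2 + cutoff_dy z ^+ 2 <= 2 / r ^+ 2 * (1 - cutoff_fun z).
Proof.
move=> Dz; pose h j := spike (pole j) z; pose q j := rho2 (pole j) z.
have h0 j : 0 <= h j by exact: spike_ge0.
have q0 j : 0 < q j by apply: rho2_gt0; exact: Dpole.
set S := spikes z; have S0 : 0 <= S by exact: spikes_ge0.
have gS : spikes_dx z ^+ 2 + spikes_dy z ^+ 2 <= 16 * (S * \sum_j h j / q j).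
  have ex : spikes_dx z = - 4 * \sum_j h j * ((z.1 - (pole j).1) / q j).
    by rewrite mulr_sumr; apply: eq_bigr => j _; rewrite /h /q; ring.
  have ey : spikes_dy z = - 4 * \sum_j h j * ((z.2 - (pole j).2) / q j).
    by rewrite mulr_sumr; apply: eq_bigr => j _; rewrite /h /q; ring.
  have c1 := weighted_cauchy (fun j => (z.1 - (pole j).1) / q j) h0.
  have c2 := weighted_cauchy (fun j => (z.2 - (pole j).2) / q j) h0.
  rewrite ex ey !exprMn -mulrDr.
  have -> : (- 4) ^+ 2 = 16 :> R by ring.
  rewrite ler_pM2l //; apply: (le_trans (lerD c1 c2)); rewrite -mulrDr ler_wpM2l //.
  rewrite -big_split /=; apply: ler_sum => j _; rewrite -mulrDr ler_wpM2l //.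
  rewrite !expr_div_n -mulrDl -/(rho2 (pole j) z) -/(q j) expr2 invfM mulrA.
  by rewrite divff ?mul1r // gt_eqF.
(* With [u = r^2 / q] one has [h = u^2], and the claim is [u^3 <= (u^2 + u^4) / 2]. *)
have hq j : h j / q j <= (h j + h j ^+ 2) / (2 * r ^+ 2).
  have u0 : 0 <= r ^+ 2 / q j by rewrite divr_ge0 ?sqr_ge0 // ltW.
  have hu : h j = (r ^+ 2 / q j) ^+ 2 by rewrite /h /spike -/(q j) expr_div_n -exprM.
  have -> : (q j)^-1 = (r ^+ 2 / q j) / r ^+ 2.
    by rewrite mulrAC divff ?mul1r // expf_neq0 // gt_eqF.
  rewrite hu; set u := r ^+ 2 / q j in u0 *.
  have -> : (u ^+ 2 + u ^+ 2 ^+ 2) / (2 * r ^+ 2) = (u ^+ 2 + u ^+ 2 ^+ 2) / 2 / r ^+ 2.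
    by field; rewrite gt_eqF.
  rewrite mulrA ler_wpM2r ?invr_ge0 ?sqr_ge0 //.
  have := sqr_ge0 (u * (1 - u)); rewrite -subr_ge0.
  have -> : (u ^+ 2 + (u ^+ 2) ^+ 2) / 2 - u ^+ 2 * u = (u * (1 - u)) ^+ 2 / 2 by field.
  by move=> ?; rewrite divr_ge0.
have hq_sum : \sum_j h j / q j <= (S + S ^+ 2) / (2 * r ^+ 2).
  apply: (@le_trans _ _ (\sum_j (h j + h j ^+ 2) / (2 * r ^+ 2))).
    by apply: ler_sum => j _.
  rewrite -mulr_suml ler_wpM2r ?invr_ge0 ?mulr_ge0 ?exprn_ge0 ?(ltW r0) //.
  rewrite big_split /= lerD // expr2 {1}/S /spikes mulr_suml; apply: ler_sum => j _.
  by rewrite expr2 ler_wpM2l // spike_le.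
have S1 : 0 < 1 + S by rewrite ltr_wpDr.
have -> : cutoff_dx z ^+ 2 + cutoff_dy z ^+ 2 =
    (spikes_dx z ^+ 2 + spikes_dy z ^+ 2) / (1 + S) ^+ 4.
  by rewrite /cutoff_dx /cutoff_dy /cutoff_fun -/S; field; rewrite gt_eqF.
rewrite ler_pdivrMr ?exprn_gt0 //; apply: (le_trans gS).
apply: (@le_trans _ _ (16 * (S * ((S + S ^+ 2) / (2 * r ^+ 2))))).
  by rewrite ler_pM2l // ler_wpM2l.
rewrite /cutoff_fun -/S.
have -> : 2 / r ^+ 2 * (1 - (1 + S)^-1) * (1 + S) ^+ 4 = 2 * S * (1 + S) ^+ 3 / r ^+ 2.
  by field; rewrite !gt_eqF.
have -> : 16 * (S * ((S + S ^+ 2) / (2 * r ^+ 2))) = 8 * S ^+ 2 * (1 + S) / r ^+ 2.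
  by field; rewrite gt_eqF.
rewrite ler_pM2r ?invr_gt0 ?exprn_gt0 // -subr_ge0.
(* What remains is [4 S <= (1 + S)^2]. *)
have -> : 2 * S * (1 + S) ^+ 3 - 8 * S ^+ 2 * (1 + S) = 2 * S * (1 + S) * (1 - S) ^+ 2 by ring.
apply: mulr_ge0; last exact: sqr_ge0.
by apply: mulr_ge0; [apply: mulr_ge0 | exact: ltW].
Qed.

(** Each pole contributes at most [h / (1 + h) = 1 / (1 + q^2)], where [q = X^2 + Y^2] is the
    squared distance in units of [r]. To separate variables, [(1 + X^2) (1 + Y^2) <= 1 + q + q^2 / 4
    <= 5/4 (1 + q^2)], the last gap being [(q - 1/2)^2]. *)
Lemma cutoff_deficit z : D z ->
  1 - cutoff_fun z <= \sum_j (5 / 4 * (1 + ((z.1 - (pole j).1) / r) ^+ 2)^-1) *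
                                 (1 + ((z.2 - (pole j).2) / r) ^+ 2)^-1.
Proof.
move=> Dz; set S := spikes z; have S0 : 0 <= S by exact: spikes_ge0.
have S1 : 0 < 1 + S by rewrite ltr_wpDr.
have -> : 1 - cutoff_fun z = \sum_j spike (pole j) z / (1 + S).
  by rewrite /cutoff_fun -mulr_suml -/(spikes z) -/S; field; rewrite gt_eqF.
apply: ler_sum => j _; have hS := spike_le j z; have h0 := spike_ge0 (pole j) z.
set h := spike _ z in hS h0 *.
have q0 : 0 < rho2 (pole j) z by apply: rho2_gt0; exact: Dpole.
apply: (@le_trans _ _ (h / (1 + h))).
  by rewrite ler_wpM2l // lef_pV2 ?posrE ?ltr_wpDr // lerD2l.
set X := (z.1 - _) / r; set Y := (z.2 - _) / r.
have X0 := sqr_ge0 X; have Y0 := sqr_ge0 Y.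
pose q := X ^+ 2 + Y ^+ 2.
have qE : rho2 (pole j) z = r ^+ 2 * q.
  by rewrite /q /X /Y /rho2; field; rewrite gt_eqF.
have q1 : 0 < q by move: q0; rewrite qE pmulr_rgt0 // exprn_gt0.
have hE : h = (q ^+ 2)^-1.
  by rewrite /h /spike qE; field; rewrite !gt_eqF.
have -> : h / (1 + h) = (1 + q ^+ 2)^-1.
  rewrite hE; field; rewrite !gt_eqF // ltr_wpDr // exprn_ge0 // ltW //.
have qq : 0 < 1 + q ^+ 2 by rewrite ltr_wpDr ?sqr_ge0.
rewrite ler_pdivlMr ?ltr_wpDr // ler_pdivlMr ?ltr_wpDr // -mulrA mulrC ler_pdivrMr //.
have : X ^+ 2 * Y ^+ 2 <= q ^+ 2 / 4.
  by have := sqr_ge0 (X ^+ 2 - Y ^+ 2); rewrite /q; lra.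
by have := sqr_ge0 (q - 1 / 2); rewrite /q; lra.
Qed.

Lemma cutoff_sqr_ge z : 1 - 2 * (1 - cutoff_fun z) <= cutoff_fun z ^+ 2.
Proof. by have := sqr_ge0 (1 - cutoff_fun z); lra. Qed.

(** Only the spike at [pole j] is kept, which gives [q / (q^2 + r^4)]; then [5/4 (q^2 + r^4) - q
    (r^2 + q) = (q/2 - r^2)^2 + r^4 / 4]. The bound depends on the second coordinate alone, so its
    integral over a vertical band is proportional to the width. *)
Lemma cutoff_dth_le j z : D z ->
  cutoff_fun z ^+ 2 / rho2 (pole j) z <= 5 / 4 / (r ^+ 2 + (z.2 - (pole j).2) ^+ 2).
Proof.
move=> Dz; have hS := spike_le j z; have h0 := spike_ge0 (pole j) z.
set h := spike _ z in hS h0 *.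
have q0 : 0 < rho2 (pole j) z by apply: rho2_gt0; exact: Dpole.
set q := rho2 _ z in q0 *.
have r2 : 0 < r ^+ 2 by rewrite exprn_gt0.
have c0 := cutoff_gt0 z; have c1 := cutoff_le1 z.
apply: (@le_trans _ _ ((1 + h)^-1 / q)).
  rewrite ler_wpM2r ?invr_ge0 ?(ltW q0) //.
  apply: (@le_trans _ _ (cutoff_fun z)); first by rewrite expr2 ler_piMl // ltW.
  by rewrite /cutoff_fun lef_pV2 ?posrE ?ltr_wpDr ?lerD2l ?spikes_ge0.
have -> : (1 + h)^-1 / q = q / (q ^+ 2 + r ^+ 4).
  have hE : h = r ^+ 4 / q ^+ 2 by [].
  have n1 : q ^+ 2 + r ^+ 4 != 0.
    by rewrite gt_eqF // ltr_wpDr ?exprn_gt0 // exprn_ge0 // ltW.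
  have n2 : q != 0 by rewrite gt_eqF.
  by rewrite hE; field; rewrite ?n1 ?n2.
have Y0 := sqr_ge0 (z.2 - (pole j).2); set Y := _ ^+ 2 in Y0 *.
have Yq : Y <= q by rewrite /q /rho2 /Y lerDr sqr_ge0.
have qr : 0 < q ^+ 2 + r ^+ 4 by rewrite ltr_wpDr ?exprn_gt0 // exprn_ge0 ?ltW.
rewrite ler_pdivrMr // mulrAC ler_pdivlMr ?ltr_wpDr //.
apply: (@le_trans _ _ (q * (r ^+ 2 + q))); first by rewrite ler_pM2l // lerD2l.
have := sqr_ge0 (q / 2 - r ^+ 2); have := sqr_ge0 (r ^+ 2).
have -> : r ^+ 4 = r ^+ 2 ^+ 2 by rewrite -exprM.
set u := r ^+ 2; lra.
Qed.

End Cutoff.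

Section WindowSums.
Variables (R : realType) (x : R) (N : nat).
Hypothesis x0 : 0 <= x.

Lemma sum_window_le (P : pred 'I_N) : \sum_(i < N | P i) window (x - i%:R) ^+ 2 <= 2.
Proof.
apply: (@le_trans _ _ (\sum_(i < N) window (x - i%:R) ^+ 2)).
  rewrite [X in _ <= X](bigID P) /= lerDl sumr_ge0 // => i _; exact: sqr_ge0.
rewrite -[X in _ <= X]mulr1; apply: (@sum_two_le R N (fun i => window (x - i%:R) ^+ 2) 1 (Num.truncn x)) => //.
  by move=> i; exact: window_le1.
by move=> i h1 h2; have [-> _] := window_eq0 (window_far x0 h1 h2); rewrite expr0n.
Qed.

Lemma sum_window'_le : \sum_(i < N) window' (x - i%:R) ^+ 2 <= 8.
Proof.
have -> : 8 = 2 * 4 :> R by ring.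
apply: (@sum_two_le R N (fun i => window' (x - i%:R) ^+ 2) 4 (Num.truncn x)) => //.
  by move=> i; exact: window'_le.
by move=> i h1 h2; have [_ ->] := window_eq0 (window_far x0 h1 h2); rewrite expr0n.
Qed.

Lemma sum_window_ge : ((Num.truncn x).+1 < N)%N ->
  81 / 256 <= \sum_(i < N) window (x - i%:R) ^+ 2.
Proof.
move=> xN; have /andP[t1 t2] := truncn_itv x0.
rewrite -[(Num.truncn x).+1]addn1 natrD in t2.
have [i iN hi] : exists2 i, (i < N)%N & `|x - i%:R| <= 1 / 2.
  have [h|h] := leP (x - (Num.truncn x)%:R) (1 / 2).
    exists (Num.truncn x); first exact: ltnW.
    by rewrite ger0_norm ?subr_ge0.
  exists (Num.truncn x).+1 => //; rewrite -[(Num.truncn x).+1]addn1 natrD.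
  by rewrite ler_norml; apply/andP; split; lra.
rewrite (bigD1 (Ordinal iN)) //=; apply: (le_trans (window_half hi)).
by rewrite lerDl sumr_ge0 // => j _; exact: sqr_ge0.
Qed.

End WindowSums.

(** * Integrals of the cutoff *)

Section CutoffIntegral.
Variables (R : realType) (U : set (plane R)) (n : nat) (pole : 'I_n -> plane R) (r : R).
Hypotheses (oU : open U) (bU : bounded_set U) (r0 : 0 < r).
Hypothesis Upole : forall j, ~ U (pole j).
Local Notation f := (cutoff_fun pole r).
Local Notation fx := (cutoff_dx pole r).
Local Notation fy := (cutoff_dy pole r).

Let Dpole z j : U z -> z != pole j.
Proof. by move=> Uz; apply/eqP => zp; apply: (Upole (j := j)); rewrite -zp. Qed.

Lemma bc_sqr_bound (h : plane R -> R) C : (forall z, U z -> {for z, continuous h}) ->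
  (forall z, U z -> h z ^+ 2 <= C) -> bc U h.
Proof.
move=> ch hC; split=> //; exists (1 + C) => z Uz.
have := hC z Uz; rewrite -(real_normK (num_real (h z))).
have := sqr_ge0 (`|h z| - 1 / 2); lra.
Qed.

Lemma bc_cutoff : bc U f.
Proof.
apply: (@bc_sqr_bound _ 1) => z Uz; first by have [] := has_grad_cutoff r0 Dpole Uz.
by rewrite expr_le1 // ?cutoff_le1 // ltW // cutoff_gt0.
Qed.

Lemma cutoff_grad_bound z : U z -> fx z ^+ 2 + fy z ^+ 2 <= 2 / r ^+ 2.
Proof.
move=> Uz; apply: (le_trans (cutoff_grad_le r0 Dpole Uz)).
rewrite ler_piMr ?divr_ge0 ?sqr_ge0 //.
by rewrite gerBl ltW // cutoff_gt0.
Qed.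

Lemma bc_cutoff_dx : bc U fx.
Proof.
apply: (@bc_sqr_bound _ (2 / r ^+ 2)) => z Uz.
  by have [] := continuous_cutoff_dxy r0 Dpole Uz.
by apply: le_trans (cutoff_grad_bound Uz); rewrite lerDl sqr_ge0.
Qed.

Lemma bc_cutoff_dy : bc U fy.
Proof.
apply: (@bc_sqr_bound _ (2 / r ^+ 2)) => z Uz.
  by have [] := continuous_cutoff_dxy r0 Dpole Uz.
by apply: le_trans (cutoff_grad_bound Uz); rewrite lerDr sqr_ge0.
Qed.

Lemma continuous_rho2V j z : U z -> {for z, continuous (fun z => (rho2 (pole j) z)^-1)}.
Proof.
move=> Uz; have q0 : rho2 (pole j) z != 0 by rewrite rho2_eq0 Dpole.
by have [] := has_gradV q0 (has_grad_rho2 (pole j) z).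
Qed.

Lemma continuous_dth j z : U z -> {for z, continuous (fun z => (dth (pole j) z).1)} /\
  {for z, continuous (fun z => (dth (pole j) z).2)}.
Proof.
move=> Uz; have cV := continuous_rho2V (j := j) Uz; split; apply: cvgM => //.
  by have [] := has_gradN (has_grad_sndB (pole j) z).
by have [] := has_grad_fstB (pole j) z.
Qed.

Lemma sqr_dth j z : U z -> (dth (pole j) z).1 ^+ 2 + (dth (pole j) z).2 ^+ 2 = (rho2 (pole j) z)^-1.
Proof.
move=> Uz; have q0 : rho2 (pole j) z != 0 by rewrite rho2_eq0 Dpole.
rewrite /dth /= !expr_div_n -mulrDl sqrrN addrC -/(rho2 (pole j) z).
by field.
Qed.

Lemma cutoff_dth_bound j z : U z -> f z ^+ 2 / rho2 (pole j) z <= 5 / 4 / r ^+ 2.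
Proof.
move=> Uz; apply: (le_trans (cutoff_dth_le r0 Dpole j Uz)).
have r2 : 0 < r ^+ 2 by rewrite exprn_gt0.
have Y0 := sqr_ge0 (z.2 - (pole j).2).
by apply: ler_wpM2l; rewrite ?divr_ge0 // lef_pV2 ?posrE ?ltr_wpDr // lerDl.
Qed.

Lemma bc_cutoff_dth j : bc U (fun z => f z * (dth (pole j) z).1) /\
  bc U (fun z => f z * (dth (pole j) z).2).
Proof.
have [cf _] := bc_cutoff.
split; apply: (@bc_sqr_bound _ (5 / 4 / r ^+ 2)) => z Uz.
- by apply: cvgM; [exact: cf | exact: (continuous_dth j Uz).1].
- apply: le_trans (cutoff_dth_bound j Uz); rewrite -sqr_dth // exprMn ler_wpM2l ?sqr_ge0 //.
  by rewrite lerDl sqr_ge0.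
- by apply: cvgM; [exact: cf | exact: (continuous_dth j Uz).2].
- apply: le_trans (cutoff_dth_bound j Uz); rewrite -sqr_dth // exprMn ler_wpM2l ?sqr_ge0 //.
  by rewrite lerDr sqr_ge0.
Qed.

Lemma is_derive_atan_scaled (k a t : R) : is_derive t (1 : R)
  (fun t => k * r * atan ((t - a) / r)) (k * (1 + ((t - a) / r) ^+ 2)^-1).
Proof.
have h1 : is_derive t (1 : R) (fun t : R => (t - a) / r) r^-1.
  have h := is_deriveM (is_deriveB (is_derive_id t (1 : R)) (is_derive_cst a t 1)) (is_derive_cst r^-1 t (1 : R)).
  by apply: is_derive_eq h _; rewrite /= scaler0 add0r subr0 [_ *: 1]mulr1.
have h2 := is_derive1_comp (is_derive1_atan _) h1.
have h3 := is_deriveZ (k * r) h2.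
apply: is_derive_eq h3 _; rewrite /GRing.scale /=; set y := (1 + _)^-1.
by field; rewrite gt_eqF.
Qed.

Lemma atan_diff_le (u v : R) : atan u - atan v <= pi.
Proof. have := atan_ltpi2 u; have := atan_gtNpi2 v; lra. Qed.

Lemma continuous_atan_density (k a : R) : continuous (fun t : R => k * (1 + ((t - a) / r) ^+ 2)^-1).
Proof.
move=> t; apply: cvgM; first exact: cvg_cst.
have c : {for t, continuous (fun t : R => 1 + ((t - a) / r) ^+ 2)}.
  apply: cvgD; first exact: cvg_cst.
  apply: (@continuous_sqr_at R R (fun t => (t - a) / r) t).
  apply: cvgM; last exact: cvg_cst.
  by apply: cvgB; [exact: cvg_id | exact: cvg_cst].
by apply: cvgV => //; rewrite gt_eqF // ltr_wpDr // sqr_ge0.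
Qed.

Lemma atan_density_ge0 (k a t : R) : 0 <= k -> 0 <= k * (1 + ((t - a) / r) ^+ 2)^-1.
Proof. by move=> k0; rewrite mulr_ge0 // invr_ge0 addr_ge0 // sqr_ge0. Qed.

Lemma bc_atan_density (k : R) j : bc U (fun z => k * (1 + ((z.1 - (pole j).1) / r) ^+ 2)^-1) /\
  bc U (fun z => k * (1 + ((z.2 - (pole j).2) / r) ^+ 2)^-1).
Proof.
have le1 (t a : R) : (k * (1 + ((t - a) / r) ^+ 2)^-1) ^+ 2 <= k ^+ 2.
  rewrite exprMn ler_piMr ?sqr_ge0 // expr_le1 ?invr_ge0 ?addr_ge0 ?sqr_ge0 //.
  by rewrite invf_le1 ?lerDl ?ltr_wpDr ?sqr_ge0.
split; apply: (@bc_sqr_bound _ (k ^+ 2)) => z Uz //.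
  apply: (@continuous_comp _ _ _ fst (fun t => k * (1 + ((t - (pole j).1) / r) ^+ 2)^-1)).
    exact: cvg_fst.
  exact: continuous_atan_density.
apply: (@continuous_comp _ _ _ snd (fun t => k * (1 + ((t - (pole j).2) / r) ^+ 2)^-1)).
  exact: cvg_snd.
exact: continuous_atan_density.
Qed.

(** For each pole the separated bound integrates to arctangents, at most [5/4 * r * pi] in one
    variable and [r * pi] in the other. *)
Lemma Int_deficit_le : Int U (fun z => 1 - f z) <= n%:R * (5 / 4 * pi ^+ 2 * r ^+ 2).
Proof.
have [M M0 hM] := bounded_box bU.
have bf : bc U (fun z => 1 - f z).
  have := bcD (bc_cst U 1) (bcZ (-1) bc_cutoff).
  by have -> : (fun z => 1 + -1 * f z) = (fun z => 1 - f z) by apply/funext => z; rewrite mulN1r.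
pose d j z := (5 / 4 * (1 + ((z.1 - (pole j).1) / r) ^+ 2)^-1) * (1 * (1 + ((z.2 - (pole j).2) / r) ^+ 2)^-1).
have bd j : bc U (d j).
  by apply: bcM; [exact: (bc_atan_density (5 / 4) j).1 | exact: (bc_atan_density 1 j).2].
apply: (@le_trans _ _ (Int U (fun z => \sum_j d j z))).
  apply: Int_le => //; first exact: bc_sum.
  move=> z Uz; apply: (le_trans (cutoff_deficit r0 Dpole Uz)).
  by apply: ler_sum => j _; rewrite /d mul1r.
rewrite Int_sum // -[n in n%:R]card_ord mulr_natl -sumr_const; apply: ler_sum => j _.
apply: (@Int_le_rect R U oU bU (- M) M (- M) M _
  (fun t => 5 / 4 * r * atan ((t - (pole j).1) / r)) (fun t => 5 / 4 * (1 + ((t - (pole j).1) / r) ^+ 2)^-1)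
  (fun t => 1 * r * atan ((t - (pole j).2) / r)) (fun t => 1 * (1 + ((t - (pole j).2) / r) ^+ 2)^-1)) => //.
- by move=> z _; rewrite mulr_ge0 // atan_density_ge0.
- by lra.
- by lra.
- exact: continuous_atan_density.
- exact: continuous_atan_density.
- by move=> t; exact: atan_density_ge0.
- by move=> t; exact: atan_density_ge0.
- by move=> t; exact: is_derive_atan_scaled.
- by move=> t; exact: is_derive_atan_scaled.
- move=> z /hM[h1 h2] nr; exfalso; apply: nr.
  by split; rewrite /= in_itv /= -ler_norml ltW.
- rewrite -!mulrBr.
  have -> : 5 / 4 * pi ^+ 2 * r ^+ 2 = (5 / 4 * r * pi) * (1 * r * pi) by ring.
  have r1 := ltW r0.
  have mono (u v : R) : u < v -> 0 <= atan v - atan u by move=> uv; rewrite subr_ge0 ltW // lt_atan.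
  have lt2 a : (- M - a) / r < (M - a) / r by rewrite ltr_pM2r ?invr_gt0 //; lra.
  by rewrite ler_pM ?mulr_ge0 ?mono // ler_wpM2l ?mulr_ge0 ?atan_diff_le.
Qed.

End CutoffIntegral.

(** * Energy in one strip *)

Section StripEnergy.
Variables (R : realType) (U : set (plane R)) (n : nat) (pole : 'I_n -> plane R).
Variables (A : plane R -> plane R) (F1 F2 : plane R -> R) (nu : 'I_n -> R) (err : plane R -> R).
Variables (r s e l M : R).
Hypotheses (oU : open U) (bU : bounded_set U) (U0 : U !=set0).
Hypotheses (r0 : 0 < r) (s0 : 0 < s).
Hypothesis Upole : forall j, ~ U (pole j).
Hypotheses (cF1 : continuous F1) (cF2 : continuous F2) (cerr : continuous err).
Hypothesis AE : forall z, U z -> A z = (F1 z, F2 z).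
Hypothesis err_e : forall z, U z -> `|err z| <= e.
Hypothesis exA : exact_on U (fun z => A z - \sum_j nu j *: dth (pole j) z - (0, err z)).
Hypothesis lla : (l%:E <= lambda1 U A)%E.
Local Notation f := (cutoff_fun pole r).
Local Notation fx := (cutoff_dx pole r).
Local Notation fy := (cutoff_dy pole r).

Definition strip_coord (z : plane R) : R := (z.1 + M) / s.
Local Notation tau := strip_coord.
Definition strip (i : nat) z : R := window (tau z - i%:R).
Definition strip_dx (i : nat) z : R := window' (tau z - i%:R) / s.
Local Notation om := strip.
Local Notation om' := strip_dx.
Definition in_strip i (j : 'I_n) := `|tau (pole j) - i%:R| < 1.

Let Dpole z j : U z -> z != pole j.
Proof. by move=> Uz; apply/eqP => zp; apply: (Upole (j := j)); rewrite -zp. Qed.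

Lemma has_grad_strip i z : has_grad (om i) z (om' i z) 0.
Proof.
have h1 : has_grad (fun z => tau z - i%:R) z s^-1 0.
  have h := has_gradB (has_gradM (has_gradD (has_grad_fst z) (has_grad_cst M z))
    (has_grad_cst s^-1 z)) (has_grad_cst i%:R z).
  by apply: has_grad_eq h _ _; rewrite ?(addr0, mulr0, mulr1, add0r, subr0).
by apply: has_grad_eq (has_grad_comp (is_derive_window _) h1) _ _; rewrite ?mulr0.
Qed.

Lemma continuous_strip i : continuous (om i).
Proof. by move=> z; have [] := has_grad_strip i z. Qed.

Lemma continuous_tau : continuous tau.
Proof.
move=> z; apply: cvgM; last exact: cvg_cst.
by apply: cvgD; [exact: cvg_fst | exact: cvg_cst].
Qed.

Lemma continuous_strip_dx i : continuous (om' i).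
Proof.
have cw : continuous (@window' R).
  move=> t; apply: cvgM; last by apply: cvgM; [exact: cvg_cst | exact: cvg_id].
  apply: cvgM; first exact: cvg_cst.
  apply: (@continuous_comp _ _ _ (fun t : R => 1 - t ^+ 2) (fun t : R => Num.max 0 t)); last exact: continuous_max0.
  apply: cvgB; first exact: cvg_cst.
  exact: (@continuous_sqr_at R R id t (@cvg_id _ _)).
move=> z; apply: cvgM; last exact: cvg_cst.
apply: (@continuous_comp _ _ _ (fun z => tau z - i%:R) (@window' R)); last exact: cw.
by apply: cvgB; [exact: continuous_tau | exact: cvg_cst].
Qed.

Lemma bc_strip i : bc U (om i).
Proof.
by apply: (@bc_sqr_bound _ _ _ 1) => z _; [exact: continuous_strip | exact: window_le1].
Qed.

Lemma bc_strip_dx i : bc U (om' i).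
Proof.
apply: (@bc_sqr_bound _ _ _ (4 / s ^+ 2)) => z _; first exact: continuous_strip_dx.
by rewrite expr_div_n ler_wpM2r ?invr_ge0 ?sqr_ge0 // window'_le.
Qed.

(** The product with the cutoff is bounded on [U]; the angular form alone need not be, as a pole may
    lie on the frontier. *)
Let v1 j z := f z * (dth (pole j) z).1.
Let v2 j z := f z * (dth (pole j) z).2.
Let bv1 j : bc U (v1 j). Proof. by have [] := bc_cutoff_dth r0 Upole j. Qed.
Let bv2 j : bc U (v2 j). Proof. by have [] := bc_cutoff_dth r0 Upole j. Qed.
Let P i (c : 'I_n -> R) z :=
  (om i z * \sum_j c j * v1 j z) ^+ 2 + (om i z * \sum_j c j * v2 j z) ^+ 2.

Let bP i c : bc U (P i c).
Proof.
by apply: bcD; apply: bcX; apply: bcM (bc_strip i) _; apply: bc_sum => j _; apply: bcZ;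
  [exact: bv1 | exact: bv2].
Qed.

(** The energy [Int U (P i c)] is a quadratic form in [c], so the averaging identity of [rounding]
    is a pointwise identity of squares, and the diagonal terms are integrals of [f^2 / |z - p_j|^2]
    against the window. *)
Lemma strip_rounding i : exists m : 'I_n -> int,
  Int U (P i (fun j => if in_strip i j then (m j)%:~R - nu j else 0)) <=
  4^-1 * \sum_(j | in_strip i j) Int U (fun z => om i z ^+ 2 * (f z ^+ 2 / rho2 (pole j) z)).
Proof.
have sumd (v : 'I_n -> R) j0 : \sum_j (j == j0)%:R * v j = v j0.
  rewrite (bigD1 j0) //= eqxx mul1r big1 ?addr0 // => j /negbTE ->.
  by rewrite mul0r.
have [||c j a|m hm] := @rounding R n (fun c => Int U (P i c)) nu (in_strip i).
- transitivity (Int U (fun=> 0)); last by rewrite Int_cst ?mul0r.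
  apply: Int_eq => z _; rewrite /P !big1 ?mulr0 ?expr0n ?addr0 // => j _; by rewrite mul0r.
- by move=> j; apply: Rintegral_ge0 => z _; rewrite addr_ge0 ?sqr_ge0.
- rewrite -[Int U (P i c)]mul1r -!IntZD //; try exact: bP.
  apply: Int_eq => z _; rewrite /P.
  have sh (v : 'I_n -> R) t : \sum_k (c k + t * (k == j)%:R) * v k = \sum_k c k * v k + t * v j.
    rewrite -(sumd v j) mulr_sumr -big_split /=; apply: eq_bigr => k _; by rewrite mulrDl mulrA.
  rewrite !sh !sumd; ring.
exists m; apply: (le_trans hm); rewrite ler_pM2l ?invr_gt0 //.
apply: ler_sum => j _; rewrite le_eqVlt; apply/orP; left; apply/eqP.
apply: Int_eq => z Uz; rewrite /P !sumd /v1 /v2 -(sqr_dth Upole j Uz); ring.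
Qed.

Lemma strip_energy i :
  l * Int U (fun z => (om i z * f z) ^+ 2) <=
    2 * Int U (fun z => om' i z ^+ 2) +
    2 * Int U (fun z => om i z ^+ 2 * (fx z ^+ 2 + fy z ^+ 2)) +
    2 * e ^+ 2 * Int U (fun z => om i z ^+ 2) +
    2^-1 * \sum_(j | in_strip i j) Int U (fun z => om i z ^+ 2 * (f z ^+ 2 / rho2 (pole j) z)).
Proof.
have [m hm] := strip_rounding i.
set c := fun j => _ in hm.
pose V := U `&` [set z | `|tau z - i%:R| < 1].
have oV : open V.
  apply: openI => //.
  have -> : [set z | `|tau z - i%:R| < 1] = (fun z => 1 - `|tau z - i%:R|) @^-1` [set t | 0 < t].
    by apply/seteqP; split=> z; rewrite /= subr_gt0.
  apply: open_comp; last exact: open_gt.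
  move=> z _; apply: cvgB; first exact: cvg_cst.
  by apply: cvg_norm; apply: cvgB; [exact: continuous_tau | exact: cvg_cst].
have VU : V `<=` U by move=> z [].
(* This is [A] plus the rounding correction minus the error. Equivalently, it is an exact form plus
   integer multiples of [dth p_j] for the poles in the strip and multiples [nu j] for the others, so
   it has a phase, and [w - A] is small. *)
pose w z : plane R := (F1 z + \sum_j c j * (dth (pole j) z).1,
                       F2 z + \sum_j c j * (dth (pole j) z).2 - err z).
have sum1 (a : 'I_n -> R) z : \sum_j a j *: dth (pole j) z =
    (\sum_j a j * (dth (pole j) z).1, \sum_j a j * (dth (pole j) z).2).
  by elim/big_rec3: _ => // j x y u _ ->; apply/eqP; rewrite xpair_eqE /= !eqxx.
have cE (x : 'I_n -> R) : \sum_j c j * x j =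
    \sum_j (if in_strip i j then (m j)%:~R else nu j) * x j - \sum_j nu j * x j.
  rewrite -sumrB; apply: eq_bigr => j _; rewrite /c; case: ifP => _; ring.
have phw : has_phase U V w.
  have h1 := has_phase_exact U (exact_onW VU exA).
  have h2 : has_phase U V (fun z => \sum_j (if in_strip i j then (m j)%:~R else nu j) *: dth (pole j) z).
    apply: has_phase_sum => j; case: ifPn => ij.
      by apply: has_phase_int; apply: has_phase_dth.
    (* The vertical line through a pole outside the strip misses [V], so its angle is single-valued
       there and any real coefficient is allowed. *)
    apply: has_phase_exact; apply: exact_onZ; apply: exact_dth_off_line => z [_ /= hz].
    by apply: contraNneq ij => zp; move: hz; rewrite /in_strip /tau zp.
  apply: has_phase_eq (has_phaseD h1 h2) => z [Uz _].
  rewrite AE // !sum1 /w; apply/eqP; rewrite xpair_eqE /=; apply/andP; split; apply/eqP.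
    by rewrite (cE (fun j => (dth (pole j) z).1)) /=; ring.
  by rewrite (cE (fun j => (dth (pole j) z).2)) /=; ring.
pose g z := om i z * f z.
pose gx z := om i z * fx z + f z * om' i z.
pose gy z := om i z * fy z.
have gg z : U z -> [/\ has_grad g z (gx z) (gy z), {for z, continuous gx} & {for z, continuous gy}].
  move=> Uz; have gf := has_grad_cutoff r0 Dpole Uz; have [cx cy] := continuous_cutoff_dxy r0 Dpole Uz.
  split.
  - by apply: has_grad_eq (has_gradM (has_grad_strip i z) gf) _ _; rewrite /gy ?mulr0 ?addr0.
  - apply: cvgD; apply: cvgM => //; [exact: continuous_strip | by case: gf | exact: continuous_strip_dx].
  - by apply: cvgM => //; exact: continuous_strip.
have bf := bc_cutoff r0 Upole.
have bfx := bc_cutoff_dx r0 Upole.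
have bfy := bc_cutoff_dy r0 Upole.
pose E z := gx z ^+ 2 + gy z ^+ 2 +
  ((om i z * \sum_j c j * v1 j z) ^+ 2 + (om i z * \sum_j c j * v2 j z - g z * err z) ^+ 2).
have berr : bc U err.
  by split=> [z _|]; [exact: cerr | exists e].
have bg : bc U g by apply: bcM (bc_strip i) bf.
have bgx : bc U gx.
  by apply: bcD; [exact: bcM (bc_strip i) bfx | exact: bcM bf (bc_strip_dx i)].
have bgy : bc U gy by exact: bcM (bc_strip i) bfy.
have bE : bc U E.
  apply: bcD; first by apply: bcD; exact: bcX.
  apply: bcD; apply: bcX; first by apply: bcM (bc_strip i) _; apply: bc_sum => j _; apply: bcZ; exact: bv1.
  have bS : bc U (fun z => \sum_j c j * v2 j z) by apply: bc_sum => j _; apply: bcZ; exact: bv2.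
  have := bcD (bcM (bc_strip i) bS) (bcZ (-1) (bcM bg berr)).
  apply: bc_eq => z; by rewrite mulN1r.
have [C1 hC1] : exists C, forall z, U z -> `|g z ^+ 2| <= C by case: (bcX bg).
have [C2 hC2] : exists C, forall z, U z -> `|E z| <= C by case: bE.
have EE z : U z -> gx z ^+ 2 + gy z ^+ 2 + g z ^+ 2 * (((w z).1 - (A z).1) ^+ 2 + ((w z).2 - (A z).2) ^+ 2) = E z.
  move=> Uz; rewrite AE //= /E; congr (_ + _).
  have -> : \sum_j c j * v1 j z = f z * \sum_j c j * (dth (pole j) z).1.
    by rewrite mulr_sumr; apply: eq_bigr => j _; rewrite /v1; ring.
  have -> : \sum_j c j * v2 j z = f z * \sum_j c j * (dth (pole j) z).2.
    by rewrite mulr_sumr; apply: eq_bigr => j _; rewrite /v2; ring.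
  rewrite /g; ring.
have := @trial_glued R U V A w F1 F2 g gx gy (Num.max C1 C2) l oU oV VU bU U0 cF1 cF2 AE phw _ gg _ _ lla.
rewrite /=.
have -> : (\int[area R]_(z in U) (g z ^+ 2)%:E = (Int U (fun z => g z ^+ 2))%:E)%E.
  by apply: EFin_Int => //; exact: bcX.
have -> : (\int[area R]_(z in U) (gx z ^+ 2 + gy z ^+ 2 + g z ^+ 2 *
    (((w z).1 - (A z).1) ^+ 2 + ((w z).2 - (A z).2) ^+ 2))%:E = (Int U E)%:E)%E.
  by rewrite -EFin_Int //; apply: eq_integral => z /set_mem Uz; rewrite EE.
rewrite -EFinM lee_fin => H; apply: (le_trans (H _ _ _)).
- move=> z Uz; split.
    apply: cvgD; first exact: cF1.
    apply: continuous_at_sum => j; apply: cvgM; first exact: cvg_cst.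
    exact: (continuous_dth Upole j Uz).1.
  apply: cvgB; last exact: cerr.
  apply: cvgD; first exact: cF2.
  apply: continuous_at_sum => j; apply: cvgM; first exact: cvg_cst.
  exact: (continuous_dth Upole j Uz).2.
- move=> z Uz nVz.
  have : 1 <= `|tau z - i%:R| by rewrite leNgt; apply/negP => hz; apply: nVz.
  move=> /window_eq0[w0 w0']; rewrite /g /gx /gy /om /om' /strip /strip_dx w0 w0'.
  by rewrite !mul0r mulr0 addr0.
- move=> z Uz; rewrite EE // !le_max; split; apply/orP; [left|right].
    exact: le_trans (ler_norm _) (hC1 z Uz).
  exact: le_trans (ler_norm _) (hC2 z Uz).
have b1 : bc U (fun z => om' i z ^+ 2) by apply: bcX; exact: bc_strip_dx.
have b2 : bc U (fun z => om i z ^+ 2 * (fx z ^+ 2 + fy z ^+ 2)).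
  by apply: bcM; [apply: bcX; exact: bc_strip | apply: bcD; exact: bcX].
have b3 : bc U (fun z => om i z ^+ 2) by apply: bcX; exact: bc_strip.
have b4 := bP i c.
apply: (@le_trans _ _ (2 * Int U (fun z => om' i z ^+ 2) +
    2 * Int U (fun z => om i z ^+ 2 * (fx z ^+ 2 + fy z ^+ 2)) +
    2 * e ^+ 2 * Int U (fun z => om i z ^+ 2) + 2 * Int U (P i c))); last first.
  rewrite lerD2l; apply: (le_trans (_ : _ <= 2 * (4^-1 *
    \sum_(j | in_strip i j) Int U (fun z => om i z ^+ 2 * (f z ^+ 2 / rho2 (pole j) z))))).
    by rewrite ler_pM2l.
  by rewrite mulrA; have -> : 2 * 4^-1 = 2^-1 :> R by field.
rewrite -!IntZ // -!IntD;
  try (by repeat (first [exact: b1 | exact: b2 | exact: b3 | exact: b4 | apply: bcZ | apply: bcD])).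
apply: Int_le => //.
  by repeat (first [exact: b1 | exact: b2 | exact: b3 | exact: b4 | apply: bcZ | apply: bcD]).
move=> z Uz; rewrite /E /P /gx /gy /g.
have f0 := cutoff_gt0 pole r0 z; have f1 := cutoff_le1 pole r0 z.
have f2 : f z ^+ 2 <= 1 by rewrite expr_le1 // ltW.
have e2 : err z ^+ 2 <= e ^+ 2.
  rewrite -(real_normK (num_real (err z))) lerXn2r ?nnegrE //; last exact: err_e.
  exact: le_trans (err_e Uz).
(* The density is split with [(x + y)^2 <= 2 x^2 + 2 y^2]; this factor [2] turns the quarter of the
   rounding into [2^-1]. *)
set a := om i z; set b := om' i z; set X := \sum_j c j * v1 j z; set Y := \sum_j c j * v2 j z.
have h1 : (a * fx z + f z * b) ^+ 2 <= 2 * (a ^+ 2 * fx z ^+ 2) + 2 * b ^+ 2.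
  have := sqr_ge0 (a * fx z - f z * b); have : f z ^+ 2 * b ^+ 2 <= b ^+ 2 by rewrite ler_piMl ?sqr_ge0.
  by lra.
have h2 : (a * fy z) ^+ 2 <= 2 * (a ^+ 2 * fy z ^+ 2) by have := sqr_ge0 (a * fy z); lra.
have h3 : (a * X) ^+ 2 <= 2 * (a * X) ^+ 2 by have := sqr_ge0 (a * X); lra.
have h4 : (a * Y - a * f z * err z) ^+ 2 <= 2 * (a * Y) ^+ 2 + 2 * e ^+ 2 * a ^+ 2.
  have := sqr_ge0 (a * Y + a * f z * err z).
  have : a ^+ 2 * (f z ^+ 2 * err z ^+ 2) <= a ^+ 2 * e ^+ 2.
    rewrite ler_wpM2l ?sqr_ge0 //; apply: le_trans e2; by rewrite ler_piMl ?sqr_ge0.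
  by lra.
lra.
Qed.

End StripEnergy.

(** * Sum over the strips *)

Section TotalEnergy.
Variables (R : realType) (U : set (plane R)) (n : nat) (pole : 'I_n -> plane R).
Variables (r s M : R).
Hypotheses (oU : open U) (bU : bounded_set U) (r0 : 0 < r) (s0 : 0 < s) (M0 : 0 < M).
Hypothesis UM : forall z, U z -> `|z.1| < M /\ `|z.2| < M.
Hypothesis Upole : forall j, ~ U (pole j).
Local Notation f := (cutoff_fun pole r).
Local Notation tau := (strip_coord s M).
Local Notation om := (strip s M).
Local Notation om' := (strip_dx s M).
Local Notation a := (fine (area R U)).

Let Dpole z j : U z -> z != pole j.
Proof. by move=> Uz; apply/eqP => zp; apply: (Upole (j := j)); rewrite -zp. Qed.

Let tau_ge0 z : U z -> 0 <= tau z.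
Proof. by move=> /UM[h _]; rewrite divr_ge0 ?(ltW s0) //; have := ler_norm (- z.1); rewrite normrN; lra. Qed.

Let bcs i : bc U (fun z => om i z ^+ 2).
Proof. by apply: bcX; exact: bc_strip. Qed.

Lemma Int_strip_dx_le N : \sum_(i < N) Int U (fun z => om' i z ^+ 2) <= 8 / s ^+ 2 * a.
Proof.
rewrite -Int_cst // -Int_sum //; last by move=> i _; apply: bcX; exact: bc_strip_dx.
apply: Int_le => //; first by apply: bc_sum => i _; apply: bcX; exact: bc_strip_dx.
  exact: bc_cst.
move=> z Uz; under eq_bigr do rewrite /strip_dx expr_div_n.
by rewrite -mulr_suml ler_wpM2r ?invr_ge0 ?sqr_ge0 // sum_window'_le // tau_ge0.
Qed.

Lemma Int_strip_le N (h : plane R -> R) : bc U h -> (forall z, U z -> 0 <= h z) ->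
  \sum_(i < N) Int U (fun z => om i z ^+ 2 * h z) <= 2 * Int U h.
Proof.
move=> bh h0; have bo i : bc U (fun z => om i z ^+ 2 * h z) by exact: bcM (bcs i) bh.
rewrite -IntZ // -Int_sum //; apply: Int_le => //; [exact: bc_sum | exact: bcZ |].
move=> z Uz; rewrite -mulr_suml ler_wpM2r ?h0 //.
exact: (@sum_window_le R (tau z) N (tau_ge0 Uz) xpredT).
Qed.

(** On [U] the coordinate [tau] lies between [0] and [2 * M / s], so these strips include, for each
    point, the integer nearest to [tau]. The loss due to the cutoff is controlled by
    [f^2 >= 1 - 2 (1 - f)]. *)
Lemma Int_strip_ge : 81 / 256 * (a - 2 * Int U (fun z => 1 - f z)) <=
  \sum_(i < (Num.truncn (2 * M / s)).+2) Int U (fun z => (om i z * f z) ^+ 2).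
Proof.
set N := (Num.truncn (2 * M / s)).+2; have bf := bc_cutoff r0 Upole.
have bd : bc U (fun z => 1 - f z).
  by apply: bc_eq (bcD (bc_cst U 1) (bcZ (-1) bf)) => z; rewrite mulN1r.
have b1 := bcD (bc_cst U 1) (bcZ (-2) bd).
have -> : 81 / 256 * (a - 2 * Int U (fun z => 1 - f z)) =
    Int U (fun z => 81 / 256 * (1 + -2 * (1 - f z))).
  rewrite (IntZ oU bU _ b1); congr (_ * _).
  by rewrite (IntD oU bU (bc_cst U 1) (bcZ (-2) bd)) (IntZ oU bU _ bd) Int_cst // mul1r mulNr.
have bg (i : nat) : bc U (fun z => (om i z * f z) ^+ 2) by apply: bcX; exact: bcM (bc_strip _ _ _ i) bf.
rewrite -Int_sum //; apply: Int_le => //; [exact: bcZ | exact: bc_sum |].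
move=> z Uz; under eq_bigr do rewrite exprMn; rewrite -mulr_suml.
have h1 := cutoff_sqr_ge pole r z.
apply: (@le_trans _ _ (81 / 256 * f z ^+ 2)); first by rewrite ler_pM2l // mulNr.
rewrite ler_wpM2r ?sqr_ge0 //; apply: sum_window_ge; first exact: tau_ge0.
rewrite /N ltnS ltnS; apply: le_truncn; rewrite ler_pM2r ?invr_gt0 //.
by have [h _] := UM Uz; have := ler_norm z.1; lra.
Qed.

(** The strips that contain the pole live within horizontal distance [2 * s] of it, and their
    squared windows sum to at most [2]. The total is thus at most [4 * s] times the integral of
    [5/2 / (r^2 + y^2)], which is at most [5/2 * pi / r]. *)
Lemma Int_spike_strip_le N j :
  \sum_(i < N | in_strip pole s M i j) Int U (fun z => om i z ^+ 2 * (f z ^+ 2 / rho2 (pole j) z)) <=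
  10 * pi * (s / r).
Proof.
have [bv1 bv2] := bc_cutoff_dth r0 Upole j.
have bq : bc U (fun z => f z ^+ 2 / rho2 (pole j) z).
  split; last first.
    exists (5 / 4 / r ^+ 2) => z Uz; rewrite ger0_norm ?(cutoff_dth_bound r0 Upole) //.
    by rewrite divr_ge0 ?sqr_ge0 // rho2_ge0.
  move=> z Uz; apply: cvgM; last exact: (@continuous_rho2V R U n pole Upole j z Uz).
  by apply: continuous_sqr_at; have [cf _] := bc_cutoff r0 Upole; exact: cf.
have bo (i : nat) : bc U (fun z => om i z ^+ 2 * (f z ^+ 2 / rho2 (pole j) z)) by exact: bcM (bcs i) bq.
have q0 z : 0 <= f z ^+ 2 / rho2 (pole j) z by rewrite divr_ge0 ?sqr_ge0 // rho2_ge0.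
rewrite -Int_sum //; set p := pole j; pose k : R := 5 / (2 * r ^+ 2).
have r2 : 0 < r ^+ 2 by rewrite exprn_gt0.
have k0 : 0 <= k by rewrite divr_ge0 // mulr_ge0 // ltW.
apply: (@Int_le_rect R U oU bU (p.1 - 2 * s) (p.1 + 2 * s) (- M) M _
  id (fun=> 1) (fun t => k * r * atan ((t - p.2) / r)) (fun t => k * (1 + ((t - p.2) / r) ^+ 2)^-1)) => //.
- exact: bc_sum.
- by move=> z _; apply: sumr_ge0 => i _; rewrite mulr_ge0 ?sqr_ge0.
- by rewrite ltrBlDr -addrA ltrDl addr_gt0 // mulr_gt0.
- by have := M0; lra.
- by move=> t; exact: cvg_cst.
- exact: continuous_atan_density.
- by move=> t; exact: atan_density_ge0.
- by move=> t; exact: is_derive_atan_scaled.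
- move=> z Uz _; rewrite -mulr_suml mul1r.
  apply: (@le_trans _ _ (2 * (5 / 4 / (r ^+ 2 + (z.2 - p.2) ^+ 2)))).
    apply: ler_pM => //; first by apply: sumr_ge0 => i _; rewrite sqr_ge0.
      exact: (@sum_window_le R (tau z) N (tau_ge0 Uz) (fun i => in_strip pole s M i j)).
    exact: (cutoff_dth_le r0 Dpole j Uz).
  rewrite le_eqVlt; apply/orP; left; apply/eqP.
  have h1 : r ^+ 2 + (z.2 - p.2) ^+ 2 != 0 by rewrite gt_eqF // ltr_wpDr // sqr_ge0.
  have h2 : r != 0 by rewrite gt_eqF.
  by rewrite /k; field; rewrite ?h1 ?h2.
- move=> z Uz nr; rewrite big1 // => i ij.
  suff /window_eq0[w _] : 1 <= `|tau z - i%:R| by rewrite /strip w expr0n mul0r.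
  have [_ z2] := UM Uz.
  have : 2 * s < `|z.1 - p.1|.
    rewrite ltNge; apply/negP => h; apply: nr; split; rewrite /= in_itv /=.
      by move: h; rewrite ler_norml => /andP[? ?]; apply/andP; split; lra.
    by rewrite -ler_norml ltW.
  have -> : z.1 - p.1 = (tau z - tau p) * s by rewrite /strip_coord; field; rewrite gt_eqF.
  rewrite normrM (gtr0_norm s0) ltr_pM2r // => h.
  move: ij; rewrite /in_strip -/p => ij.
  have := ler_distD i%:R (tau z) (tau p); rewrite (distrC i%:R); lra.
- have -> : 10 * pi * (s / r) = (4 * s) * (k * r * pi).
    by rewrite /k; field; rewrite gt_eqF.
  have -> : p.1 + 2 * s - (p.1 - 2 * s) = 4 * s by ring.
  rewrite -mulrBr ler_pM2l ?mulr_gt0 // ler_wpM2l ?atan_diff_le //.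
  by rewrite mulr_ge0 // ltW.
Qed.

Variables (A : plane R -> plane R) (F1 F2 : plane R -> R) (nu : 'I_n -> R) (err : plane R -> R).
Variables (e l : R).
Hypotheses (U0 : U !=set0) (l0 : 0 <= l).
Hypotheses (cF1 : continuous F1) (cF2 : continuous F2) (cerr : continuous err).
Hypothesis AE : forall z, U z -> A z = (F1 z, F2 z).
Hypothesis err_e : forall z, U z -> `|err z| <= e.
Hypothesis exA : exact_on U (fun z => A z - \sum_j nu j *: dth (pole j) z - (0, err z)).
Hypothesis lla : (l%:E <= lambda1 U A)%E.

(** The strip inequalities are added up. On the right come the windows, the gradient of the cutoff,
    the rounding and the error; [B] bounds the integral of [1 - f]. *)
Lemma energy_inequality B : B = n%:R * (5 / 4 * pi ^+ 2 * r ^+ 2) ->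
  l * (81 / 256 * (a - 2 * B)) <=
  16 / s ^+ 2 * a + 8 / r ^+ 2 * B + 5 * pi * (s / r) * n%:R + 4 * e ^+ 2 * a.
Proof.
move=> BE; set D := Int U (fun z => 1 - f z).
have DB : D <= B by rewrite BE; exact: Int_deficit_le.
pose N := (Num.truncn (2 * M / s)).+2.
have h1 := Int_strip_ge.
have h2 := Int_strip_dx_le N.
have bd : bc U (fun z => 1 - f z).
  by apply: bc_eq (bcD (bc_cst U 1) (bcZ (-1) (bc_cutoff r0 Upole))) => z; rewrite mulN1r.
have bG : bc U (fun z => cutoff_dx pole r z ^+ 2 + cutoff_dy pole r z ^+ 2).
  by apply: bcD; apply: bcX; [exact: (bc_cutoff_dx r0 Upole) | exact: (bc_cutoff_dy r0 Upole)].
have h3 : \sum_(i < N) Int U (fun z =>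
    om i z ^+ 2 * (cutoff_dx pole r z ^+ 2 + cutoff_dy pole r z ^+ 2)) <= 2 * (2 / r ^+ 2 * D).
  apply: (le_trans (Int_strip_le N bG _)); first by move=> z _; rewrite addr_ge0 ?sqr_ge0.
  rewrite ler_pM2l // /D -IntZ //; apply: Int_le => //; first exact: bcZ.
  by move=> z Uz; exact: (cutoff_grad_le r0 Dpole Uz).
have h4 : \sum_(i < N) Int U (fun z => om i z ^+ 2) <= 2 * a.
  have := @Int_strip_le N (fun=> 1) (bc_cst U 1) (fun _ _ => ler01); rewrite Int_cst // mul1r.
  apply: le_trans; rewrite le_eqVlt; apply/orP; left; apply/eqP.
  by apply: eq_bigr => i _; apply: Int_eq => z _; rewrite mulr1.
have h5 : \sum_(i < N) \sum_(j | in_strip pole s M i j) Int U (fun z =>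
    om i z ^+ 2 * (f z ^+ 2 / rho2 (pole j) z)) <= 10 * pi * (s / r) * n%:R.
  have -> : 10 * pi * (s / r) * n%:R = \sum_(j < n) 10 * pi * (s / r) by rewrite sumr_const card_ord mulr_natr.
  (* Summing over the poles first, each pole is charged only for the strips that contain it. *)
  rewrite (exchange_big_dep xpredT) //=.
  by apply: ler_sum => j _; exact: Int_spike_strip_le.
have r2 : 0 < r ^+ 2 by rewrite exprn_gt0.
have s2 : 0 < s ^+ 2 by rewrite exprn_gt0.
apply: (@le_trans _ _ (l * \sum_(i < N) Int U (fun z => (om i z * f z) ^+ 2))).
  rewrite ler_wpM2l //; apply: le_trans h1; rewrite -/D; lra.
apply: (@le_trans _ _ (\sum_(i < N) (2 * Int U (fun z => om' i z ^+ 2) +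
    2 * Int U (fun z => om i z ^+ 2 * (cutoff_dx pole r z ^+ 2 + cutoff_dy pole r z ^+ 2)) +
    2 * e ^+ 2 * Int U (fun z => om i z ^+ 2) +
    2^-1 * \sum_(j | in_strip pole s M i j) Int U (fun z => om i z ^+ 2 * (f z ^+ 2 / rho2 (pole j) z))))).
  rewrite mulr_sumr; apply: ler_sum => i _.
  exact: (strip_energy s M oU bU U0 r0 Upole cF1 cF2 cerr AE err_e exA lla i).
rewrite !big_split /= -!mulr_sumr.
have k3 : 2 * (2 * (2 / r ^+ 2 * D)) <= 8 / r ^+ 2 * B.
  have -> : 2 * (2 * (2 / r ^+ 2 * D)) = 8 / r ^+ 2 * D by ring.
  by rewrite ler_wpM2l // divr_ge0 // ltW.
have k4 : 2 * e ^+ 2 * (\sum_(i < N) Int U (fun z => om i z ^+ 2)) <= 4 * e ^+ 2 * a.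
  apply: (le_trans (ler_wpM2l _ h4)); first by rewrite mulr_ge0 ?sqr_ge0.
  by rewrite le_eqVlt; apply/orP; left; apply/eqP; ring.
have k2 : 2 * (8 / s ^+ 2 * a) = 16 / s ^+ 2 * a by ring.
lra.
Qed.

End TotalEnergy.

(** Here [p] stands for [pi]. The parameters chosen leave [81/512 * l * a] on the left and
    [66/5 * p^2 * m + 26 * p * m] on the right. By [p < 4] the right side is below [78.8 * p * m],
    and [78.8 * 512 / 81 < 544]. *)
Lemma energy_optimum (R : realType) (p m a l : R) : 0 < p -> p < 4 -> 0 <= m -> 0 < a -> 0 < l ->
  (forall r s e B : R, 0 < r -> 0 < s -> 0 < e -> B = m * (5 / 4 * p ^+ 2 * r ^+ 2) ->
    l * (81 / 256 * (a - 2 * B)) <=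
    16 / s ^+ 2 * a + 8 / r ^+ 2 * B + 5 * p * (s / r) * m + 4 * e ^+ 2 * a) ->
  l * a <= 544 * p * m.
Proof.
move=> p0 p4; rewrite le_eqVlt => /predU1P[<- a0 l0 main|m0 a0 l0 main].
  (* Without holes only the windows and the error cost anything. These choices make each equal to
     [l * a / 16], together less than [81/256 * l * a], a contradiction. *)
  have s0 : 0 < Num.sqrt (256 / l) by rewrite sqrtr_gt0 divr_gt0 ?ltr0n.
  have e0 : 0 < Num.sqrt (l / 64) by rewrite sqrtr_gt0 divr_gt0 ?ltr0n.
  have := main 1 _ _ _ ltr01 s0 e0 (erefl _).
  rewrite !mul0r !mulr0 !addr0 subr0 !sqr_sqrtr ?divr_ge0 ?ler0n ?(ltW l0) //.
  have -> : 16 / (256 / l) * a = l * a / 16 by field; rewrite gt_eqF.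
  have := mulr_gt0 l0 a0; lra.
(* This value makes [B = a / 4], so that half of the area survives on the left; then [s = 5 * r],
   and [e] is such that the error costs [p * m]. *)
pose r2 := a / (5 * p ^+ 2 * m).
have r20 : 0 < r2 by rewrite divr_gt0 ?mulr_gt0 ?exprn_gt0.
pose r := Num.sqrt r2; have r0 : 0 < r by rewrite sqrtr_gt0.
have rE : r ^+ 2 = r2 by rewrite sqr_sqrtr // ltW.
have e20 : 0 < p * m / (4 * a) by rewrite divr_gt0 ?mulr_gt0.
have s0 : 0 < 5 * r by rewrite mulr_gt0.
have e0 : 0 < Num.sqrt (p * m / (4 * a)) by rewrite sqrtr_gt0.
have := main r _ _ _ r0 s0 e0 (erefl _).
rewrite [(5 * r) ^+ 2]exprMn rE (sqr_sqrtr (ltW e20)).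
have -> : 5 * r / r = 5 by rewrite mulfK // gt_eqF.
have np : p != 0 by rewrite gt_eqF.
have nm : m != 0 by rewrite gt_eqF.
have na : a != 0 by rewrite gt_eqF.
have -> : m * (5 / 4 * p ^+ 2 * r2) = a / 4 by rewrite /r2; field; rewrite np nm.
have -> : 16 / (5 ^+ 2 * r2) * a = 16 / 5 * p ^+ 2 * m by rewrite /r2; field; rewrite np nm na.
have -> : 8 / r2 * (a / 4) = 10 * p ^+ 2 * m by rewrite /r2; field; rewrite np nm na.
have -> : 4 * (p * m / (4 * a)) * a = p * m by field.
have pm := mulr_gt0 p0 m0.
have : p ^+ 2 * m < 4 * (p * m) by rewrite expr2 -mulrA ltr_pM2r // mulr_gt0.
lra.
Qed.

Theorem theorem1 (R : realType) :
  exists C : R,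
    [/\ 0 < C, C = 544 * pi &
      forall (Omega : set (R * R)) (n : nat) (A : R * R -> R * R),
        domain Omega -> bounded_set Omega -> smooth_boundary Omega ->
        has_holes n Omega ->
        potential Omega A -> closed_form Omega A ->
        (lambda1 Omega A <= (C * (n%:R / fine (area R Omega)))%:E)%E].
Proof.
have pi0 := pi_gt0 R.
have pi4 : pi < 4 :> R by have := pihalf_lt2 R; lra.
have c0 : 0 < 544 :> R by rewrite ltr0n.
have C0 : 0 < 544 * pi :> R := mulr_gt0 c0 pi0.
exists (544 * pi); split; [exact: C0 | reflexivity |].
move=> Omega n A dO bO sO hO pA clA; have [neO oO _] := dO.
have [F1 [F2 [pole [cF1 cF2 AE npole dec]]]] := closed_form_decomposition dO bO sO hO pA clA.
have [M M0 hM] := bounded_box bO.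
set a := fine (area R Omega).
have a0 : 0 < a.
  by apply: fine_gt0; rewrite area_open_gt0 // area_bounded.
rewrite leNgt; apply/negP => lt_la.
(* [lambda1] is an extended real; a finite [l] above the claimed bound is needed for the real
   inequalities. *)
have [l [lC lla]] : exists l, 544 * pi * (n%:R / a) < l /\ (l%:E <= lambda1 Omega A)%E.
  move: lt_la; case: (lambda1 Omega A) => [l|_|//].
    by rewrite lte_fin => h; exists l.
  by exists (544 * pi * (n%:R / a) + 1); rewrite ltrDl ltr01 leey.
have l0 : 0 < l by apply: le_lt_trans lC; exact: (mulr_ge0 (ltW C0) (divr_ge0 (ler0n R n) (ltW a0))).
have main (r s e B : R) : 0 < r -> 0 < s -> 0 < e -> B = n%:R * (5 / 4 * pi ^+ 2 * r ^+ 2) ->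
  l * (81 / 256 * (a - 2 * B)) <=
  16 / s ^+ 2 * a + 8 / r ^+ 2 * B + 5 * pi * (s / r) * n%:R + 4 * e ^+ 2 * a.
  move=> r0 s0 e0 BE; have [nu [err [cerr err_e exA]]] := dec e e0.
  exact: (@energy_inequality R Omega n pole r s M oO bO r0 s0 M0 hM npole A F1 F2 nu err e l
    neO (ltW l0) cF1 cF2 cerr AE err_e exA lla B BE).
have := energy_optimum pi0 pi4 (ler0n R n) a0 l0 main.
by rewrite leNgt => /negP; apply; move: lC; rewrite mulrA ltr_pdivrMr.
Qed.
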